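(* For $k\ge 3$, $$\begin{bmatrix}\lambda^1(t_1,\dots,t_k,z)\\ \lambda^2(t_1,\dots,t_k,z)\\ \mathcal{E}^1(t_1,\dots,t_k,z)\\ \mathcal{E}^2(t_1,\dots,t_k,z)\end{bmatrix}=A(t_{k-1},t_k,z)\begin{bmatrix}\lambda^1(t_1,\dots,t_{k-1},z)\\ \lambda^2(t_1,\dots,t_{k-1},z)\\ \mathcal{E}^1(t_1,\dots,t_{k-1},z)\\ \mathcal{E}^2(t_1,\dots,t_{k-1},z)\end{bmatrix},$$ where $A(t_{k-1},t_k,z)=[A_{ij}]_{i,j=1}^4$ is the $4\times 4$ matrix with entries, writing $D=1-2t_k-4zt_k-16z^2t_k^2$ and $D'=1-t_k-4zt_k-16z^2t_k^2$, $$A_{11}=\frac{16z^2t_k}{D},\quad A_{12}=0,\quad A_{13}=\frac{t_k(1+2z)+8z^2t_k^2}{D},\quad A_{14}=0,$$ $$A_{21}=A_{11}-16z^2t_k,\quad A_{22}=0,\quad A_{23}=A_{13}-t_k(1+2z),\quad A_{24}=0,$$ $$A_{31}=\frac{16z^2t_kA_{11}}{D'},\quad A_{32}=\frac{16z^2t_{k-1}^{-1}t_k}{D'},\quad A_{33}=\frac{16z^2t_k+16z^2t_kA_{13}}{D'},\quad A_{34}=\frac{(1+4z)t_{k-1}^{-1}t_k+16z^2t_{k-1}^{-1}t_k^2}{D'},$$ $$A_{41}=A_{31},\quad A_{42}=A_{32}-16z^2t_{k-1}^{-1}t_k,\quad A_{43}=A_{33}-16z^2t_k,\quad A_{44}=A_{34}-(1+4z)t_{k-1}^{-1}t_k.$$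 Furthermore, $$\begin{bmatrix}\lambda^1(t_1,\dots,t_k,z)\\ \lambda^2(t_1,\dots,t_k,z)\\ \mathcal{E}^1(t_1,\dots,t_k,z)\\ \mathcal{E}^2(t_1,\dots,t_k,z)\end{bmatrix}=A(t_{k-1},t_k,z)\cdots A(t_2,t_3,z)\begin{bmatrix}\lambda^1(t_1,t_2,z)\\ \lambda^2(t_1,t_2,z)\\ \mathcal{E}^1(t_1,t_2,z)\\ \mathcal{E}^2(t_1,t_2,z)\end{bmatrix},$$ where $A(t_{j-1},t_j,z)$ is obtained from the matrix $A(t_{k-1},t_k,z)=[A_{ij}]_{i,j=1}^4$ by replacing $t_{k-1},t_k$ by $t_{j-1},t_j$.
   Context: Euler-genus polynomial. The Euler-genus of a closed surface is $2j$ for the orientable surface with $j$ handles and $c$ for the non-orientable surface with $c$ crosscaps. A pure rotation system of a graph $G$ assigns to every vertex a cyclic permutation of its incident edges; a general rotation system is a pure rotation system together with a map $\tau:E(G)\to\{0,1\}$ (an edge $e$ is twisted if $\tau(e)=1$, untwisted otherwise); it determines a cellular embedding of $G$ in a closed surface. For a fixed spanning tree $T$ of $G$, a $T$-rotation system is a general rotation system with $\tau(e)=0$ for all $e\in E(T)$. Embeddings with equivalent $T$-rotation systems are identified, so the number $\varepsilon_G(i)$ of equivalent embeddings of $G$ into surfaces of Euler-genus $i$ is the number of $T$-rotation systems whose embedding surface has Euler-genus $i$. The Euler-genus polynomial is $\mathcal{E}_G(z)=\sum_{i\ge 0}\varepsilon_G(i)z^i$. The graphs $H_{m_1,\dots,m_k}$.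 Let $k\ge 2$, $m_1,\dots,m_k\ge 1$. Put $n_1=m_1$, $n_i=m_i+1$ for $1<i<k$, $n_k=m_k$, and $\ell=n_1+\dots+n_k$. Take the path $v_0v_1\cdots v_{\ell+1}$ drawn horizontally and attach to each $v_i$ ($1\le i\le\ell$) a leaf $u_i$; the first $n_1$ of the leaves $u_i$ are drawn above the path, the next $n_2$ below, the next $n_3$ above, and so on alternately. Add a cycle $C$ through all leaves of this tree in their planar order: $v_0$, then the upper leaves $u_i$ in increasing order of index, then $v_{\ell+1}$, then the lower leaves $u_i$ in decreasing order of index. The resulting cubic Halin graph (a cubic caterpillar-Halin graph) is $H_{m_1,\dots,m_k}$. Write $\mathcal{E}_{m_1,\dots,m_k}(z)$ for its Euler-genus polynomial. The polynomials $\lambda$. For $k\ge2$ and $m_1,\dots,m_k\ge 1$, consider symmetric matrices over $\mathbb{Z}_2=\{0,1\}$ of order $k+m_1+\dots+m_k$ whose rows and columns are indexed by symbols $e_i$ ($1\le i\le k$) and $e_{i,l}$ ($1\le i\le k$, $1\le l\le m_i$). A matrix has the form $\Delta_{m_1,\dots,m_k}$ if all its entries vanish except possibly the following (and their transposes), which are arbitrary in $\mathbb{Z}_2$: $(e_i,e_i)=x_i$ and $(e_{i,l},e_{i,l})=x_{i,l}$; $(e_i,e_{i+1})=y_i$ for $1\le i\le k-1$; $(e_{i,l},e_{i,l+1})=y_{i,l}$ for $1\le l\le m_i-1$; $(e_i,e_{i,l})=z_{i,l}$ for $1\le l\le m_i$; $(e_i,e_{i-1,m_{i-1}})=z_{i,0}$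 for $2\le i\le k$; $(e_i,e_{i+1,1})=z_{i,m_i+1}$ for $1\le i\le k-1$. A matrix has the form $\Lambda_{m_1,\dots,m_k}$ if it has the form $\Delta_{m_1,\dots,m_k}$ and its row and column indexed by $e_k$ are zero. Set $\lambda_{m_1,\dots,m_k}(z)=\sum_j \lambda_{m_1,\dots,m_k}[j]z^j$, where $\lambda_{m_1,\dots,m_k}[j]$ is the number of matrices of the form $\Lambda_{m_1,\dots,m_k}$ of rank $j$. Generating functions. For $k\ge 2$ and $i=1,2$, as formal series in $t_1,\dots,t_k$ (identities involving negative powers of $t_{k-1}$ are understood for formal Laurent series, rational functions being expanded as power series in $t_k$), $$\lambda^i(t_1,\dots,t_k,z)=\sum_{m_1,\dots,m_{k-1}\ge1,\;m_k\ge i}2^{m_k}\lambda_{m_1,\dots,m_k}(z)t_1^{m_1}\cdots t_k^{m_k},\qquad \mathcal{E}^i(t_1,\dots,t_k,z)=\sum_{m_1,\dots,m_{k-1}\ge1,\;m_k\ge i}\mathcal{E}_{m_1,\dots,m_k}(z)t_1^{m_1}\cdots t_k^{m_k}.$$ *)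

(* Defs.v *)
From HB Require Import structures.
From mathcomp Require Import all_boot all_order all_fingroup all_algebra zify.
From mathcomp Require Import boolp classical_sets functions cardinality fsbigop.

Set Implicit Arguments.
Unset Strict Implicit.
Unset Printing Implicit Defensive.

Import Order.TTheory GRing.Theory Num.Theory.
Local Open Scope ring_scope.

Section LaurentSeries.
Variables (R : comNzRingType) (n : nat).

Definition expo := {ffun 'I_n -> int}.

Lemma expoB (e a : expo) i : (e - a) i = (e i : int) - (a i : int).
Proof. by rewrite !ffunE. Qed.

Lemma expoN (e : expo) i : (- e) i = - (e i : int).
Proof. by rewrite !ffunE. Qed.

(* Formal Laurent series in n variables t_1, ..., t_n: the support is bounded
   below in each coordinate. They form a commutative ring, in which an element
   has at most one inverse. *)
Definition bounded_below (f : expo -> R) : Prop :=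
  exists N : nat, forall e, f e != 0 -> forall i, - N%:Z <= e i.

Definition lseries_pred : {pred expo -> R} :=
  [pred f : expo -> R | `[< bounded_below f >]].

Record lseries := LSeries { lcoef :> expo -> R; _ : lcoef \in lseries_pred }.

HB.instance Definition _ := [isSub for lcoef].
HB.instance Definition _ := [Choice of lseries by <:].

Lemma lseries_predP f : reflect (bounded_below f) (f \in lseries_pred).
Proof. exact: asboolP. Qed.

Lemma lseries_zmod_closed : zmod_closed lseries_pred.
Proof.
split=> [|f g /lseries_predP[N fN] /lseries_predP[M gM]]; apply/lseries_predP.
  by exists 0%N => e; rewrite eqxx.
exists (N + M)%N => e fge i.
have [fe0|/fN/(_ i) ? ] := eqVneq (f e) 0; last by lia.
have [ge0|/gM/(_ i) ? ] := eqVneq (g e) 0; last by lia.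
by case/negP: fge; rewrite (_ : (f - g) e = f e - g e) // fe0 ge0 subr0.
Qed.
HB.instance Definition _ :=
  GRing.isZmodClosed.Build _ lseries_pred lseries_zmod_closed.
HB.instance Definition _ := [SubChoice_isSubZmodule of lseries by <:].

Lemma lseriesP (f : lseries) : bounded_below f.
Proof. by apply/lseries_predP/(valP f). Qed.

Lemma lcoefP (f g : lseries) : (forall e, f e = g e) -> f = g.
Proof. by move=> fg; apply/val_inj/funext. Qed.

Lemma lcoefD (f g : lseries) e : (f + g) e = f e + g e.
Proof. by []. Qed.

Lemma lcoefN (f : lseries) e : (- f) e = - f e.
Proof. by []. Qed.

(* Cauchy product: for two series bounded below, the sum has finitely many
   nonzero terms (a sum over a set with infinite support would be 0). *)
Definition conv (f g : expo -> R) (e : expo) : R :=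
  \sum_(a \in [set: expo]%classic) f a * g (e - a).

Definition box (N d : nat) : seq expo :=
  [seq [ffun i => (x i : nat)%:Z - N%:Z] | x : {ffun 'I_n -> 'I_d}].

Lemma box_uniq N d : uniq (box N d).
Proof.
rewrite map_inj_uniq ?enum_uniq // => x y /ffunP xy; apply/ffunP => i.
by move: (xy i); rewrite !ffunE => /addIr[] /val_inj.
Qed.

Lemma mem_box N d (a : expo) :
  (forall i, - N%:Z <= a i /\ a i < d%:Z - N%:Z) -> a \in box N d.
Proof.
move=> Ha.
have lt_d i : (absz (a i + N%:Z)%R < d)%N by have [] := Ha i; lia.
apply/mapP; exists [ffun i => Ordinal (lt_d i)]; first by rewrite mem_enum.
by apply/ffunP => i; rewrite !ffunE /=; have [] := Ha i; lia.
Qed.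

Lemma expo_ub (e : expo) : exists M : nat, forall i, e i <= M%:Z.
Proof.
exists (\sum_i absz (e i))%N => i.
by have := leq_bigmax_cond; rewrite (bigD1 i) //=; lia.
Qed.

Lemma convE (S : seq expo) (f g : expo -> R) e : uniq S ->
    (forall a, f a != 0 -> g (e - a) != 0 -> a \in S) ->
  conv f g e = \sum_(a <- S) f a * g (e - a).
Proof.
move=> uS fgS; rewrite /conv (@fsbigE _ _ _ _ _ S) //; last first.
  move=> a _ /(contra (fun h => h)) aS; have [->|fa0] := eqVneq (f a) 0.
    by rewrite mul0r.
  have [->|ga0] := eqVneq (g (e - a)) 0; first by rewrite mulr0.
  by rewrite fgS in aS.
by apply: eq_bigl => a; rewrite in_setT.
Qed.

Lemma convC f g : conv f g = conv g f.
Proof.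
apply/funext => e; rewrite /conv.
rewrite (@reindex_fsbigT _ _ _ _ _ (fun a : expo => e - a)) /=.
  by apply: eq_fsbigr => a _; rewrite subKr mulrC.
by exists (fun a : expo => e - a) => a; rewrite subKr.
Qed.

Lemma conv_neq0 f g e : conv f g e != 0 ->
  exists a, f a != 0 /\ g (e - a) != 0.
Proof.
move=> /eqP fge; apply: contrapT => fg0; apply: fge; apply: fsbig1 => a _.
have [->|fa0] := eqVneq (f a) 0; first by rewrite mul0r.
have [->|ga0] := eqVneq (g (e - a)) 0; first by rewrite mulr0.
by case: fg0; exists a.
Qed.

Lemma conv_bounded f g : bounded_below f -> bounded_below g ->
  bounded_below (conv f g).
Proof.
move=> [N fN] [M gM]; exists (N + M)%N => e /conv_neq0[a [/fN fa /gM ga]] i.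
have := fa i; have := ga i; rewrite ?expoB; lia.
Qed.

Lemma convA (f g h : lseries) : conv f (conv g h) = conv (conv f g) h.
Proof.
have [N fN] := lseriesP f; have [M gM] := lseriesP g.
have [L hL] := lseriesP h; apply/funext => e; have [U eU] := expo_ub e.
pose S1 := box (N + M) (N + M + L + U).+1.
pose S2 := box N (N + M + L + U).+1.
rewrite (@convE S2) ?box_uniq //; last first.
  move=> b /fN fb /conv_neq0[c [/gM gc /hL hc]]; apply: mem_box => i.
  have := fb i; have := gc i; have := hc i; have := eU i.
  by rewrite ?expoB ?expoN; lia.
rewrite (@convE S1) ?box_uniq //; last first.
  move=> a /conv_neq0[b [/fN fb /gM gb]] /hL ha; apply: mem_box => i.
  have := fb i; have := gb i; have := ha i; have := eU i.
  by rewrite ?expoB ?expoN; lia.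
transitivity (\sum_(b <- S2) \sum_(a <- S1) f b * g (a - b) * h (e - a)).
  apply: eq_big_seq => b; case: (eqVneq (f b) 0) => [->|/fN fb bS2].
    by rewrite mul0r big1 // => a _; rewrite !mul0r.
  rewrite -(eq_bigr _ (fun a _ => mulrA _ _ _)) -mulr_sumr; congr (_ * _).
  rewrite /conv (@reindex_fsbigT _ _ _ _ _ (fun a : expo => a - b)) /=; last first.
    by exists (fun a : expo => a + b) => a; rewrite ?subrK ?addrK.
  rewrite (@fsbigE _ _ _ _ _ S1) ?box_uniq //.
    rewrite (eq_bigl xpredT) => [|a]; last by rewrite in_setT.
    by apply: eq_bigr => a _; rewrite opprB addrA subrK.
  move=> a _ aS1; apply/eqP; apply: contraNT aS1 => gh.
  have /gM ga : g (a - b) != 0 by apply: contraNneq gh => ->; rewrite mul0r.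
  have /hL ha : h (e - b - (a - b)) != 0.
    by apply: contraNneq gh => ->; rewrite mulr0.
  apply: mem_box => i.
  have := fb i; have := ga i; have := ha i; have := eU i.
  by rewrite ?expoB ?expoN; lia.
rewrite exchange_big /=; apply: eq_big_seq => a aS1.
case: (eqVneq (h (e - a)) 0) => [->|/hL ha].
  by rewrite mulr0 big1 // => b _; rewrite mulr0.
rewrite -mulr_suml (@convE S2) ?box_uniq // => b /fN fb /gM gb.
apply: mem_box => i.
have := fb i; have := gb i; have := ha i; have := eU i.
by rewrite ?expoB ?expoN; lia.
Qed.

Definition lmul (f g : lseries) : lseries :=
  LSeries (introT (lseries_predP _) (conv_bounded (lseriesP f) (lseriesP g))).

Lemma lmonom_subproof (c : R) (e : expo) :
  (fun a => if a == e then c else 0) \in lseries_pred.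
Proof.
apply/lseries_predP; have [U eU] := expo_ub (- e); exists U => a.
have [-> _ i|_] := eqVneq a e; last by rewrite eqxx.
by have := eU i; rewrite ?expoB ?expoN; lia.
Qed.
Definition lmonom c e : lseries := LSeries (lmonom_subproof c e).

Lemma lmonom_convE c e (f : lseries) a : conv (lmonom c e) f a = c * f (a - e).
Proof.
rewrite (@convE [:: e]) // => [|b /=]; first by rewrite big_seq1 /= eqxx.
by rewrite inE; have [//|_] := eqVneq b e; rewrite /= eqxx.
Qed.

Lemma lmulA : associative lmul.
Proof. by move=> f g h; apply/val_inj/convA. Qed.

Lemma lmulC : commutative lmul.
Proof. by move=> f g; apply/val_inj/convC. Qed.

Lemma lmul1 : left_id (lmonom 1 0) lmul.
Proof. by move=> f; apply: lcoefP => e /=; rewrite lmonom_convE mul1r subr0. Qed.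

Lemma lmulDl : left_distributive lmul +%R.
Proof.
move=> f g h; apply: lcoefP => e; rewrite lcoefD /=.
have [N fN] := lseriesP f; have [M gM] := lseriesP g.
have [L hL] := lseriesP h; have [U eU] := expo_ub e.
have fg : bounded_below (f + g) := lseriesP (f + g).
pose S := box (N + M) (N + M + L + U).+1.
rewrite !(@convE S) ?box_uniq // -?big_split /=.
- by apply: eq_bigr => a _; rewrite mulrDl.
- move=> a /gM ga /hL ha; apply: mem_box => i.
  by have := ga i; have := ha i; have := eU i; rewrite ?expoB ?expoN; lia.
- move=> a /fN fa /hL ha; apply: mem_box => i.
  by have := fa i; have := ha i; have := eU i; rewrite ?expoB ?expoN; lia.
move=> a fga /hL ha; apply: mem_box => i.
have : - (N + M)%:Z <= a i.
  have [fa0|/fN/(_ i) ?] := eqVneq (f a) 0; last by lia.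
  have [ga0|/gM/(_ i) ?] := eqVneq (g a) 0; last by lia.
  by case/eqP: fga; change (f a + g a = 0); rewrite fa0 ga0 addr0.
by have := ha i; have := eU i; rewrite ?expoB ?expoN; lia.
Qed.

Lemma lone_neq0 : lmonom 1 0 != 0.
Proof.
apply/eqP => /(congr1 (fun f : lseries => f 0)) /= /eqP.
by rewrite eqxx oner_eq0.
Qed.

HB.instance Definition _ :=
  GRing.Zmodule_isComNzRing.Build lseries lmulA lmulC lmul1 lmulDl lone_neq0.

(* Inverses are chosen classically: f^-1 is the inverse of f if there is one,
   and f otherwise. *)
Definition lunit : {pred lseries} := [pred f | `[< exists g, g * f = 1 >]].

Definition linv (f : lseries) : lseries :=
  if pselect (exists g, g * f = 1) is left ex then projT1 (cid ex) else f.

Lemma lmulVx : {in lunit, left_inverse 1 linv *%R}.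
Proof.
by move=> f /asboolP ex; rewrite /linv; case: pselect => // ex'; case: cid.
Qed.

Lemma lunitPl (f g : lseries) : g * f = 1 -> f \in lunit.
Proof. by move=> gf; apply/asboolP; exists g. Qed.

Lemma linv_out : {in [predC lunit], linv =1 id}.
Proof. by move=> f /asboolPn nex; rewrite /linv; case: pselect. Qed.

HB.instance Definition _ :=
  GRing.ComNzRing_hasMulInverse.Build lseries lmulVx lunitPl linv_out.

Lemma lcoef_monomM c e (f : lseries) a : (lmonom c e * f) a = c * f (a - e).
Proof. exact: lmonom_convE. Qed.

Lemma lmonomM c d e a : lmonom c e * lmonom d a = lmonom (c * d) (e + a).
Proof.
apply: lcoefP => b; rewrite lcoef_monomM /= subr_eq [a + e]addrC.
by case: (_ == _); rewrite ?mulr0.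
Qed.

Definition lconst (c : R) : lseries := lmonom c 0.

Lemma lconst_zmod_morphism : zmod_morphism lconst.
Proof.
move=> c d; apply: lcoefP => e; rewrite lcoefD lcoefN /=.
by case: (_ == _); rewrite ?subr0.
Qed.
HB.instance Definition _ :=
  GRing.isZmodMorphism.Build R lseries lconst lconst_zmod_morphism.

Lemma lconst_monoid_morphism : monoid_morphism lconst.
Proof. by split=> // c d; rewrite /lconst lmonomM addr0. Qed.
HB.instance Definition _ :=
  GRing.isMonoidMorphism.Build R lseries lconst lconst_monoid_morphism.

(* t_j for 1 <= j <= n; the coordinates of exponent vectors are numbered from 0,
   the variables from 1. *)
Definition lvar (j : nat) : lseries :=
  lmonom 1 [ffun i : 'I_n => (i.+1 == j)%:Z].

Lemma lvar_unit j : lvar j \is a GRing.unit.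
Proof.
apply: (@lunitPl _ (lmonom 1 (- [ffun i : 'I_n => (i.+1 == j)%:Z]))).
by rewrite lmonomM mul1r addNr.
Qed.

(* coefficients of the expansion of 1 / (1 - a t - b t^2) *)
Fixpoint quad_coefs (a b : R) (d : nat) : R * R :=
  if d is d'.+1 then
    let: (x, y) := quad_coefs a b d' in (y, a * y + b * x)
  else (0, 1).

Definition quad_inv_fun (a b : R) (i0 : 'I_n) (e : expo) : R :=
  if [forall i, (i != i0) ==> (e i == 0)] && (0 <= e i0 :> int)
  then (quad_coefs a b (absz (e i0))).2 else 0.

Lemma quad_inv_subproof a b i0 : quad_inv_fun a b i0 \in lseries_pred.
Proof.
apply/lseries_predP; exists 0%N => e; rewrite /quad_inv_fun.
case: andP => [[/forallP e0 ei0] _ i|]; last by rewrite eqxx.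
by have [->//|ii0] := eqVneq i i0; have := e0 i; rewrite ii0 => /eqP ->.
Qed.

Lemma quad_unit a b j : (0 < j <= n)%N ->
  1 - lconst a * lvar j - lconst b * lvar j ^+ 2 \is a GRing.unit.
Proof.
case: j => // j ltjn; pose i0 := Ordinal (ltjn : (j < n)%N).
pose d : expo := [ffun i : 'I_n => (i.+1 == j.+1)%:Z].
have dE i : d i = (i == i0)%:Z :> int by rewrite ffunE eqSS.
apply: (@lunitPl _ (LSeries (quad_inv_subproof a b i0))).
set g := LSeries _; rewrite mulrC !mulrBl mul1r expr2 /lconst /lvar -/d.
rewrite !lmonomM !mulr1 !add0r; apply: lcoefP => e.
rewrite !(lcoefD, lcoefN) !lcoef_monomM {}/g /= /quad_inv_fun.
have axisB (u : expo) : (forall i, i != i0 -> u i = 0 :> int) ->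
    [forall i, (i != i0) ==> ((e - u) i == 0)]
    = [forall i, (i != i0) ==> (e i == 0)].
  move=> u0; apply: eq_forallb => i; have [//|ii0 /=] := eqVneq i i0.
  by rewrite expoB u0 // subr0.
rewrite !axisB ?expoB; try by move=> i /negPf ii0; rewrite ?[(d + d) _]ffunE dE ii0.
have -> : (d + d) i0 = 2 :> int by rewrite ffunE !dE eqxx.
rewrite dE eqxx; case: forallP => [e0|ne0] /=; last first.
  case: eqP => [e0|_]; last by rewrite !mulr0 !subr0.
  by case: ne0 => i; rewrite e0 ffunE eqxx implybT.
have -> : (e == 0) = (e i0 == 0 :> int).
  apply/eqP/eqP => [->|ei0]; first by rewrite ffunE.
  apply/ffunP => i; rewrite ffunE; have [-> //|ii0] := eqVneq i i0.
  by have := e0 i; rewrite ii0 => /eqP.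
case: (e i0 : int) => [[|[|x]]|x] /=.
- by rewrite !mulr0 !subr0.
- by rewrite mulr0 addr0 subr0 subrr.
- rewrite subn2 /=.
  by case: quad_coefs => u v /=; rewrite [X in X - _ - _]addrC addrK subrr.
by rewrite !mulr0 !subr0.
Qed.

End LaurentSeries.

(* A simple graph is a symmetric irreflexive relation adj on a finite type V.
   Its edges are the two-element sets {v, w} with adj v w, so the edges
   incident with v are represented by the neighbours of v. *)
Section RotationSystems.
Variables (V : finType) (adj : rel V).
Local Open Scope nat_scope.

Definition edges : {set {set V}} :=
  [set [set p.1; p.2] | p : V * V & adj p.1 p.2].

Definition neighbours (v : V) : {set V} := [set w | adj v w].

Definition cyclic_perm_on (A : {set V}) (s : {perm V}) : bool :=
  perm_on A s && [forall x in A, porbit s x == A].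

(* The second component is the set of the edges e with tau(e) = 1. *)
Definition rotation_system := ({ffun V -> {perm V}} * {set {set V}})%type.

Definition general_rotation_system (rho : rotation_system) : bool :=
  [forall v, cyclic_perm_on (neighbours v) (rho.1 v)] && (rho.2 \subset edges).

Definition T_rotation_system (T : {set {set V}}) (rho : rotation_system) :=
  general_rotation_system rho && [disjoint rho.2 & T].

(* Face tracing: (v, w, s) is the traversal of the edge {v, w} from v to w, with
   local orientation at v reversed iff s is true. Crossing a twisted edge
   toggles the orientation, which decides whether the walk goes on with the
   successor or with the predecessor of {v, w} in the rotation at w. *)
Definition face_step (rho : rotation_system) (x : V * V * bool) :
    V * V * bool :=
  let: (v, w, s) := x in
  let s' := s (+) ([set v; w] \in rho.2) in
  (w, (if s' then (rho.1 w)^-1 v else rho.1 w v)%g, s').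

(* Every face boundary is traced by exactly two orbits, one for each sense. *)
Definition nb_faces (rho : rotation_system) : nat :=
  (fcard (face_step rho) [pred x | adj x.1.1 x.1.2])./2.

(* For connected graphs. The surface with j handles has Euler characteristic
   2 - 2j, that with c crosscaps 2 - c; so the Euler-genus of the surface of a
   cellular embedding is the i with #vertices - #edges + #faces = 2 - i. *)
Definition has_euler_genus (rho : rotation_system) (i : nat) : bool :=
  #|V| + nb_faces rho + i == #|edges| + 2.

Definition nb_embeddings (T : {set {set V}}) (i : nat) : nat :=
  #|[set rho | T_rotation_system T rho & has_euler_genus rho i]|.

(* The Euler-genus of a cellular embedding is at most #edges + 2. *)
Definition euler_genus_poly (T : {set {set V}}) : {poly int} :=
  \poly_(i < #|edges|.+3) (nb_embeddings T i)%:Z.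

Definition spanning_tree (T : {set {set V}}) : Prop :=
  let adjT := [rel v w | [set v; w] \in T] in
  [/\ T \subset edges, forall v w, connect adjT v w &
      forall c : seq V, ucycle adjT c -> size c <= 2].

End RotationSystems.

(* The graph H_{m_1, ..., m_k}, with m = [:: m_1; ...; m_k]. *)
Section CaterpillarHalin.
Variable m : seq nat.
Local Open Scope nat_scope.

Definition block_sizes : seq nat :=
  mkseq (fun i => nth 0 m i + ((0 < i) && (i.+1 < size m))) (size m).

Definition nb_spine : nat := sumn block_sizes.

(* inl i is v_i (0 <= i <= l + 1); inr i is u_{i+1} (0 <= i < l). *)
Definition halin_vertex := ('I_nb_spine.+2 + 'I_nb_spine)%type.

(* reshape_index block_sizes i is the number (from 0) of the block that
   contains the leaf u_{i+1}. *)
Definition upper_leaf (i : 'I_nb_spine) : bool :=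
  ~~ odd (reshape_index block_sizes i).

Definition halin_cycle : seq halin_vertex :=
  inl ord0 :: [seq inr i | i <- enum 'I_nb_spine & upper_leaf i]
  ++ inl ord_max :: rev [seq inr i | i <- enum 'I_nb_spine & ~~ upper_leaf i].

Definition caterpillar_arc (x y : halin_vertex) : bool :=
  match x, y with
  | inl i, inl j => j == i.+1 :> nat
  | inl i, inr j => i == j.+1 :> nat
  | _, _ => false
  end.

Definition halin_cycle_arc (x y : halin_vertex) : bool :=
  (x \in halin_cycle) && (y == next halin_cycle x).

Definition halin_adj : rel halin_vertex := fun x y =>
  [|| caterpillar_arc x y, caterpillar_arc y x,
      halin_cycle_arc x y | halin_cycle_arc y x].

End CaterpillarHalin.

Section LambdaPolynomials.
Variable m : seq nat.

(* inl i is e_{i+1}; inr (Tagged _ l), with tag i, is e_{i+1,l+1}. *)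
Definition delta_index :=
  ('I_(size m) + {i : 'I_(size m) & 'I_(nth 0%N m i)})%type.

Definition delta_pos (a b : delta_index) : bool :=
  match a, b with
  | inl i, inl j => (j == i :> nat) || (j == i.+1 :> nat)
  | inr p, inr q => (tag p == tag q) &&
      ((tagged q == tagged p :> nat) || (tagged q == (tagged p).+1 :> nat))
  | inl i, inr q =>
      [|| tag q == i,
          (i == (tag q).+1 :> nat) && ((tagged q).+1 == nth 0%N m (tag q)) |
          (tag q == i.+1 :> nat) && (tagged q == 0%N :> nat)]
  | inr _, inl _ => false
  end.

Definition entry (M : 'M['F_2]_#|{: delta_index}|) (a b : delta_index) : 'F_2 :=
  M (enum_rank a) (enum_rank b).

Definition Delta_form (M : 'M['F_2]_#|{: delta_index}|) : bool :=
  [forall a, forall b, (entry M a b == entry M b a) &&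
     ((entry M a b != 0) ==> delta_pos a b || delta_pos b a)].

Definition Lambda_form (M : 'M['F_2]_#|{: delta_index}|) : bool :=
  Delta_form M &&
  [forall i : 'I_(size m), (i.+1 == size m :> nat) ==>
     [forall b, (entry M (inl i) b == 0) && (entry M b (inl i) == 0)]].

Definition lambda_poly : {poly int} :=
  \poly_(j < #|{: delta_index}|.+1)
     #|[set M | Lambda_form M & \rank M == j]|%:Z.

End LambdaPolynomials.

Section GeneratingFunctions.
Variable k : nat.

Definition exponents (m : seq nat) : expo k := [ffun i : 'I_k => (nth 0%N m i)%:Z].

(* For j <= k, the series in t_1, ..., t_k (constant in t_{j+1}, ..., t_k)
   sum_{m_1, ..., m_{j-1} >= 1, m_j >= i} c(m) t_1^{m_1} ... t_j^{m_j},
   where i >= 1. *)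
Definition gen_coef (j i : nat) (c : seq nat -> {poly int}) (e : expo k) :
    {poly int} :=
  let m := [seq absz (e r) | r <- take j (enum 'I_k)] in
  if [&& e == exponents m, all (leq 1) m & (i <= last 0 m)%N] then c m else 0.

Lemma gen_series_subproof j i c : gen_coef j i c \in @lseries_pred {poly int} k.
Proof.
apply/lseries_predP; exists 0%N => e; rewrite /gen_coef.
by case: and3P => [[/eqP -> _ _] _ r|]; rewrite ?eqxx ?ffunE.
Qed.

Definition gen_series j i c : lseries {poly int} k :=
  LSeries (gen_series_subproof j i c).

Definition lambda_series (i j : nat) : lseries {poly int} k :=
  gen_series j i (fun m => 2 ^+ last 0%N m * lambda_poly m).

Variable T : forall m : seq nat, {set {set halin_vertex m}}.

Definition euler_series (i j : nat) : lseries {poly int} k :=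
  gen_series j i (fun m => euler_genus_poly (@halin_adj m) (T m)).

(* The column (lambda^1, lambda^2, E^1, E^2)(t_1, ..., t_j, z). *)
Definition series_col (j : nat) : 'cV[lseries {poly int} k]_4 :=
  \col_(r < 4) nth 0 [:: lambda_series 1 j; lambda_series 2 j;
                         euler_series 1 j; euler_series 2 j] r.

(* A(t_p, t_q, z), with z the indeterminate of the coefficient ring {poly int}.
   D and D' are units (lemmas transfer_D_unit and transfer_D'_unit), so that
   the quotients are the expansions as power series in t_q. *)
Definition transfer_D (q : nat) : lseries {poly int} k :=
  let t := lvar {poly int} k q in let z := lconst k 'X in
  1 - 2 * t - 4 * z * t - 16 * z ^+ 2 * t ^+ 2.

Definition transfer_D' (q : nat) : lseries {poly int} k :=
  let t := lvar {poly int} k q in let z := lconst k 'X in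
  1 - t - 4 * z * t - 16 * z ^+ 2 * t ^+ 2.

Definition transfer_mx (p q : nat) : 'M[lseries {poly int} k]_4 :=
  let s := lvar {poly int} k p in let t := lvar _ k q in let z := lconst k 'X in
  let D := transfer_D q in let D' := transfer_D' q in
  let A11 := 16 * z ^+ 2 * t / D in
  let A13 := (t * (1 + 2 * z) + 8 * z ^+ 2 * t ^+ 2) / D in
  let A21 := A11 - 16 * z ^+ 2 * t in
  let A23 := A13 - t * (1 + 2 * z) in
  let A31 := 16 * z ^+ 2 * t * A11 / D' in
  let A32 := 16 * z ^+ 2 * s^-1 * t / D' in
  let A33 := (16 * z ^+ 2 * t + 16 * z ^+ 2 * t * A13) / D' in
  let A34 := ((1 + 4 * z) * s^-1 * t + 16 * z ^+ 2 * s^-1 * t ^+ 2) / D' in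
  let A41 := A31 in
  let A42 := A32 - 16 * z ^+ 2 * s^-1 * t in
  let A43 := A33 - 16 * z ^+ 2 * t in
  let A44 := A34 - (1 + 4 * z) * s^-1 * t in
  \matrix_(r < 4, c < 4)
    nth 0 (nth [::] [:: [:: A11; 0;   A13; 0  ];
                        [:: A21; 0;   A23; 0  ];
                        [:: A31; A32; A33; A34];
                        [:: A41; A42; A43; A44]] r) c.

Lemma transfer_D_unit q : (0 < q <= k)%N -> transfer_D q \is a GRing.unit.
Proof.
move=> hq; have := @quad_unit {poly int} k (2 + 4 * 'X) (16 * 'X^2) q hq.
rewrite /transfer_D rmorphD !rmorphM !rmorph_nat -?expr2.
by rewrite mulrDl opprD !addrA.
Qed.

Lemma transfer_D'_unit q : (0 < q <= k)%N -> transfer_D' q \is a GRing.unit.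
Proof.
move=> hq; have := @quad_unit {poly int} k (1 + 4 * 'X) (16 * 'X^2) q hq.
rewrite /transfer_D' rmorphD !rmorphM !rmorph_nat -?expr2 rmorph1.
by rewrite mulrDl mul1r opprD !addrA.
Qed.

End GeneratingFunctions.

(* Main.v *)
(* The embeddings of a plane cubic graph arise from the plane one by reversing
   the rotations at some vertices and by twisting some edges.  The resulting
   edge weights over F_2 are encoded by a symmetric matrix M indexed by the inner
   faces: an edge between the faces p and q has weight M p q, and an outer edge
   has as weight the sum of a row of M.  A 0/1-labelling of the sides of the
   edges that is constant along every face of the new embedding amounts to a
   vector y of the kernel of M together with a potential on the vertices, which
   exists and is unique up to a constant.  Counting these labellings shows that
   the number of faces is dim ker M + 1, i.e. that the Euler genus is rank M.
   For the graphs H_m the supports of these matrices are those of the form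
   Delta_m, so that E_m is twice the rank polynomial of this form.  Eliminating
   the last index by a pivot expresses the rank polynomials of Delta_m and
   Lambda_m through those with a smaller last block, and comparing coefficients
   turns these recurrences into linear equations between the series. *)

Require Import Defs.
From HB Require Import structures.
From mathcomp Require Import all_boot all_order all_fingroup all_algebra.
From mathcomp Require Import mxabelem.
From mathcomp Require Import zify ring.

Set Implicit Arguments.
Unset Strict Implicit.
Unset Printing Implicit Defensive.

Import Order.TTheory GRing.Theory Num.Theory.
Local Open Scope ring_scope.

(** The recurrences close up because of the numbering of the indices from left to right. Every index
    [r >= 2] has exactly two smaller neighbours, [p = r - 1] and a block start [q]; they are
    adjacent, so the support is a strip of triangles. When [r] is the last index, every neighbour of
    [p] is one of [q], and this keeps the fill-in of all pivots inside the support. The pivot is [r]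
    alone, or the pair [r, p], or the pair [r, q]. The last case deletes a block start and so leads
    to the form Lambda, in which the last index has a single neighbour. The number of neighbours of
    [q] grows with its block, which is the origin of the weight [2 ^ m_k] in the lambda series. The
    strip that ends at the first index of a new block is also the strip of the sequence whose
    previous block is longer by one. Hence the factor [t_{k-1}^-1] and the series whose last
    exponent starts at 2. The factor 2 in E_m comes from reversing the rotations at all vertices at
    once, which changes the rotation system but not the matrix. *)

(** * Rank reduction and arithmetic over the two-element field *)

(* Wedderburn's rank reduction. *)
Lemma mxrank_pivot (F : fieldType) m n (M : 'M[F]_(m, n)) i j :
  M i j != 0 ->
  \rank M = (\rank (M - (M i j)^-1 *: (col j M *m row i M))%R).+1.
Proof.
move=> Mij; set M' := M - _.
have eqM : (M :=: M' + row i M)%MS.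
  apply/eqmxP/andP; split.
    have {1}-> : M = M' + (M i j)^-1 *: (col j M *m row i M) by rewrite subrK.
    by rewrite addmx_sub_adds // scalemx_sub // submxMl.
  rewrite addsmx_sub row_sub andbT addmx_sub // eqmx_opp scalemx_sub //.
  by rewrite (submx_trans (submxMl _ _)) ?row_sub.
(* Column [j] of [M'] vanishes while entry [j] of [row i M] does not, so the two row spaces meet
   trivially and the ranks add up. *)
have cM' : M' *m delta_mx j (0 : 'I_1) = 0.
  rewrite -colE; apply/matrixP => a b.
  by rewrite !mxE big_ord1 !mxE mulrCA mulVf // mulr1 subrr.
have rN0 : row i M != 0.
  by apply: contraNneq Mij => /rowP/(_ j); rewrite !mxE => ->.
rewrite eqM mxrank_disjoint_sum ?rank_rV ?rN0 ?addn1 //.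
apply/eqP/rowV0P => v; rewrite sub_capmx => /andP[/submxP[u vu]].
case/sub_rVP => c vc; have := congr1 (mulmx^~ (delta_mx j (0 : 'I_1))) vu.
rewrite /= -mulmxA cM' mulmx0 vc -scalemxAl -colE => /matrixP/(_ 0 0).
rewrite !mxE => /eqP; rewrite mulf_eq0 (negPf Mij) orbF => /eqP ->.
by rewrite scale0r.
Qed.

Lemma F2_cases (x : 'F_2) : x = 0 \/ x = 1.
Proof. by case: x => [[|[|[]]] // ?]; [left | right]; apply/val_inj. Qed.

Lemma F2_neq0 (x : 'F_2) : (x != 0) = (x == 1).
Proof. by case: (F2_cases x) => ->. Qed.

Lemma F2_addrr (x : 'F_2) : x + x = 0.
Proof. by case: (F2_cases x) => ->; apply/val_inj. Qed.

Lemma F2_oppr (x : 'F_2) : - x = x.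
Proof. by apply/eqP; rewrite eq_sym -addr_eq0 F2_addrr. Qed.

Lemma F2mx_oppr m n (M : 'M['F_2]_(m, n)) : - M = M.
Proof. by apply/matrixP => i j; rewrite mxE F2_oppr. Qed.

Lemma F2mx_addKr m n (M N : 'M['F_2]_(m, n)) : M + N + N = M.
Proof. by rewrite -{2}(F2mx_oppr N) addrK. Qed.

Lemma card_rV_fixed (R : finNzRingType) n (A : pred 'I_n) (c : 'I_n -> R) :
  #|[pred v : 'rV[R]_n | [forall x, ~~ A x ==> (v 0 x == c x)]]|
  = (#|R| ^ #|A|)%N.
Proof.
pose h (f : {ffun 'I_n -> R}) : 'rV[R]_n := \row_x (f x + c x).
have h_inj : injective h.
  by move=> f g /rowP fg; apply/ffunP => x; have := fg x; rewrite !mxE => /addIr.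
rewrite -(card_pffun_on 0 A predT) -(card_image h_inj); apply: eq_card => v.
rewrite inE; apply/forallP/imageP => [Av|[f /pffun_onP[/subsetP fA _] ->] x].
  exists [ffun x => v 0 x - c x].
    apply/pffun_onP; split=> //; apply/subsetP => x; rewrite inE /= ffunE subr_eq0.
    by apply: contraR => Ax; exact: implyP (Av x) Ax.
  by apply/rowP => x; rewrite mxE ffunE subrK.
apply/implyP => Ax; rewrite mxE -subr_eq0 addrK; apply: contraR Ax => fx0.
exact: (fA x).
Qed.

(** * Rank polynomials of symmetric matrices over F_2 *)

Section RankPolynomial.
Variable n : nat.
Implicit Types (e : rel 'I_n) (M : 'M['F_2]_n) (u v : 'rV['F_2]_n).

Definition sym_supp e M : bool :=
  (M^T == M) && [forall i, forall j, (M i j != 0) ==> e i j].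

Definition rank_poly e : {poly int} := \sum_(M | sym_supp e M) 'X^(\rank M).

(** The index [r] stays as a zero row and column, so that successive eliminations remain in one
    matrix type. *)
Definition delv r e : rel 'I_n := [rel i j | [&& i != r, j != r & e i j]].

Lemma delvE r e i j : delv r e i j = [&& i != r, j != r & e i j].
Proof. by []. Qed.

Lemma sym_suppP e M :
  reflect ((forall i j, M i j = M j i) /\ (forall i j, M i j != 0 -> e i j))
          (sym_supp e M).
Proof.
apply: (iffP andP) => [[/eqP Ms /forallP eM]|[Ms eM]]; split.
- by move=> i j; rewrite -{1}Ms mxE.
- by move=> i j Mij; exact: implyP (forallP (eM i) j) Mij.
- by apply/eqP/matrixP => i j; rewrite mxE.
by apply/forallP => i; apply/forallP => j; apply/implyP; exact: eM.
Qed.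

Lemma eq_sym_supp e e' : e =2 e' -> sym_supp e =1 sym_supp e'.
Proof.
move=> ee M; congr (_ && _); apply: eq_forallb => i; apply: eq_forallb => j.
by rewrite ee.
Qed.

Lemma eq_rank_poly e e' : e =2 e' -> rank_poly e = rank_poly e'.
Proof. by move=> ee; apply: eq_bigl; exact: eq_sym_supp. Qed.

(** The corrections in the Schur complements for the pivot blocks [[1]] and [[0 1; 1 u_p]], where
    [v] and [u] are the rows of [r] and [p]. The inverse of the second block over F_2 is
    [[u_p 1; 1 0]], whence the three terms of [pivot2]; signs disappear. *)
Definition pivot1 v : 'M['F_2]_n := v^T *m v.
Definition pivot2 p u v : 'M['F_2]_n :=
  u^T *m v + v^T *m u + u 0 p *: (v^T *m v).

Lemma pivot1E v i j : pivot1 v i j = v 0 i * v 0 j.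
Proof. by rewrite mxE big_ord1 mxE. Qed.

Lemma pivot2E p u v i j : pivot2 p u v i j
  = u 0 i * v 0 j + v 0 i * u 0 j + u 0 p * (v 0 i * v 0 j).
Proof. by rewrite !mxE !big_ord1 !mxE. Qed.

Lemma rank_pivot1 r M v : M^T = M -> row r M = v -> v 0 r = 1 ->
  \rank M = (\rank (M + pivot1 v)%R).+1.
Proof.
move=> Ms rM vr; have Mrr : M r r = 1 by rewrite -vr -rM mxE.
rewrite (@mxrank_pivot _ _ _ _ r r) ?Mrr ?oner_eq0 // invr1 scale1r.
have -> : col r M = v^T by rewrite -rM tr_row Ms.
by rewrite rM F2mx_oppr.
Qed.

(** Two rank reductions, at [(r, p)] and then at [(p, r)]. Since [M r r = 0], the entry at [(p, r)]
    is still 1 after the first one. *)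
Lemma rank_pivot2 r p M u v : M^T = M -> row r M = v -> row p M = u ->
  v 0 r = 0 -> v 0 p = 1 -> \rank M = (\rank (M + pivot2 p u v)%R).+2.
Proof.
move=> Ms rM pM vr vp.
have MC i j : M i j = M j i by rewrite -{1}Ms mxE.
have vE i : v 0 i = M r i by rewrite -rM mxE.
have uE i : u 0 i = M p i by rewrite -pM mxE.
have Mrr : M r r = 0 by rewrite -vE.
have Mrp : M r p = 1 by rewrite -vE.
have Mpr : M p r = 1 by rewrite MC.
rewrite (@mxrank_pivot _ _ _ _ r p) ?Mrp ?oner_eq0 // invr1 scale1r F2mx_oppr.
set M1 := (M + col p M *m row r M); have M1E i j : M1 i j = M i j + M i p * M r j.
  by rewrite !mxE big_ord1 !mxE.
have M1pr : M1 p r = 1 by rewrite M1E Mrr mulr0 addr0.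
rewrite (@mxrank_pivot _ _ _ M1 p r) ?M1pr ?oner_eq0 // invr1 scale1r.
rewrite F2mx_oppr; congr (\rank _).+2; apply/matrixP => i j.
rewrite mxE M1E [RHS]mxE pivot2E !vE !uE mxE big_ord1 !mxE big_ord1 !mxE Mrr.
rewrite !big_ord1 !mxE (MC p i) (MC r i); ring.
Qed.

(* For a fixed row v of the matrix, elimination of the index r is the
   translation by the matrix pivot1 v. *)
Lemma sum_rank_loop e r (C : pred 'rV['F_2]_n) :
  (forall v, C v -> v 0 r = 1) ->
  (forall v i j, C v -> v 0 i != 0 -> v 0 j != 0 -> e i j) ->
  \sum_(M | sym_supp e M && C (row r M)) 'X^(\rank M)
  = #|C|%:R * 'X * rank_poly (delv r e) :> {poly int}.
Proof.
move=> Cr Ce; rewrite (partition_big (fun M => row r M) C) => [|M /andP[]] //.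
rewrite (eq_bigr (fun _ => 'X * rank_poly (delv r e))) => [|v Cv].
  by rewrite big_const iter_addr_0 -mulrA [RHS]mulr_natl.
have vr := Cr v Cv; rewrite (reindex_inj (addIr (pivot1 v))) /= mulr_sumr.
apply: eq_big => [B|B]; last first.
  case/andP => /andP[/sym_suppP[Bs _] _] /eqP rB.
  rewrite (rank_pivot1 (r := r) (v := v)) ?F2mx_addKr ?exprS //.
  by apply/matrixP => i j; rewrite mxE.
apply/andP/sym_suppP => [[/andP[/sym_suppP[Bs Be] _] /eqP/rowP rB]|[Bs Be]].
  have BE i j : B i j = (B + pivot1 v) i j + v 0 i * v 0 j.
    by rewrite mxE pivot1E -addrA F2_addrr addr0.
  have Bsym i j : B i j = B j i.
    by rewrite BE Bs (mulrC (v 0 i)) -BE.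
  have Br j : B r j = 0.
    by have := rB j; rewrite BE vr mul1r mxE => ->; rewrite F2_addrr.
  split=> // i j Bij.
  have ir : i != r by apply: contraNneq Bij => ->; rewrite Br.
  have jr : j != r by apply: contraNneq Bij => ->; rewrite Bsym Br.
  rewrite delvE ir jr /=.
  have [Kij|Kij] := eqVneq (v 0 i * v 0 j) 0.
    by apply: Be; rewrite mxE pivot1E Kij addr0.
  by move: Kij; rewrite mulf_eq0 negb_or => /andP[vi vj]; apply: Ce Cv _ _.
have Br j : B r j = 0.
  by apply/eqP; apply: contraTT isT => /Be; rewrite delvE eqxx.
have rB : row r (B + pivot1 v) = v.
  by apply/rowP => j; rewrite mxE mxE pivot1E Br vr mul1r add0r.
rewrite rB Cv eqxx andbT; split=> //; apply/sym_suppP; split=> i j.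
  by rewrite !mxE !big_ord1 !mxE Bs mulrC.
rewrite mxE pivot1E; have [->|/Be] := eqVneq (B i j) 0; last by case/and3P.
by rewrite add0r mulf_eq0 negb_or => /andP[vi vj]; apply: Ce Cv _ _.
Qed.

(** The analogue of [sum_rank_loop] for a zero diagonal entry at [r]: once the rows [v] of [r] and
    [u] of [p] are fixed, translation by [pivot2 p u v] clears both indices and lowers the rank by
    two. The third hypothesis says that the fill-in stays in the support. *)
Lemma sum_rank_pivot e r p (C D : pred 'rV['F_2]_n) :
  (forall v, C v -> v 0 r = 0 /\ v 0 p = 1) -> (forall u, D u -> u 0 r = 1) ->
  (forall u v i j, D u -> C v -> pivot2 p u v i j != 0 -> e i j) ->
  \sum_(M | sym_supp e M && (C (row r M) && D (row p M))) 'X^(\rank M)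
  = (#|C| * #|D|)%:R * 'X^2 * rank_poly (delv p (delv r e)) :> {poly int}.
Proof.
move=> Cr Dr CDe.
rewrite (partition_big (fun M => row r M) C) => [|M /and3P[]] //.
rewrite (eq_bigr (fun _ => #|D|%:R * ('X^2 * rank_poly (delv p (delv r e))))).
  by rewrite big_const iter_addr_0 natrM -!mulrA [RHS]mulr_natl.
move=> v Cv; have [vr vp] := Cr v Cv.
rewrite (partition_big (fun M => row p M) D) => [|M /andP[/and3P[]]] //.
rewrite (eq_bigr (fun _ => 'X^2 * rank_poly (delv p (delv r e)))) => [|u Du].
  by rewrite big_const iter_addr_0 [RHS]mulr_natl.
have ur := Dr u Du; rewrite (reindex_inj (addIr (pivot2 p u v))) /= mulr_sumr.
have Ksym i j : pivot2 p u v i j = pivot2 p u v j i by rewrite !pivot2E; ring.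
apply: eq_big => [B|B]; last first.
  case/andP => /andP[/and3P[/sym_suppP[Bs _] _ _] /eqP rB] /eqP pB.
  rewrite (rank_pivot2 (r := r) (p := p) (u := u) (v := v)) //; last first.
    by apply/matrixP => i j; rewrite mxE.
  by rewrite F2mx_addKr -exprD.
(* Rows [r] and [p] of the correction are [v] and [u], so the translated matrix [B] is zero in
   both. *)
have Kr j : pivot2 p u v r j = v 0 j.
  by rewrite pivot2E ur vr !mul0r mulr0 mul1r !addr0.
have Kp j : pivot2 p u v p j = u 0 j.
  by rewrite pivot2E vp !mul1r addrAC F2_addrr add0r.
apply/idP/sym_suppP => [|[Bs Be]].
  case/andP => /andP[/and3P[/sym_suppP[Bs Be] _ _] /eqP/rowP rB] /eqP/rowP pB.
  have BE i j : B i j = (B + pivot2 p u v) i j + pivot2 p u v i j.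
    by rewrite mxE -addrA F2_addrr addr0.
  have Bsym i j : B i j = B j i by rewrite BE Bs Ksym -BE.
  have Br j : B r j = 0.
    by have := rB j; rewrite BE Kr mxE => ->; rewrite F2_addrr.
  have Bp j : B p j = 0.
    by have := pB j; rewrite BE Kp mxE => ->; rewrite F2_addrr.
  split=> // i j Bij.
  have ir : i != r by apply: contraNneq Bij => ->; rewrite Br.
  have jr : j != r by apply: contraNneq Bij => ->; rewrite Bsym Br.
  have ip : i != p by apply: contraNneq Bij => ->; rewrite Bp.
  have jp : j != p by apply: contraNneq Bij => ->; rewrite Bsym Bp.
  rewrite !delvE ir jr ip jp /=.
  have [Kij|Kij] := eqVneq (pivot2 p u v i j) 0.
    by apply: Be; rewrite mxE Kij addr0.
  exact: CDe Du Cv Kij.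
have Br j : B r j = 0.
  by apply/eqP; apply: contraTT isT => /Be; rewrite !delvE eqxx ?andbF.
have Bp j : B p j = 0.
  by apply/eqP; apply: contraTT isT => /Be; rewrite !delvE eqxx ?andbF.
have rB : row r (B + pivot2 p u v) = v.
  by apply/rowP => j; rewrite mxE mxE Kr Br add0r.
have pB : row p (B + pivot2 p u v) = u.
  by apply/rowP => j; rewrite mxE mxE Kp Bp add0r.
rewrite rB pB Cv Du !eqxx !andbT; apply/sym_suppP; split=> i j.
  by rewrite mxE [RHS]mxE Bs Ksym.
rewrite mxE; have [->|/Be] := eqVneq (B i j) 0; last by case/and3P=> _ _ /and3P[].
by rewrite add0r; exact: CDe.
Qed.

End RankPolynomial.

(** * Elimination of an index with at most two neighbours *)

Section VertexElimination.
Variable n : nat.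
Implicit Types (e : rel 'I_n) (M : 'M['F_2]_n).

Definition dele r p e : rel 'I_n :=
  fun i j => [&& e i j, (i, j) != (r, p) & (i, j) != (p, r)].

Lemma card_F2_rV_fixed (A : pred 'I_n) (c : 'I_n -> 'F_2) :
  #|[pred v : 'rV['F_2]_n | [forall x, ~~ A x ==> (v 0 x == c x)]]|
  = (2 ^ #|A|)%N.
Proof. by rewrite card_rV_fixed card_Fp. Qed.

(** Entries outside the neighbourhood of [r] vanish anyway, so only the conditions on [B] remain.
    This converts conditions on entries of [M] into a set of rows that [card_F2_rV_fixed] counts. *)
Lemma row_fixedE e M r (B : pred 'I_n) (c : 'I_n -> 'F_2) : sym_supp e M ->
  [forall x, ~~ (e r x && ~~ B x) ==> (row r M 0 x == if B x then c x else 0)]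
  = [forall x, B x ==> (M r x == c x)].
Proof.
move=> /sym_suppP[_ Me]; apply: eq_forallb => x; rewrite mxE.
case: (B x) => /=; first by rewrite andbF.
rewrite andbT; case: (boolP (e r x)) => //= erx.
by apply: contraNT erx; exact: Me.
Qed.

Lemma rank_poly_isolated e r : e r r -> (forall x, e r x -> x = r) ->
  rank_poly e = (1 + 'X) * rank_poly (delv r e).
Proof.
move=> err er; rewrite /rank_poly (bigID (fun M => M r r != 0)) /= addrC.
rewrite mulrDl mul1r; congr (_ + _).
  apply: eq_bigl => M; rewrite negbK; apply/andP/idP.
    case=> /sym_suppP[Ms Me] /eqP Mr; apply/sym_suppP; split=> // i j Mij.
    have Mr0 x : M r x = 0.
      apply/eqP/negbNE/negP => Mrx; have xr : x = r by apply/er/Me.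
      by rewrite xr Mr eqxx in Mrx.
    rewrite delvE (Me _ _ Mij) andbT; apply/andP; split.
      by apply: contraNneq Mij => ->; rewrite Mr0.
    by apply: contraNneq Mij => ->; rewrite Ms Mr0.
  case/sym_suppP=> Ms Me; split.
    by apply/sym_suppP; split=> // i j /Me; rewrite delvE => /and3P[].
  by apply: contraT => /Me; rewrite delvE eqxx.
pose c (x : 'I_n) : 'F_2 := if x == r then 1 else 0.
pose A (x : 'I_n) := e r x && ~~ (x == r).
pose C := [pred v : 'rV['F_2]_n | [forall x, ~~ A x ==> (v 0 x == c x)]].
have CE v x : C v -> v 0 x = c x.
  move=> /forallP/(_ x)/implyP Cv; apply/eqP/Cv; rewrite /A.
  by apply/negP => /andP[/er -> /eqP].
transitivity (\sum_(M | sym_supp e M && C (row r M)) 'X^(\rank M) : {poly int}).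
  apply: eq_bigl => M; case: (boolP (sym_supp e M)) => // eM; rewrite !andTb.
  have -> : C (row r M) = _ := row_fixedE r (pred1 r) (fun=> 1) eM.
  rewrite F2_neq0; apply/idP/forallP => [Mr x|].
    by apply/implyP => /eqP ->.
  by move=> /(_ r); rewrite /= eqxx.
rewrite sum_rank_loop.
- rewrite card_F2_rV_fixed (@eq_card0 _ (mem A)) ?mul1r // => x.
  by rewrite inE; apply/negP => /andP[/er -> /eqP].
- by move=> v Cv; rewrite (CE _ _ Cv) /c eqxx.
have cr x : c x != 0 -> x = r by rewrite /c; case: (eqVneq x r) => //; rewrite eqxx.
by move=> v i j Cv; rewrite !(CE _ _ Cv) => /cr -> /cr ->.
Qed.

(** If [M r r = 1] the pivot is [r], otherwise it is the pair [r, p]; in both cases the row of [r]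
    is free at its neighbours other than [r] and [p]. The last two hypotheses keep the fill-in
    inside [e]. The exception [y = r] is harmless: symmetry covers it in the first case, and the row
    of [r] vanishes at [r] in the second. *)
Lemma sum_rank_edge e r p : symmetric e -> r != p -> e r r -> e r p ->
  (forall x, e r x -> e p x) ->
  (forall x y, e p x -> e r y -> y != r -> e x y) ->
  \sum_(M | sym_supp e M && (M r p != 0)) 'X^(\rank M)
  = (2 ^ #|[pred x | [&& e r x, x != r & x != p]]|)%:R
    * ('X * rank_poly (delv r e)
       + (2 ^ #|[pred x | e p x && (x != r)]|)%:R * 'X^2
         * rank_poly (delv p (delv r e))) :> {poly int}.
Proof.
move=> es rp err erp rpe dom; pose B (x : 'I_n) := (x == r) || (x == p).
pose A (x : 'I_n) := e r x && ~~ B x.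
pose Cf (b : 'F_2) := [pred v : 'rV['F_2]_n |
  [forall x, ~~ A x ==> (v 0 x == if B x then (if x == r then b else 1) else 0)]].
pose A' (x : 'I_n) := e p x && ~~ (x == r).
pose D := [pred u : 'rV['F_2]_n |
  [forall x, ~~ A' x ==> (u 0 x == if x == r then 1 else 0)]].
have CfE b v : Cf b v -> [/\ v 0 r = b, v 0 p = 1 & forall x, v 0 x != 0 -> e r x].
  move=> /forallP Cv; split; first 2 last.
  - move=> x; apply: contraNT => erx; apply/eqP.
    have := implyP (Cv x); rewrite /A (negPf erx) /= => /(_ isT)/eqP ->.
    rewrite /B; case: eqP erx => [->|_ erx]; first by rewrite err.
    by case: eqP erx => // ->; rewrite erp.
  - by have := implyP (Cv r); rewrite /A /B eqxx andbF /= => /(_ isT)/eqP.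
  - have := implyP (Cv p); rewrite /A /B eqxx orbT andbF /= => /(_ isT)/eqP.
    by rewrite eq_sym (negPf rp).
have DE u : D u -> u 0 r = 1 /\ forall x, u 0 x != 0 -> e p x.
  move=> /forallP Du; split.
    by have := implyP (Du r); rewrite /A' eqxx andbF /= => /(_ isT)/eqP.
  move=> x; apply: contraNT => epx; apply/eqP.
  have := implyP (Du x); rewrite /A' (negPf epx) /= => /(_ isT)/eqP ->.
  by case: eqP epx => // ->; rewrite es erp.
have cA : #|[pred x | [&& e r x, x != r & x != p]]| = #|A|.
  by apply: eq_card => x; rewrite !inE /= -negb_or.
have cC b : #|Cf b| = (2 ^ #|A|)%N by rewrite card_F2_rV_fixed.
have cD : #|D| = (2 ^ #|A'|)%N by rewrite card_F2_rV_fixed.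
have CM b M : sym_supp e M -> Cf b (row r M) = (M r r == b) && (M r p != 0).
  move=> eM; have -> : Cf b (row r M) = _ :=
    row_fixedE r B (fun x => if x == r then b else 1) eM.
  apply/forallP/andP => [BM|[Mr Mp] x].
    have := BM r; have := BM p; rewrite /B !eqxx orbT /= [p == r]eq_sym (negPf rp).
    by rewrite F2_neq0.
  apply/implyP; rewrite /B; case: eqP => [-> //|_ /= /eqP ->].
  by rewrite -F2_neq0.
have DM M : sym_supp e M -> D (row p M) = (M r p != 0).
  move=> eM; have -> : D (row p M) = _ := row_fixedE p (pred1 r) (fun=> 1) eM.
  rewrite F2_neq0.
  have /sym_suppP[Ms _] := eM; rewrite (Ms r p).
  apply/forallP/idP => [/(_ r)|Mr x]; first by rewrite /= eqxx.
  by apply/implyP => /eqP ->.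
rewrite (bigID (fun M => M r r != 0)) /= mulrDr; congr (_ + _).
  transitivity (\sum_(M | sym_supp e M && Cf 1 (row r M)) 'X^(\rank M) : {poly int}).
    apply: eq_bigl => M; case: (boolP (sym_supp e M)) => // eM; rewrite !andTb.
    by rewrite (CM 1) // F2_neq0 andbC.
  rewrite sum_rank_loop ?cC ?cA ?mulrA // => [v /CfE[]|v i j /CfE[_ _ ve] vi vj] //.
  have [->|jr] := eqVneq j r; first by rewrite es ve.
  by apply: dom jr; [apply: rpe|]; exact: ve.
transitivity (\sum_(M | sym_supp e M && (Cf 0 (row r M) && D (row p M))) 'X^(\rank M)
              : {poly int}).
  apply: eq_bigl => M; case: (boolP (sym_supp e M)) => // eM; rewrite !andTb.
  by rewrite (CM 0) // (DM M) // negbK -andbA andbb andbC.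
rewrite sum_rank_pivot.
- by rewrite cC cD cA natrM !mulrA.
- by move=> v /CfE[].
- by move=> u /DE[].
move=> u v i j /DE[ur ue] /CfE[vr vp ve]; rewrite pivot2E.
have uv x y : u 0 x != 0 -> v 0 y != 0 -> e x y.
  move=> /ue epx vy; apply: dom epx (ve _ vy) _.
  by apply: contraNneq vy => ->; rewrite vr.
have vv x y : v 0 x != 0 -> v 0 y != 0 -> e x y.
  move=> /ve/rpe epx vy; apply: dom epx (ve _ vy) _.
  by apply: contraNneq vy => ->; rewrite vr.
apply: contraNT => neij; apply/eqP.
have z1 : u 0 i * v 0 j = 0.
  apply/eqP; apply: contraNT neij; rewrite mulf_eq0 negb_or => /andP[].
  exact: uv.
have z2 : v 0 i * u 0 j = 0.
  apply/eqP; apply: contraNT neij; rewrite mulf_eq0 negb_or => /andP[vi uj].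
  by rewrite es uv.
have z3 : v 0 i * v 0 j = 0.
  apply/eqP; apply: contraNT neij; rewrite mulf_eq0 negb_or => /andP[].
  exact: vv.
by rewrite z1 z2 z3 mulr0 !addr0.
Qed.

Lemma rank_poly_split e r p : symmetric e -> e r p ->
  rank_poly e = rank_poly (dele r p e)
    + \sum_(M | sym_supp e M && (M r p != 0)) 'X^(\rank M).
Proof.
move=> es erp; rewrite /rank_poly (bigID (fun M => M r p != 0)) /= addrC.
congr (_ + _); apply: eq_bigl => M; rewrite negbK.
apply/andP/idP => [[/sym_suppP[Ms Me] /eqP Mrp]|/sym_suppP[Ms Me]].
  apply/sym_suppP; split=> // i j Mij; rewrite /dele (Me _ _ Mij) /=.
  apply/andP; split; apply: contraNneq Mij => -[-> ->]; first by rewrite Mrp.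
  by rewrite Ms Mrp.
split; first by apply/sym_suppP; split=> // i j /Me /and3P[].
by apply: contraT => /Me; rewrite /dele eqxx andbF.
Qed.

(** Matrices with [M r p = 0] have [r] isolated and give [1 + 'X]. Those with [M r p = 1] give a
    further ['X] if [M r r = 1] and the quadratic term if [M r r = 0]. *)
Lemma rank_poly_leaf e r p : symmetric e -> r != p -> e p p ->
  (forall x, e r x = (x == r) || (x == p)) ->
  rank_poly e = (1 + 2 * 'X) * rank_poly (delv r e)
    + (2 ^ #|[pred x | e p x && (x != r)]|)%:R * 'X^2
      * rank_poly (delv p (delv r e)).
Proof.
move=> es rp epp er; have err : e r r by rewrite er eqxx.
have erp : e r p by rewrite er eqxx orbT.
have dE : delv r (dele r p e) =2 delv r e.
  move=> i j; rewrite !delvE /dele; case: (eqVneq i r) => //= ir.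
  case: (eqVneq j r) => //= jr; rewrite !xpair_eqE (negPf ir) (negPf jr).
  by rewrite andbF andbT.
rewrite (rank_poly_split es erp) (@rank_poly_isolated (dele r p e) r); first last.
- move=> x; rewrite /dele er !xpair_eqE eqxx /=.
  by case: (eqVneq x r) => // _; case: eqVneq.
- by rewrite /dele err !xpair_eqE !eqxx (negPf rp).
rewrite (eq_rank_poly dE) sum_rank_edge //.
- rewrite (@eq_card0 _ [pred x | _]) => [|x]; first by rewrite expn0; ring.
  by rewrite !inE er; case: eqVneq => //=; rewrite andbN.
- by move=> x; rewrite er => /orP[] /eqP -> //; rewrite es.
by move=> x y epx; rewrite er => /orP[/eqP ->|/eqP ->]; rewrite ?eqxx // es.
Qed.

(** If [M r p = 0], then [r] is a leaf attached to [q] and contributes [1 + 2 * 'X] and the term in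
    [q]. If [M r p = 1], the entry [M r q] is free, which doubles both the linear term and the term
    in [p]. *)
Lemma rank_poly_triangle e r p q : symmetric e -> r != p -> r != q -> p != q ->
  e q q -> (forall x, e r x = [|| x == r, x == p | x == q]) ->
  e p p -> (forall x, e p x -> e q x) ->
  rank_poly e = (1 + 4 * 'X) * rank_poly (delv r e)
    + (2 ^ #|[pred x | e p x && (x != r)]|.+1)%:R * 'X^2
      * rank_poly (delv p (delv r e))
    + (2 ^ #|[pred x | e q x && (x != r)]|)%:R * 'X^2
      * rank_poly (delv q (delv r e)).
Proof.
move=> es rp rq pq eqq er epp pqe; have err : e r r by rewrite er eqxx.
have erp : e r p by rewrite er eqxx orbT.
have epq : e p q by rewrite es pqe.
have dE : delv r (dele r p e) =2 delv r e.
  move=> i j; rewrite !delvE /dele; case: (eqVneq i r) => //= ir.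
  case: (eqVneq j r) => //= jr; rewrite !xpair_eqE (negPf ir) (negPf jr).
  by rewrite andbF andbT.
have ds : symmetric (dele r p e).
  move=> i j; rewrite /dele es !xpair_eqE.
  by move: (e j i) (i == r) (i == p) (j == r) (j == p) => [] [] [] [] [].
rewrite (rank_poly_split es erp) (@rank_poly_leaf (dele r p e) r q) //; first last.
- move=> x; rewrite /dele er !xpair_eqE eqxx /=.
  rewrite (negPf rp) /= andbT; case: (eqVneq x p) => [->|]; last by rewrite andbT.
  by rewrite andbF eq_sym (negPf rp) (negPf pq).
- by rewrite /dele eqq !xpair_eqE [q == r]eq_sym (negPf rq) andbF.
rewrite (eq_rank_poly dE) sum_rank_edge //; first last.
- move=> x y epx; rewrite er => /or3P[/eqP ->|/eqP ->|/eqP ->]; rewrite ?eqxx // es //.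
  by rewrite pqe.
- by move=> x; rewrite er => /or3P[] /eqP ->; rewrite // es.
have -> : #|[pred x | [&& e r x, x != r & x != p]]| = 1%N.
  rewrite -(card1 q); apply: eq_card => x; rewrite !inE er.
  case: (eqVneq x r) => [->|]; first by rewrite (negPf rq).
  by case: (eqVneq x p) => [->|]; rewrite ?(negPf pq) //= andbT.
have -> : #|[pred x | dele r p e q x && (x != r)]| = #|[pred x | e q x && (x != r)]|.
  apply: eq_card => x; rewrite !inE /dele; case: (eqVneq x r) => [->|xr].
    by rewrite !andbF.
  rewrite !xpair_eqE [q == r]eq_sym (negPf rq) /= (negPf xr) andbF.
  by rewrite !andbT.
have dE2 : delv q (delv r (dele r p e)) =2 delv q (delv r e).
  by move=> i j; rewrite !(delvE q) dE.
rewrite (eq_rank_poly dE2) expn1 expnS natrM. ring.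
Qed.

End VertexElimination.

(** The matrix [H] of the injection satisfies [H *m H^T = 1], so [A] and [H^T *m A *m H] have the
    same rank and determine each other among matrices supported in the image of [h]. *)
Lemma rank_poly_inj n n' (h : 'I_n -> 'I_n') (e : rel 'I_n) (e' : rel 'I_n') :
  injective h -> (forall i j, e' (h i) (h j) = e i j) ->
  (forall i j, e' i j -> (i \in codom h) && (j \in codom h)) ->
  rank_poly e' = rank_poly e.
Proof.
move=> h_inj he he'; pose H : 'M['F_2]_(n, n') := \matrix_(i, j) (h i == j)%:R.
have HE (A : 'M['F_2]_n') i j : (H *m A *m H^T) i j = A (h i) (h j).
  rewrite mxE (bigD1 (h j)) //= !mxE eqxx mulr1 [X in _ + X]big1 ?addr0.
    rewrite (bigD1 (h i)) //= !mxE eqxx mul1r big1 ?addr0 // => k ki.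
    by rewrite mxE eq_sym (negPf ki) mul0r.
  by move=> k kj; rewrite !mxE [_ == k]eq_sym (negPf kj) mulr0.
have HH : H *m H^T = 1%:M.
  apply/matrixP => i j; have := HE 1%:M i j; rewrite mulmx1 => ->.
  by rewrite !mxE (inj_eq h_inj).
have Hfree : row_free H by apply/row_freeP; exists H^T.
have H'E (A : 'M['F_2]_n) i j : (H^T *m A *m H) (h i) (h j) = A i j.
  by rewrite -HE !mulmxA HH mul1mx -mulmxA HH mulmx1.
have H'0 (A : 'M['F_2]_n) i j : (i \in codom h) && (j \in codom h) = false ->
    (H^T *m A *m H) i j = 0.
  move=> /negbT; rewrite negb_and => /orP[ih|jh].
    rewrite -mulmxA mxE big1 // => k _; rewrite !mxE; case: eqP ih => [<-|_ _].
      by rewrite codom_f.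
    by rewrite mul0r.
  rewrite mxE big1 // => k _; rewrite [H k j]mxE; case: eqP jh => [<-|_ _].
    by rewrite codom_f.
  by rewrite mulr0.
rewrite /rank_poly (reindex_onto (fun A => H^T *m A *m H)
                                 (fun A => H *m A *m H^T)) /=; last first.
  move=> A /sym_suppP[As Ae]; apply/matrixP => i j.
  have [/andP[/codomP[i' ->] /codomP[j' ->]]|ij] :=
    boolP ((i \in codom h) && (j \in codom h)).
    by rewrite H'E HE.
  rewrite H'0 ?(negPf ij) //; apply/esym/eqP; apply: contraNT ij.
  by move=> /Ae; exact: he'.
apply: eq_big => [A|A _]; last first.
  by rewrite (mxrankMfree _ Hfree) -mxrank_tr trmx_mul trmxK mxrankMfree // mxrank_tr.
have -> : H *m (H^T *m A *m H) *m H^T == A.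
  by apply/eqP/matrixP => i j; rewrite HE H'E.
rewrite andbT; apply/sym_suppP/sym_suppP => [[As Ae]|[As Ae]]; split=> i j.
- by rewrite -H'E As H'E.
- by rewrite -H'E => /Ae; rewrite he.
- have [/andP[/codomP[i' ->] /codomP[j' ->]]|ij] :=
    boolP ((i \in codom h) && (j \in codom h)).
    by rewrite !H'E As.
  by rewrite !H'0 ?(negPf ij) // andbC (negPf ij).
have [/andP[/codomP[i' ->] /codomP[j' ->]]|ij] :=
    boolP ((i \in codom h) && (j \in codom h)).
  by rewrite H'E he => /Ae.
by rewrite H'0 ?eqxx // (negPf ij).
Qed.

Lemma card_ord_mem N (s : seq nat) : uniq s -> all (gtn N) s ->
  #|[pred x : 'I_N | val x \in s]| = size s.
Proof.
move=> us /allP sN; rewrite cardE -(size_map val); apply: perm_size.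
apply: uniq_perm => // [|x]; first by rewrite (map_inj_uniq val_inj) enum_uniq.
apply/mapP/idP => [[y]|xs]; first by rewrite mem_enum => ? ->.
by exists (Ordinal (sN x xs)); rewrite ?mem_enum.
Qed.

(** * The support of the matrices of the form Delta *)

Section Strip.
Local Open Scope nat_scope.
Variable st : pred nat.

Fixpoint last_start (j : nat) : nat :=
  if j is j'.+1 then (if st j then j else last_start j') else 0.

(** The smaller neighbours of [r]. The shift by two lets a single rule cover all cases: from offset
    2 on, [last_start r.-2] is the start of the block of [r], while the first two indices of a block
    are joined to the start of the preceding block. *)
Definition strip_arc (r s : nat) : bool :=
  (r == s.+1) || ((1 < r) && (s == last_start r.-2)).

Definition strip : rel nat :=
  fun r s => [|| r == s, strip_arc r s | strip_arc s r].

Definition strip_poly (S : pred nat) N : {poly int} :=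
  rank_poly (fun i j : 'I_N => [&& S i, S j & strip i j]).

Definition full_strip_poly N := strip_poly (gtn N) N.
Definition cut_strip_poly N q := strip_poly [pred x | (x < N) && (x != q)] N.

Lemma last_start_le j : last_start j <= j.
Proof. by elim: j => //= j IH; case: (st _) => //; exact: leqW. Qed.

Lemma last_start_between i j : last_start i <= j <= i ->
  last_start j = last_start i.
Proof.
elim: i => [|i IH] /= ; first by case: j.
case: ifP => [sti /andP[ij ji]|sti /andP[ij]].
  by have -> : j = i.+1 by [lia]; rewrite /= sti.
rewrite leq_eqVlt => /orP[/eqP -> /=|ji]; first by rewrite sti.
by apply: IH; rewrite ij.
Qed.

Lemma strip_sym : symmetric strip.
Proof. by move=> r s; rewrite /strip eq_sym [strip_arc r s || _]orbC. Qed.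

Lemma strip_refl : reflexive strip.
Proof. by move=> r; rewrite /strip eqxx. Qed.

Lemma stripE r s : s < r -> strip r s = strip_arc r s.
Proof.
move=> sr; rewrite /strip (gtn_eqF sr) /=.
case: (boolP (strip_arc s r)) => [|_]; last by rewrite orbF.
have := last_start_le s.-2.
by rewrite {1}/strip_arc => ? /orP[/eqP|/andP[_ /eqP]]; lia.
Qed.

(** This is the edge on which [j.+2] is placed, so each new index completes a triangle. *)
Lemma strip_last_start j : strip j.+1 (last_start j).
Proof.
rewrite stripE ?ltnS ?last_start_le // /strip_arc.
by case: j => [|j] //=; case: ifP; rewrite eqxx ?orbT.
Qed.

Lemma strip_poly_ext (S S' : pred nat) N :
  (forall x, x < N -> S x = S' x) -> strip_poly S N = strip_poly S' N.
Proof. by move=> SS; apply: eq_rank_poly => i j; rewrite !SS. Qed.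

Lemma strip_poly_widen (S : pred nat) N N' : N <= N' ->
  (forall x, S x -> x < N) -> strip_poly S N' = strip_poly S N.
Proof.
move=> NN' SN; apply: (rank_poly_inj (h := widen_ord NN')) => //.
  by move=> i j /(congr1 val) /= /val_inj.
have cod (i : 'I_N') : S i -> i \in codom (widen_ord NN').
  by move=> Si; apply/codomP; exists (Ordinal (SN i Si)); apply: val_inj.
by move=> i j /and3P[/cod -> /cod ->].
Qed.

(** A start [q] has two smaller neighbours, and it is adjacent to every later index as long as no
    new start occurs up to two positions before that index; this is what [r <= j.+3] guarantees. *)
Lemma card_strip_last_start (N j r : nat) (q := last_start j) :
  1 < q < r -> r <= j.+3 -> r <= N ->
  #|[pred x : 'I_N | (x < r) && strip q x]| = (r - q).+2.
Proof.
move=> /andP[q1 qr] rj rN.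
have qE : last_start q.-2 <= q.-2 by exact: last_start_le.
rewrite -[RHS](_ : size [:: q.-1, last_start q.-2 & iota q (r - q)] = _); last first.
  by rewrite /= size_iota.
rewrite -(@card_ord_mem N) /=.
- apply: eq_card => x; rewrite !inE mem_iota (subnKC (ltnW qr)).
  have [xr|] /= := ltnP x r; last by rewrite ?andbF ?orbF; lia.
  rewrite andbT; case: (ltngtP x q) => [xq|qx|->].
  - rewrite stripE // orbF /strip_arc q1 /=; congr (_ || _).
    by apply/eqP/eqP; lia.
  - rewrite !orbT strip_sym stripE // /strip_arc.
    case: (eqVneq (x : nat) q.+1) => //= xq1; apply/andP; split; first by lia.
    by rewrite (@last_start_between j) //; apply/andP; split; lia.
  by rewrite !orbT strip_refl.
- by rewrite !inE !mem_iota iota_uniq; apply/and3P; split=> //; lia.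
apply/and3P; split; [lia|lia|]; apply/allP => x; rewrite mem_iota /=; lia.
Qed.

End Strip.

(** * Recurrences for the rank polynomials of a strip *)

Section StripRecurrences.
Variable st : pred nat.
Local Notation full := (full_strip_poly st).
Local Notation cut := (cut_strip_poly st).
Local Notation last_start := (last_start st).
Local Notation strip := (strip st).
Local Notation strip_poly := (strip_poly st).

Local Notation strip_on S N := (fun i j : 'I_N => [&& S i, S j & strip i j]).

Definition rem1 (S : pred nat) r : pred nat := [pred x | S x && (x != r)].

Lemma delv_strip1 (S : pred nat) N (r : 'I_N) :
  delv r (strip_on S N) =2 strip_on (rem1 S r) N.
Proof.
move=> i j; rewrite delvE /rem1 /= -!val_eqE /=.
by do ![case: (_ == _)] => /=; rewrite ?andbT ?andbF.
Qed.

Lemma delv_strip2 (S : pred nat) N (r p : 'I_N) :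
  delv p (delv r (strip_on S N)) =2 strip_on (rem1 (rem1 S r) p) N.
Proof. by move=> i j; rewrite -delv_strip1 !(delvE p) delv_strip1. Qed.

Lemma strip_on_sym (S : pred nat) N : symmetric (strip_on S N).
Proof. by move=> i j; rewrite strip_sym; case: (S i); case: (S j). Qed.

Lemma strip_poly_leaf (S : pred nat) N r p : (r < N)%N -> (p < N)%N -> r != p ->
  S r -> S p ->
  (forall x, (x < N)%N -> S x -> strip r x = (x == r) || (x == p)) ->
  strip_poly S N = (1 + 2 * 'X) * strip_poly (rem1 S r) N
   + (2 ^ #|[pred x : 'I_N | rem1 S r x && strip p x]|)%:R * 'X^2
     * strip_poly (rem1 (rem1 S r) p) N.
Proof.
move=> rN pN rp Sr Sp er.
rewrite {1}/strip_poly (@rank_poly_leaf _ _ (Ordinal rN) (Ordinal pN)) //.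
- rewrite (eq_rank_poly (delv_strip1 _ _)) (eq_rank_poly (delv_strip2 _ _ _)).
  congr (_ + (2 ^ _)%:R * _ * _); apply: eq_card => x.
  by rewrite !inE /= Sp /= -!andbA -val_eqE /= [strip _ _ && _]andbC.
- exact: strip_on_sym.
- by rewrite /= Sp strip_refl.
move=> x; rewrite /= Sr /= -!val_eqE /=.
case: (boolP (S x)) => [Sx|Sx] /=; first by rewrite er.
by apply/esym; apply: contraNF Sx => /orP[/eqP ->|/eqP ->].
Qed.

Lemma strip_poly_triangle (S : pred nat) N r p q : (r < N)%N -> (p < N)%N ->
  (q < N)%N -> r != p -> r != q -> p != q -> S r -> S p -> S q ->
  (forall x, (x < N)%N -> S x -> strip r x = [|| x == r, x == p | x == q]) ->
  (forall x, (x < N)%N -> S x -> strip p x -> strip q x) ->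
  strip_poly S N = (1 + 4 * 'X) * strip_poly (rem1 S r) N
   + (2 ^ #|[pred x : 'I_N | rem1 S r x && strip p x]|.+1)%:R * 'X^2
     * strip_poly (rem1 (rem1 S r) p) N
   + (2 ^ #|[pred x : 'I_N | rem1 S r x && strip q x]|)%:R * 'X^2
     * strip_poly (rem1 (rem1 S r) q) N.
Proof.
move=> rN pN qN rp rq pq Sr Sp Sq er pqe.
rewrite {1}/strip_poly
  (@rank_poly_triangle _ _ (Ordinal rN) (Ordinal pN) (Ordinal qN)) //.
- rewrite (eq_rank_poly (delv_strip1 _ _)) !(eq_rank_poly (delv_strip2 _ _ _)).
  congr (_ + (2 ^ _.+1)%:R * _ * _ + (2 ^ _)%:R * _ * _); apply: eq_card => x;
    by rewrite !inE /= ?Sp ?Sq /= -!andbA -val_eqE /= [strip _ _ && _]andbC.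
- exact: strip_on_sym.
- by rewrite /= Sq strip_refl.
- move=> x; rewrite /= Sr /= -!val_eqE /=.
  case: (boolP (S x)) => [Sx|Sx] /=; first by rewrite er.
  by apply/esym; apply: contraNF Sx => /or3P[/eqP ->|/eqP ->|/eqP ->].
- by rewrite /= Sp strip_refl.
by move=> x /and3P[_ Sx px]; rewrite /= Sq Sx; exact: pqe.
Qed.

Lemma strip_lastE t x : (x < t.+3)%N ->
  strip t.+2 x = [|| x == t.+2, x == t.+1 | x == last_start t].
Proof.
have := last_start_le st t => lt.
rewrite ltnS leq_eqVlt => /orP[/eqP ->|xt]; first by rewrite strip_refl eqxx.
by rewrite stripE // (ltn_eqF xt) /strip_arc eqSS [x == t.+1]eq_sym.
Qed.

(** The triangle elimination for [r = t + 2], [p = t + 1] and the start [q]. The power of 2 in the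
    last term counts the neighbours of [q] below [r]; [1 < q] ensures that two of them precede
    [q]. *)
Lemma full_strip_rec t (q := last_start t) : (1 < q)%N ->
  full t.+3 = (1 + 4 * 'X) * full t.+2 + 16 * 'X^2 * full t.+1
    + (2 ^ (t.+4 - q))%:R * 'X^2 * cut t.+2 q.
Proof.
move=> q1; have qt : (q <= t)%N := last_start_le st t.
have subp x : (x < t.+3)%N -> strip t.+1 x -> strip q x.
  have sqp : strip q t.+1 by rewrite strip_sym strip_last_start.
  rewrite ltnS leq_eqVlt => /orP[/eqP -> _|xt].
    by rewrite strip_sym strip_lastE; [rewrite -/q eqxx !orbT|lia].
  case: t @q q1 qt xt sqp => [|t] q q1 qt xt sqp; first by move: q1 qt; lia.
  rewrite strip_lastE // => /or3P[/eqP ->//|/eqP ->|/eqP ->]; rewrite /q /=.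
    by case: ifP; rewrite ?strip_refl // strip_sym strip_last_start.
  by case: ifP; rewrite ?strip_refl // strip_last_start.
rewrite /full_strip_poly (@strip_poly_triangle _ _ t.+2 t.+1 q) //=; try lia.
- congr (_ * _ + _ * _ * _ + _ * _ * _).
  + rewrite -(@strip_poly_widen st (gtn t.+2) t.+2 t.+3) //.
    by apply: strip_poly_ext => x _; rewrite /rem1 /=; lia.
  + case: t @q q1 qt {subp} => [|t] q q1 qt; first by move: q1 qt; lia.
    have lt := last_start_le st t.
    (* Below [r], the neighbours of [p] are [p] itself and its two smaller neighbours, whence the
       exponent 3 + 1. *)
    rewrite -[16]/(2 ^ (size [:: t.+2; t.+1; last_start t]).+1)%:R.
    rewrite -(@card_ord_mem t.+4) /=; last by apply/and4P; split=> //; lia.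
      congr (2 ^ _.+1)%:R; apply: eq_card => x; rewrite !inE /=.
      have [xt|xt] := ltnP x t.+3; first by rewrite strip_lastE // /rem1 /=; lia.
      by have := ltn_ord x; rewrite /rem1 /=; lia.
    by rewrite !inE; lia.
  + rewrite -(@strip_poly_widen st (gtn t.+1) t.+1 t.+3) //; last by lia.
    by apply: strip_poly_ext => x _; rewrite /rem1 /=; lia.
  + congr (2 ^ _)%:R.
    have -> : (t.+4 - q = (t.+2 - q).+2)%N by lia.
    rewrite -(@card_strip_last_start st t.+3 t t.+2) //; last by rewrite q1 /= ltnS leqW.
    by apply: eq_card => x; rewrite !inE /rem1 /=; congr (_ && _); lia.
  rewrite /cut_strip_poly -(@strip_poly_widen st _ t.+2 t.+3) //; last first.
    by move=> x; rewrite /rem1 /=; lia.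
  by apply: strip_poly_ext => x _; rewrite /rem1 /=; lia.
- by move=> x xt _; rewrite strip_lastE.
by move=> x xt _; exact: subp.
Qed.

(** Without [q] the last index keeps only the neighbour [t + 1], so it is a leaf. *)
Lemma cut_strip_rec t (q := last_start t) : (0 < q)%N ->
  cut t.+3 q = (1 + 2 * 'X) * cut t.+2 q + 4 * 'X^2 * cut t.+1 q.
Proof.
move=> q0; have qt : (q <= t)%N := last_start_le st t.
rewrite /cut_strip_poly (@strip_poly_leaf _ _ t.+2 t.+1) //=; try lia.
- congr (_ * _ + _ * _ * _).
  + rewrite -(@strip_poly_widen st _ t.+2 t.+3) //; last first.
      by move=> x; rewrite /rem1 /=; lia.
    by apply: strip_poly_ext => x _; rewrite /rem1 /=; lia.
  + case: t @q q0 qt => [|t] q q0 qt; first by move: q0 qt; lia.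
    have lt := last_start_le st t.
    (* One of the two smaller neighbours of [t.+2] is the deleted [q]; [y] is the other one. *)
    pose y := if q == t.+1 then last_start t else t.+1.
    rewrite -[4]/(2 ^ (size [:: t.+2; y]))%:R.
    rewrite -(@card_ord_mem t.+4) /=; last by rewrite /y; case: ifP => _; lia.
      congr (2 ^ _)%:R; apply: eq_card => x; rewrite !inE /=.
      have := ltn_ord x; have [xt|xt] := ltnP x t.+3.
        rewrite strip_lastE // /rem1 /= /y; case: ifP => qt1; first by lia.
        by have := qt1; rewrite /q /=; case: ifP; rewrite ?eqxx // => _ _; lia.
      by rewrite /rem1 /= /y; case: ifP => _; lia.
    by rewrite !inE /y; case: ifP => _; lia.
  rewrite -(@strip_poly_widen st _ t.+1 t.+3) //; last by move=> x; rewrite /rem1 /=; lia.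
    by apply: strip_poly_ext => x _; rewrite /rem1 /=; lia.
  by lia.
move=> x xt /andP[_ xq]; rewrite strip_lastE // -/q (negPf xq).
by rewrite orbF.
Qed.

(** The case of a last block of length 1: its start [j + 1] is deleted, and its other index [j + 2]
    is a leaf attached to the start of the preceding block. *)
Lemma cut_strip_rec0 j (q := last_start j) : (1 < q < j.+1)%N ->
  cut j.+3 j.+1 = (1 + 2 * 'X) * full j.+1
    + (2 ^ (j.+3 - q))%:R * 'X^2 * cut j.+1 q.
Proof.
move=> /andP[q1 qj].
rewrite /cut_strip_poly (@strip_poly_leaf _ _ j.+2 q) //=; try lia.
- congr (_ * _ + _ * _ * _).
  + rewrite /full_strip_poly -(@strip_poly_widen st _ j.+1 j.+3) //; last by lia.
    by apply: strip_poly_ext => x _; rewrite /rem1 /=; lia.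
  + congr (2 ^ _)%:R.
    have -> : (j.+3 - q = (j.+1 - q).+2)%N by lia.
    rewrite -(@card_strip_last_start st j.+3 j j.+1) ?q1 //; try lia.
    by apply: eq_card => x; rewrite !inE /rem1 /=; congr (_ && _); lia.
  rewrite -(@strip_poly_widen st _ j.+1 j.+3) //; last by move=> x; rewrite /rem1 /=; lia.
    by apply: strip_poly_ext => x _; rewrite /rem1 /=; lia.
  by lia.
move=> x xt /andP[_ xq]; rewrite strip_lastE // -/q (negPf xq).
by [].
Qed.

Lemma cut_strip0 q : cut q.+1 q = full q.
Proof.
rewrite /cut_strip_poly /full_strip_poly.
rewrite -(@strip_poly_widen st (gtn q) q q.+1) //.
by apply: strip_poly_ext => x _; rewrite /rem1 /=; lia.
Qed.

End StripRecurrences.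

Lemma sum_polyX_card (I : finType) (P : pred I) (f : I -> nat) B :
  (forall i, P i -> (f i < B)%N) ->
  \sum_(i | P i) 'X^(f i)
  = \poly_(j < B) #|[set i | P i & f i == j]|%:Z :> {poly int}.
Proof.
move=> fB; apply/polyP => j; rewrite coef_sum coef_poly.
transitivity (\sum_(i | P i) (f i == j)%:R : int).
  by apply: eq_bigr => i _; rewrite coefXn eq_sym.
rewrite -natr_sum natz; case: ltnP => Bj.
  by rewrite -sum1dep_card big_mkcondr.
rewrite big1 // => i Pi.
by rewrite ltn_eqF // (leq_trans (fB i Pi)).
Qed.

(** * Numbering of the indices by blocks and offsets *)

Section BlockStarts.
Local Open Scope nat_scope.
Variable m : seq nat.
Local Notation k := (size m).

(* The vertices e_i and e_{i,l} of the i-th block (i from 0) are numbered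
   block_start i and block_start i + l. *)
Definition block_start (i : nat) : nat := sumn (take i (map S m)).
Definition is_start : pred nat := [pred r | r \in map block_start (iota 0 k)].
Definition strip_size : nat := sumn (map S m).

Lemma block_start0 : block_start 0 = 0.
Proof. by rewrite /block_start take0. Qed.

Lemma block_startS i : i < k -> block_start i.+1 = block_start i + (nth 0 m i).+1.
Proof.
move=> ik; rewrite /block_start (take_nth 0) ?size_map //.
by rewrite sumn_rcons (nth_map 0).
Qed.

Lemma block_start_size : block_start k = strip_size.
Proof. by rewrite /block_start -(size_map S) take_size. Qed.

Lemma block_start_lt i j : i < j <= k ->
  block_start i + nth 0 m i < block_start j.
Proof.
case/andP; elim: j => // j IH; rewrite ltnS leq_eqVlt => ij jk.
rewrite block_startS //; case/orP: ij => [/eqP ->|ij]; first by lia.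
by have := IH ij (ltnW jk); lia.
Qed.

Lemma block_num_inj i l i' l' : i < k -> i' < k -> l <= nth 0 m i ->
  l' <= nth 0 m i' -> block_start i + l = block_start i' + l' -> i = i' /\ l = l'.
Proof.
move=> ik ik' lm lm' E; case: (ltngtP i i') => [ii|ii|ii].
- by have := @block_start_lt i i'; rewrite ii ltnW // => /(_ isT); lia.
- by have := @block_start_lt i' i; rewrite ii ltnW // => /(_ isT); lia.
by split=> //; move: E; rewrite ii; lia.
Qed.

Lemma last_start_uniq (st : pred nat) s j : s = 0 \/ st s -> s <= j ->
  (forall x, s < x <= j -> ~~ st x) -> last_start st j = s.
Proof.
move=> ss; elim: j => [|j IH] sj nst /=; first by lia.
case: (eqVneq s j.+1) => [sj1|sj1].
  by case: ss => [|sts]; [lia | rewrite -sj1 sts].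
have -> : st j.+1 = false by apply/negbTE/nst; lia.
by apply: IH => [|x xj]; [lia | apply: nst; lia].
Qed.

Lemma last_start_block i l : i < k -> l <= nth 0 m i ->
  last_start is_start (block_start i + l) = block_start i.
Proof.
move=> ik lm; apply: last_start_uniq; first 2 last.
- move=> x xi; apply/negP => /mapP[j]; rewrite mem_iota /= => jk xj.
  have := @block_num_inj i (x - block_start i) j 0 ik jk; case; try lia.
- by right; apply/mapP; exists i => //; rewrite mem_iota.
by lia.
Qed.

Hypothesis m_gt0 : all (leq 1) m.

Lemma nth_gt0 i : i < k -> 0 < nth 0 m i.
Proof. by move=> ik; exact: (allP m_gt0) _ (mem_nth 0 ik). Qed.

(** [strip_arc] in the coordinates block and offset: the first two disjuncts describe the
    predecessor of an index, the last two the start reached by [last_start]. *)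
Definition block_arc (i l i' l' : nat) : bool :=
  [|| (i == i') && (l == l'.+1),
      [&& i == i'.+1, l == 0 & l' == nth 0 m i'],
      [&& 1 < l, i' == i & l' == 0] |
      [&& l <= 1, i == i'.+1 & l' == 0]].

Lemma block_arcE i l i' l' : i < k -> i' < k -> l <= nth 0 m i ->
  l' <= nth 0 m i' ->
  strip_arc is_start (block_start i + l) (block_start i' + l')
  = block_arc i l i' l'.
Proof.
move=> ik ik' lm lm'; rewrite /strip_arc /block_arc orbA; congr (_ || _).
  case: l lm => [|l] lm.
    case: i ik lm => [|i] ik lm.
      by rewrite block_start0; lia.
    rewrite (block_startS (ltnW ik)) addn0 addnS eqSS andbF /=.
    apply/eqP/andP => [|[/eqP[->] /eqP ->] //].
    move/esym/(block_num_inj ik' (ltnW ik) lm' (leqnn _)) => [-> ->].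
    by rewrite !eqxx.
  rewrite addnS eqSS /= andbF orbF; apply/eqP/andP => [|[/eqP -> /eqP[->]] //].
  by move/(block_num_inj ik ik' (ltnW lm) lm') => [-> ->].
case: (ltnP 1 l) => l1 /=; rewrite ?orbF.
  have -> : (block_start i + l).-2 = block_start i + l.-2 by lia.
  rewrite last_start_block ?orbF; [|lia..].
  rewrite (_ : 1 < _) /=; last by lia.
  apply/eqP/andP => [|[/eqP -> /eqP ->]]; last by rewrite addn0.
  rewrite -[RHS]addn0 => /(block_num_inj ik' ik lm' (leq0n _)) [-> ->].
  by [].
case: i ik lm => [|i] ik lm; first by rewrite block_start0; lia.
have := nth_gt0 (ltnW ik) => mi.
have -> : (block_start i.+1 + l).-2 = block_start i + (nth 0 m i + l).-1.
  by rewrite (block_startS (ltnW ik)); lia.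
rewrite last_start_block ?(ltnW ik) //; last by lia.
rewrite (_ : 1 < _) /=; last by rewrite (block_startS (ltnW ik)); lia.
apply/eqP/andP => [|[/eqP[->] /eqP ->]]; last by rewrite addn0.
rewrite -[RHS]addn0 => /(block_num_inj ik' (ltnW ik) lm' (leq0n _)) [-> ->].
by [].
Qed.

End BlockStarts.

Section DeltaStrip.
Variable m : seq nat.
Hypothesis m_gt0 : all (leq 1) m.

Definition delta_num (a : delta_index m) : nat :=
  match a with
  | inl i => block_start m i
  | inr p => (block_start m (tag p) + (tagged p).+1)%N
  end.

Definition delta_block (a : delta_index m) : nat :=
  match a with inl i => i | inr p => tag p end.
Definition delta_offset (a : delta_index m) : nat :=
  match a with inl i => 0%N | inr p => (tagged p).+1 end.

Lemma delta_numE a : delta_num a = (block_start m (delta_block a) + delta_offset a)%N.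
Proof. by case: a => [i|p] /=; rewrite ?addn0. Qed.

Lemma delta_block_lt a : (delta_block a < size m)%N.
Proof. by case: a => [i|p] /=. Qed.

Lemma delta_offset_le a : (delta_offset a <= nth 0%N m (delta_block a))%N.
Proof. by case: a => [i|p] //=. Qed.

Lemma delta_num_inj : injective delta_num.
Proof.
move=> a b; rewrite !delta_numE => /(block_num_inj (delta_block_lt a)
  (delta_block_lt b) (delta_offset_le a) (delta_offset_le b)).
case: a b => [i|[i l]] [j|[j n]] [] //= /val_inj ij; first by rewrite ij.
by case: _ / ij n => n [/val_inj ->].
Qed.

Lemma delta_num_lt a : (delta_num a < strip_size m)%N.
Proof.
rewrite delta_numE -block_start_size; have ak := delta_block_lt a.
have := delta_offset_le a.
by have := @block_start_lt m (delta_block a) (size m); rewrite ak leqnn => /(_ isT); lia.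
Qed.

Lemma card_delta_index : #|{: delta_index m}| = strip_size m.
Proof.
rewrite card_sum card_ord card_tagged.
have -> : map (fun i : 'I_(size m) => #|'I_(nth 0%N m i)|) (enum 'I_(size m)) = m.
  apply: (@eq_from_nth _ 0%N); rewrite size_map -cardE card_ord // => i im.
  by rewrite (nth_map (Ordinal im)) -?cardE ?card_ord // nth_enum_ord.
by rewrite /strip_size; elim: (m) => //= x s <-; lia.
Qed.

Lemma strip_delta a b :
  strip (is_start m) (delta_num a) (delta_num b) = delta_pos a b || delta_pos b a.
Proof.
rewrite /strip (inj_eq delta_num_inj) !delta_numE.
rewrite !block_arcE ?delta_block_lt ?delta_offset_le //.
case: a b => [i|[i l]] [j|[j n]]; rewrite /block_arc /=.
- have := nth_gt0 m_gt0 (ltn_ord i); have := nth_gt0 m_gt0 (ltn_ord j).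
  have -> : (inl i == inl j :> delta_index m) = (i == j :> nat) by [].
  lia.
- by rewrite -!val_eqE /= orbF; lia.
- by rewrite -!val_eqE /=; lia.
have -> : (inr (Tagged _ l) == inr (Tagged _ n) :> delta_index m)
          = (i == j :> nat) && (l == n :> nat).
  apply/eqP/andP => [E|[/eqP/val_inj ij]].
    have /= ij := congr1 delta_block E; have /= [ln] := congr1 delta_offset E.
    by split; apply/eqP.
  by case: _ / ij n => n /eqP/val_inj ->.
by rewrite -!val_eqE /=; lia.
Qed.

Definition delta_ord (i : 'I_#|{: delta_index m}|) : 'I_(strip_size m) :=
  Ordinal (delta_num_lt (enum_val i)).

Lemma delta_ord_inj : injective delta_ord.
Proof. by move=> i j [] /delta_num_inj/enum_val_inj. Qed.

Lemma lambda_polyE : (0 < size m)%N ->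
  lambda_poly m
  = cut_strip_poly (is_start m) (strip_size m) (block_start m (size m).-1).
Proof.
move=> m0; rewrite /cut_strip_poly /strip_poly.
rewrite (rank_poly_inj delta_ord_inj (fun _ _ => erefl _)); last first.
  have [g _ gK] : bijective delta_ord.
    by apply: (inj_card_bij delta_ord_inj); rewrite !card_ord card_delta_index.
  by move=> i j _; rewrite -(gK i) -(gK j) !codom_f.
rewrite /rank_poly (@sum_polyX_card _ _ _ #|{: delta_index m}|.+1); last first.
  by move=> M _; rewrite ltnS rank_leq_row.
have km : ((size m).-1 < size m)%N by rewrite prednK.
have lastE (a : delta_index m) :
    (delta_num a != block_start m (size m).-1) = (a != inl (Ordinal km)).
  by rewrite -[block_start m _]/(delta_num (inl (Ordinal km))) (inj_eq delta_num_inj).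
apply/polyP => j; rewrite !coef_poly; case: ifP => // _; congr Posz.
apply: eq_card => M; rewrite !inE; congr (_ && _).
apply/andP/sym_suppP => [[/forallP MD /forallP ML]|[Ms Me]].
  have Ms i i' : M i i' = M i' i.
    have /forallP/(_ (enum_val i'))/andP[/eqP] := MD (enum_val i).
    by rewrite /entry !enum_valK.
  have ML0 i : enum_val i = inl (Ordinal km) -> forall i', M i i' = 0.
    move=> iE i'; have := ML (Ordinal km); rewrite /= prednK // eqxx /=.
    move=> /forallP/(_ (enum_val i'))/andP[/eqP + _].
    by rewrite /entry -iE !enum_valK.
  split=> // i i' Mii; rewrite !inE !lastE !delta_num_lt /=; apply/and3P; split.
  - by apply: contraNneq Mii => /ML0 ->.
  - by apply: contraNneq Mii => /ML0; rewrite Ms => ->.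
  rewrite strip_delta; have /forallP/(_ (enum_val i'))/andP[_] := MD (enum_val i).
  by rewrite /entry !enum_valK => /implyP ->.
split; apply/forallP => a.
  apply/forallP => b; rewrite /entry Ms eqxx /=; apply/implyP => /Me/and3P[_ _].
  by rewrite /= !enum_rankK strip_delta orbC.
apply/implyP => ak; apply/forallP => b.
have aE : a = Ordinal km by apply: val_inj => /=; move: (eqP ak) => /=; lia.
rewrite /entry Ms andbb; apply: contraT => /Me/and3P[_].
by rewrite /= !enum_rankK lastE aE eqxx andbF.
Qed.

End DeltaStrip.

Lemma F2_cross (a b c d : 'F_2) : a + b = c + d -> a + c = b + d.
Proof.
move=> E; have -> : a = c + d + b by rewrite -E -addrA F2_addrr addr0.
by rewrite addrC !addrA F2_addrr add0r addrC.
Qed.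

(** * Euler genus of the embeddings of a plane cubic graph *)

Section OrbitPairs.
Variables (D : finType) (f a : D -> D) (X : {pred D}).
Hypotheses (f_inj : injective f) (fX : fclosed f X).
Hypotheses (aX : forall x, x \in X -> a x \in X)
  (aK : forall x, x \in X -> a (a x) = x)
  (faf : forall x, x \in X -> f (a (f x)) = a x)
  (a_neq : forall x, x \in X -> a x != x)
  (af_neq : forall x, x \in X -> a (f x) != x).

Definition invariant_functions : {set {ffun D -> 'F_2}} :=
  [set w : {ffun D -> 'F_2} |
    [forall x, if x \in X then (w (f x) == w x) && (w (a x) == w x) else w x == 0]].

Let fXE x : (f x \in X) = (x \in X).
Proof. by rewrite (fX (eqxx (f x))). Qed.

(** If [a y] were [f^(i+2) y], then cancelling [f] in [f (a (f y)) = a y] gives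
    [a (f y) = f^i (f y)]. The exponent thus drops by two until it is 0 or 1, and these cases
    contradict [a_neq] and [af_neq]. *)
Lemma involution_not_fconnect x : x \in X -> ~~ fconnect f x (a x).
Proof.
move=> xX; apply/negP => /iter_findex; move: (findex f x (a x)) => n.
suff H i y : y \in X -> a y <> iter i f y /\ a y <> iter i.+1 f y.
  by move=> E; have [] := H n x xX; rewrite E.
elim: i y => [|i IH] y yX; split.
- by apply/eqP; exact: a_neq.
- by rewrite /= -faf // => /f_inj/eqP; apply/negP; exact: af_neq.
- by have [] := IH y yX.
have fyX : f y \in X by rewrite fXE.
have [H _] := IH (f y) fyX; move=> E; apply: H; apply: f_inj.
by rewrite faf // E -iterSr.
Qed.

Let Xf : {set {ffun D -> 'F_2}} :=
  [set w : {ffun D -> 'F_2} | [forall x, if x \in X then w (f x) == w x else w x == 0]].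

Let root_f x : froot f (f x) = froot f x.
Proof.
by apply/eqP; rewrite eq_sym (root_connect (fconnect_sym f_inj)) fconnect1.
Qed.

Let XfP (w : {ffun D -> 'F_2}) : reflect ((forall x, x \in X -> w (froot f x) = w x)
                     /\ (forall x, x \notin X -> w x = 0)) (w \in Xf).
Proof.
rewrite inE; apply: (iffP forallP) => [wX|[wX wN] x].
  split=> x xX; last by have := wX x; rewrite (negPf xX) => /eqP.
  have /iter_findex <- := connect_root (frel f) x.
  elim: (findex _ _ _) => //= n <-; have := wX (iter n f x).
  suff -> : iter n f x \in X by move=> /eqP.
  by elim: n => //= n IH; rewrite fXE.
case: ifP => xX; last by rewrite wN ?xX.
by rewrite -(wX x xX) -(wX (f x)) ?fXE // root_f.
Qed.

Let rootX x : (froot f x \in X) = (x \in X).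
Proof. by rewrite -(closed_connect fX (connect_root _ x)). Qed.

Let card_Xf : #|Xf| = (2 ^ fcard f X)%N.
Proof.
pose R := [predI froots f & X].
have <- : #|pffun_on (0 : 'F_2) R predT| = (2 ^ fcard f X)%N.
  by rewrite card_pffun_on card_Fp.
pose h (k : {ffun D -> 'F_2}) := [ffun x => if x \in X then k (froot f x) else 0].
suff h_inj : {in pffun_on (0 : 'F_2) R predT &, injective h}.
  rewrite -(card_in_imset h_inj); apply: eq_card => w.
  apply/XfP/imsetP => [[wX wN]|[k _ ->]].
    exists [ffun x => if x \in R then w x else 0].
      apply/pffun_onP; split=> //; apply/subsetP => x.
      by rewrite inE /= ffunE; case: ifP; rewrite ?eqxx.
    apply/ffunP => x; rewrite !ffunE; case: ifP => [xX|xX]; last by rewrite wN ?xX.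
    by rewrite !inE (roots_root (fconnect_sym f_inj)) rootX xX /= wX.
  split=> x xX; rewrite !ffunE ?(negPf xX) //.
  by rewrite rootX xX (root_root (fconnect_sym f_inj)).
move=> k k' /pffun_onP[/subsetP kR _] /pffun_onP[/subsetP kR' _] /ffunP hk.
apply/ffunP => x; have [xR|xR] := boolP (x \in R).
  have := hk x; rewrite !ffunE; move: xR; rewrite !inE => /andP[/eqP xr ->].
  by rewrite xr.
have -> : k x = 0 by apply/eqP; apply: contraNT xR => kx; exact: kR.
by apply/esym/eqP; apply: contraNT xR => kx; exact: kR'.
Qed.

(** The involution [a] pairs the orbits of [f] without fixing any, so an [f]-invariant function
    amounts to two functions that are invariant under [a] as well, one for each member of the
    pairs. *)
Lemma card_invariant_functions :
  (#|invariant_functions| ^ 2 = 2 ^ fcard f X)%N.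
Proof.
rewrite -card_Xf -mulnn -cardsX.
(* The comparison of roots selects one orbit from each pair. *)
pose ch x := (enum_rank (froot f x) < enum_rank (froot f (a x)))%N.
have root_af x : x \in X -> froot f (a (f x)) = froot f (a x).
  by move=> xX; rewrite -root_f faf.
have ch_f x : x \in X -> ch (f x) = ch x.
  by move=> xX; rewrite /ch root_f root_af.
have ch_a x : x \in X -> ch (a x) = ~~ ch x.
  move=> xX; rewrite /ch aK //.
  have : enum_rank (froot f x) != enum_rank (froot f (a x)) :> nat.
    rewrite val_eqE (inj_eq enum_rank_inj) (root_connect (fconnect_sym f_inj)).
    exact: involution_not_fconnect.
  by lia.
(* [mix] uses the first function on the selected orbits and the second on the others; [lower]
   recovers each of them by copying the values across [a]. *)
pose mix (p : {ffun D -> 'F_2} * {ffun D -> 'F_2}) :=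
  [ffun x => if ch x then p.1 x else p.2 x].
pose lower (b : bool) (w : {ffun D -> 'F_2}) :=
  [ffun x => if ch x == b then w x else if x \in X then w (a x) else 0].
have WP (w : {ffun D -> 'F_2}) : reflect ((forall x, x \in X -> w (f x) = w x /\ w (a x) = w x)
    /\ (forall x, x \notin X -> w x = 0)) (w \in invariant_functions).
  rewrite inE; apply: (iffP forallP) => [wX|[wX wN] x].
    split=> x xX; have := wX x; first by rewrite xX => /andP[/eqP -> /eqP ->].
    by rewrite (negPf xX) => /eqP.
  by case: ifP => xX; [have [-> ->] := wX x xX; rewrite eqxx | rewrite wN ?xX].
have WfP (w : {ffun D -> 'F_2}) : reflect ((forall x, x \in X -> w (f x) = w x)
    /\ (forall x, x \notin X -> w x = 0)) (w \in Xf).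
  rewrite inE; apply: (iffP forallP) => [wX|[wX wN] x].
    split=> x xX; have := wX x; first by rewrite xX => /eqP.
    by rewrite (negPf xX) => /eqP.
  by case: ifP => xX; [rewrite wX | rewrite wN ?xX].
suff mix_inj : {in setX invariant_functions invariant_functions &, injective mix}.
  rewrite -(card_in_imset mix_inj); apply: eq_card => w.
  apply/imsetP/WfP => [[[u v]]|[wX wN]].
    rewrite in_setX /= => /andP[/WP[uX uN] /WP[vX vN]] ->; split=> x xX; rewrite !ffunE /=.
      by rewrite ch_f //; have [-> _] := uX x xX; have [-> _] := vX x xX.
    by rewrite uN // vN // if_same.
  have waf x : x \in X -> w (a (f x)) = w (a x).
    by move=> xX; rewrite -[in RHS]faf // wX // aX ?fXE.
  exists (lower true w, lower false w).
    have lowerW b : lower b w \in invariant_functions.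
      apply/WP; split=> x xX; rewrite !ffunE; last first.
        by rewrite wN // (negPf xX) if_same.
      rewrite ch_f // ch_a // fXE aX // aK // xX wX // waf //; split=> //.
      by case: (ch x); case: b.
    by rewrite in_setX /= !lowerW.
  by apply/ffunP => x; rewrite !ffunE /=; case: (ch x).
move=> [u v] [u' v']; rewrite !in_setX /=.
move=> /andP[/WP[uX uN] /WP[vX vN]] /andP[/WP[uX' uN'] /WP[vX' vN']].
move=> /ffunP E; congr (_, _); apply/ffunP => x.
  have [xX|xX] := boolP (x \in X); last by rewrite uN ?uN'.
  have := E x; have := E (a x); rewrite !ffunE /= ch_a //.
  have [_ ->] := uX x xX; have [_ ->] := uX' x xX.
  by case: (ch x).
have [xX|xX] := boolP (x \in X); last by rewrite vN ?vN'.
have := E x; have := E (a x); rewrite !ffunE /= ch_a //.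
have [_ ->] := vX x xX; have [_ ->] := vX' x xX.
by case: (ch x).
Qed.

End OrbitPairs.

(** * Potentials on connected graphs and on forests *)

Section Potentials.
Variables (V : finType) (t : rel V) (h : V -> V -> 'F_2).

Definition potentials : {set {ffun V -> 'F_2}} :=
  [set g : {ffun V -> 'F_2} | [forall v, forall w, t v w ==> (g v + g w == h v w)]].

Lemma potentialsP (g : {ffun V -> 'F_2}) :
  reflect (forall v w, t v w -> g v + g w = h v w) (g \in potentials).
Proof.
rewrite inE; apply: (iffP forallP) => [H v w tvw|H v].
  by apply/eqP/(implyP (forallP (H v) w)).
by apply/forallP => w; apply/implyP => tvw; apply/eqP/H.
Qed.

(** The difference of two potentials is constant along every edge, hence constant, and F_2 offers
    two constants. *)
Lemma card_potentials (v0 : V) : (forall v w, connect t v w) ->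
  (exists g : V -> 'F_2, forall v w, t v w -> g v + g w = h v w) ->
  #|potentials| = 2%N.
Proof.
move=> tc [g0 g0h]; pose s (c : 'F_2) : {ffun V -> 'F_2} := [ffun v => g0 v + c].
have s_inj : injective s by move=> c d /ffunP/(_ v0); rewrite !ffunE => /addrI.
transitivity #|s @: [set: 'F_2]|; last by rewrite card_imset // cardsT card_Fp.
apply: eq_card => g; apply/potentialsP/imsetP => [gh|[c _ ->] v w tvw].
  exists (g v0 + g0 v0) => //; apply/ffunP => v; rewrite ffunE.
  have /connectP[p pt ->] := tc v0 v.
  elim: p v0 pt => [|w p IH] u /=.
    by move=> _; rewrite addrCA F2_addrr addr0.
  case/andP=> tuw /IH ->; congr (_ + _); apply: F2_cross.
  by rewrite addrC gh // addrC g0h.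
by rewrite !ffunE addrACA F2_addrr addr0 g0h.
Qed.

End Potentials.

Section Forest.
Variables (V : finType) (h : V -> V -> 'F_2).
Hypothesis h_sym : forall v w, h v w = h w v.
Implicit Types T : {set {set V}}.
Local Notation joined T := [rel v w | [set v; w] \in (T : {set {set V}})].

Lemma joined_sym T : symmetric (joined T).
Proof. by move=> v w; rewrite /= setUC. Qed.

Lemma set2_inj (a b v w : V) : [set v; w] = [set a; b] ->
  (v = a /\ w = b) \/ (v = b /\ w = a).
Proof.
move=> E; have : v \in [set a; b] by rewrite -E set21.
have : w \in [set a; b] by rewrite -E set22.
have : a \in [set v; w] by rewrite E set21.
have : b \in [set v; w] by rewrite E set22.
rewrite !inE => bvw avw /orP[/eqP wa|/eqP wb] /orP[/eqP va|/eqP vb]; auto.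
  by left; move: bvw; rewrite wa va orbb => /eqP ->.
by left; move: avw; rewrite wb vb orbb => /eqP ->.
Qed.

(** Induction on the number of edges: after the removal of [{a, b}], acyclicity separates [a] from
    [b]. The first hypothesis excludes loops, since [[set v; v]] is the singleton of [v]. *)
Lemma forest_potential T : (forall v, [set v] \notin T) ->
  (forall c : seq V, ucycle (joined T) c -> (size c <= 2)%N) ->
  exists g : V -> 'F_2, forall v w, [set v; w] \in T -> g v + g w = h v w.
Proof.
have [n] := ubnP #|T|; elim: n T => // n IH T; rewrite ltnS => Tn TN Tc.
have [/existsP[[a b] /= abT]|noT] :=
  boolP [exists p : V * V, [set p.1; p.2] \in T]; last first.
  exists (fun=> 0) => v w vwT; case/negP: noT; apply/existsP.
  by exists (v, w).
pose T' := T :\ [set a; b].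
have subT' : subrel (joined T') (joined T) by move=> v w /setD1P[].
have [||c /andP[cT' uc]|g' g'h] := IH T'.
- by move: Tn; rewrite (cardsD1 [set a; b] T) abT.
- by move=> v; rewrite !inE negb_and TN orbT.
- by apply: Tc; rewrite /ucycle uc andbT; apply: sub_cycle cT'.
have sc : connect_sym (joined T') := sym_connect_sym (@joined_sym T').
have nab : ~~ connect (joined T') b a.
  apply/negP; rewrite sc => /connectP[p0 /shortenP[p pT' up _] bE].
  have /Tc : ucycle (joined T) (a :: p).
    apply/andP; split=> //=; rewrite rcons_path (sub_path subT' pT') /=.
    by rewrite -bE setUC.
  case: p pT' up bE => [_ _ ba|c [|//] /= ]; last first.
    by move=> /andP[+ _] _ bc _; rewrite -bc !inE eqxx.
  by move=> _; case/negP: (TN a); move: abT; rewrite /= ba /= setUid.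
(* A constant added on the component of [b] affects no equation but that of [{a, b}], and the
   constant is chosen to satisfy it. *)
exists (fun v => g' v + if connect (joined T') b v then g' a + g' b + h a b else 0).
have gab : g' a + 0 + (g' b + (g' a + g' b + h a b)) = h a b.
  rewrite addr0 !addrA -[g' a + _ + g' a]addrA [g' b + g' a]addrC addrA F2_addrr.
  by rewrite add0r F2_addrr add0r.
move=> v w vwT; have [E|nE] := eqVneq [set v; w] [set a; b].
  case: (set2_inj E) => -[-> ->]; rewrite connect0 (negPf nab) //.
  by rewrite addrC gab h_sym.
have vw : joined T' v w by rewrite /= !inE nE.
have -> : connect (joined T') b w = connect (joined T') b v.
  apply/idP/idP => bc; apply: connect_trans bc _; apply: connect1 => //.
  by rewrite joined_sym.
by rewrite addrACA F2_addrr addr0 g'h.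
Qed.

End Forest.

(** * Rotations at a vertex of degree three *)

Section CubicRotation.
Variables (V : finType).
Local Open Scope group_scope.

Definition rot3 (a b c : V) : {perm V} := tperm a b * tperm a c.

Lemma rot3E (a b c : V) : a != b -> a != c -> b != c ->
  [/\ rot3 a b c a = b, rot3 a b c b = c, rot3 a b c c = a &
      forall x, x \notin [set a; b; c] -> rot3 a b c x = x].
Proof.
move=> ab ac bc; rewrite /rot3; have [ba ca cb] : [/\ b != a, c != a & c != b].
  by rewrite ![_ == a]eq_sym [c == b]eq_sym.
split=> [||| x].
- by rewrite permM tpermL (tpermD ab cb).
- by rewrite permM tpermR tpermL.
- by rewrite permM (tpermD ac bc) tpermR.
rewrite !inE !negb_or => /andP[/andP[xa xb] xc].
by rewrite permM !tpermD // eq_sym.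
Qed.

Lemma porbit_sub (s : {perm V}) (S : {set V}) x :
  (forall y, y \in S -> s y \in S) -> x \in S -> porbit s x \subset S.
Proof.
move=> sS xS; apply/subsetP => y /porbitP[i ->].
by elim: i => [|i IH]; rewrite ?expg0 ?perm1 // expgSr permM sS.
Qed.

(** A set of three elements has two cyclic permutations, inverse to each other; a rotation at a
    cubic vertex is therefore a single bit. *)
Lemma cyclic_perm_on3 (a b c : V) (s : {perm V}) :
  a != b -> a != c -> b != c ->
  cyclic_perm_on [set a; b; c] s = (s == rot3 a b c) || (s == (rot3 a b c)^-1).
Proof.
move=> ab ac bc; have [ra rb rc rx] := rot3E ab ac bc.
set A := [set a; b; c]; set r := rot3 a b c.
have [aA bA cA] : [/\ a \in A, b \in A & c \in A] by rewrite !inE !eqxx ?orbT.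
have rA : cyclic_perm_on A r.
  have on : perm_on A r by apply/subsetP => x; rewrite inE; apply: contraR => /rx/eqP.
  have orb : porbit r a = A.
    apply/eqP; rewrite eqEsubset porbit_sub //=; last first.
      by move=> y; rewrite !inE => /orP[/orP[]|] /eqP ->; rewrite /r ?ra ?rb ?rc eqxx ?orbT.
    have m (x : V) : r x \in porbit r x by have := mem_porbit r 1 x; rewrite expg1.
    have mb : b \in porbit r a by rewrite -ra m.
    apply/subsetP => x; rewrite !inE => /orP[/orP[]|] /eqP -> //; first exact: porbit_id.
    by move: mb; rewrite -eq_porbit_mem => /eqP <-; rewrite -rb m.
  rewrite /cyclic_perm_on on; apply/forallP => x; apply/implyP.
  by rewrite -{1}orb -eq_porbit_mem orb.
apply/idP/orP => [/andP[on /forallP orb]|[] /eqP ->] //; last first.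
  case/andP: rA => on /forallP orb; rewrite /cyclic_perm_on perm_onV //.
  by apply/forallP => x; rewrite porbitV; exact: orb.
have sA x : x \in A -> s x \in A by rewrite (perm_closed _ on).
have noS (S : {set V}) x : x \in A -> x \in S -> (forall y, y \in S -> s y \in S) ->
    A \subset S.
  move=> xA xS sS; have /implyP/(_ xA)/eqP <- := orb x; exact: porbit_sub.
(* A fixed point ([n1]) or an exchanged pair ([n2]) would be an invariant proper subset of the
   orbit; what remains determines [s] from [s a]. *)
have n1 x y z : x \in A -> y \in A -> z \in A -> x != y -> s x != x.
  move=> xA yA zA xy; apply/negP => /eqP sx.
  have /subsetP/(_ y yA) : A \subset [set x].
    by apply: (noS _ x xA) => [|u]; rewrite !inE // => /eqP ->; rewrite sx.
  by rewrite inE eq_sym (negPf xy).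
have n2 x y z : x \in A -> y \in A -> z \in A -> x != z -> y != z -> s x = y -> s y != x.
  move=> xA yA zA xz yz sx; apply/negP => /eqP sy.
  have /subsetP/(_ z zA) : A \subset [set x; y].
    apply: (noS _ x xA) => [|u]; rewrite !inE ?eqxx // => /orP[] /eqP ->.
      by rewrite sx eqxx orbT.
    by rewrite sy eqxx.
  by rewrite !inE ![z == _]eq_sym (negPf xz) (negPf yz).
have sx x : x \notin A -> s x = x by exact: out_perm on.
have [ba ca cb] : [/\ b != a, c != a & c != b].
  by rewrite ![_ == a]eq_sym [c == b]eq_sym.
have : s a \in A by exact: sA.
rewrite !inE (negPf (n1 a b c _ _ _ _)) //= => /orP[] /eqP sa.
  left; have : s b \in A by exact: sA.
  rewrite !inE (negPf (n1 b a c _ _ _ _)) // (negPf (n2 a b c _ _ _ _ _ _)) //= => /eqP sb.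
  have sc : s c = a.
    have : s c \in A by exact: sA.
    rewrite !inE => /orP[/orP[]|] /eqP // sc.
      by move: ca; rewrite -(inj_eq (@perm_inj _ s)) sc sa eqxx.
    by move: cb; rewrite -(inj_eq (@perm_inj _ s)) sc sb eqxx.
  apply/eqP/permP => x; have [|xA] := boolP (x \in A); last by rewrite sx // rx.
  by rewrite !inE => /orP[/orP[]|] /eqP ->; rewrite /r ?ra ?rb ?rc.
right; have : s c \in A by exact: sA.
rewrite !inE (negPf (n1 c a b _ _ _ _)) // (negPf (n2 a c b _ _ _ _ _ _)) //=.
rewrite orbF => /eqP sc.
have sb : s b = a.
  have : s b \in A by exact: sA.
  rewrite !inE => /orP[/orP[]|] /eqP // sb.
    by move: cb; rewrite -(inj_eq (@perm_inj _ s)) sc sb eqxx.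
  by move: ba; rewrite -(inj_eq (@perm_inj _ s)) sa sb eqxx.
apply/eqP/permP => x; apply: (@perm_inj _ r); rewrite permKV.
have [|xA] := boolP (x \in A); last by rewrite sx // rx.
by rewrite !inE => /orP[/orP[]|] /eqP ->; rewrite ?sa ?sb ?sc /r ?ra ?rb ?rc.
Qed.

End CubicRotation.

(** * Embeddings of a plane cubic graph *)

Lemma card_kermx n (M : 'M['F_2]_n) :
  #|[set y : 'rV['F_2]_n | y *m M == 0]| = (2 ^ (n - \rank M))%N.
Proof.
rewrite -mxrank_ker; transitivity #|rowg (kermx M)|; last by rewrite card_rowg card_Fp.
by apply: eq_card => y; rewrite !inE sub_kermx.
Qed.

Lemma F2_neq0D (x y : 'F_2) : (x + y != 0) = (x != 0) (+) (y != 0).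
Proof. by case: (F2_cases x) (F2_cases y) => -> [] ->. Qed.

(* A plane cubic graph is given by the darts v -> w with the three neighbours
   na v, nb v, nc v in cyclic order; left v w is the inner face on the left of
   the dart, None standing for the outer face, cyc p is the dart that separates
   the inner face p from the outer one, and e is the adjacency of the inner
   faces.  The hypotheses inner_acyclic and inner_potential say that the edges
   between inner faces contain no cycle, in terms of F_2-cycles and of
   F_2-cochains respectively; cardV is Euler's formula. *)
Section PlaneCubicGraph.
Variables (V : finType) (adj : rel V) (n : nat).
Variables (na nb nc : V -> V) (left : V -> V -> option 'I_n).
Variables (e : rel 'I_n) (cyc : 'I_n -> V * V) (v0 : V).
Hypotheses (adjE : forall v w, adj v w = [|| w == na v, w == nb v | w == nc v])
  (adj_sym : symmetric adj) (adj_irr : irreflexive adj)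
  (nab : forall v, na v != nb v) (nac : forall v, na v != nc v)
  (nbc : forall v, nb v != nc v).
Hypotheses (left_ab : forall v, left (na v) v = left v (nb v))
  (left_bc : forall v, left (nb v) v = left v (nc v))
  (left_ca : forall v, left (nc v) v = left v (na v)).
Hypotheses (left_neq : forall v w, adj v w -> left v w != left w v)
  (left_inj : forall v w v' w', adj v w -> adj v' w' ->
     left v w = left v' w' -> left w v = left w' v' -> (v, w) = (v', w'))
  (cycP : forall p, [/\ adj (cyc p).1 (cyc p).2, left (cyc p).1 (cyc p).2 = Some p
                      & left (cyc p).2 (cyc p).1 = None]).
Hypotheses (e_refl : reflexive e)
  (e_left : forall v w p q, adj v w -> left v w = Some p -> left w v = Some q -> e p q)
  (left_e : forall p q, p != q -> e p q ->
     exists v w, [/\ adj v w, left v w = Some p & left w v = Some q]).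
Hypothesis inner_acyclic : forall x : V -> V -> 'F_2,
  (forall v w, adj v w -> x v w = x w v) ->
  (forall v, x v (na v) + x v (nb v) + x v (nc v) = 0) ->
  (forall v w, adj v w -> left v w = None -> x v w = 0) ->
  forall v w, adj v w -> x v w = 0.
Hypothesis inner_potential : forall h : V -> V -> 'F_2,
  (forall v w, h v w = h w v) ->
  exists g : V -> 'F_2, forall v w, adj v w -> left v w != None ->
    left w v != None -> g v + g w = h v w.
Hypothesis adj_connected : forall v w, connect adj v w.
Hypothesis cardV : (#|V| + 2 = 2 * n)%N.

Local Notation r0 v := (rot3 (na v) (nb v) (nc v)).

Lemma adj_na v : adj v (na v). Proof. by rewrite adjE eqxx. Qed.
Lemma adj_nb v : adj v (nb v). Proof. by rewrite adjE eqxx orbT. Qed.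
Lemma adj_nc v : adj v (nc v). Proof. by rewrite adjE eqxx !orbT. Qed.

Lemma adj_r0 v w : adj v (r0 v w) = adj v w.
Proof.
have [ra rb rc rx] := rot3E (nab v) (nac v) (nbc v).
have [|vw] := boolP (adj v w).
  by rewrite {1}adjE => /or3P[] /eqP ->; rewrite ?ra ?rb ?rc ?adj_na ?adj_nb ?adj_nc.
rewrite rx ?(negPf vw) //; move: vw; rewrite adjE !inE.
by rewrite orbA.
Qed.

Lemma adj_r0V v w : adj v ((r0 v)^-1%g w) = adj v w.
Proof. by rewrite -{2}(permKV (r0 v) w) adj_r0. Qed.

Lemma left_r0 v w : adj w v -> left w (r0 w v) = left v w.
Proof.
have [ra rb rc rx] := rot3E (nab w) (nac w) (nbc w).
by rewrite adjE => /or3P[] /eqP ->;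
  rewrite ?ra ?rb ?rc ?left_ab ?left_bc ?left_ca.
Qed.

Section FixedMatrix.
Variable M : 'M['F_2]_n.
Hypothesis eM : sym_supp e M.

(* The weight of an edge is the entry of M at its two faces; for an edge of the
   outer face it is the sum of the row of the other face, so that all weights
   on the boundary of a face p add up to M p p. *)
Definition weight (v w : V) : 'F_2 :=
  match left v w, left w v with
  | Some p, Some q => M p q
  | Some p, None | None, Some p => \sum_q M p q
  | None, None => 0
  end.

Lemma weight_sym v w : weight v w = weight w v.
Proof.
rewrite /weight; case: (left v w) => [p|]; case: (left w v) => [q|] //.
by have /sym_suppP[Ms _] := eM.
Qed.

Definition face_val (y : 'rV['F_2]_n) (o : option 'I_n) : 'F_2 :=
  if o is Some p then y 0 p else 0.

(** An edge of weight 1 exchanges its two sides. A labelling of the form face value plus vertex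
    value matches across the edge exactly when the vertex values differ by this amount. *)
Definition jump y v w : 'F_2 :=
  weight v w * (face_val y (left v w) + face_val y (left w v)).

Lemma jump_sym y v w : jump y v w = jump y w v.
Proof. by rewrite /jump weight_sym addrC. Qed.

(** Another face shares at most one edge with [p], so the boundary is indexed by the face on the
    other side; the index [q = p] can be added because [y p + y p = 0]. The inner edges then
    contribute [y p] with the row sum as coefficient, and the outer edge, whose weight is this row
    sum, cancels it. *)
Lemma sum_jump y p :
  \sum_(d : V * V | adj d.1 d.2 && (left d.1 d.2 == Some p)) jump y d.1 d.2
  = \sum_q M p q * y 0 q.
Proof.
have /sym_suppP[Ms Me] := eM.
pose G (o : option 'I_n) : 'F_2 :=
  if o is Some q then M p q * (y 0 p + y 0 q) else (\sum_q M p q) * y 0 p.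
transitivity (\sum_o G o).
  rewrite (partition_big (fun d => left d.2 d.1) xpredT) //=; apply: eq_bigr => o _.
  have [/existsP[d Pd]|noD] := boolP [exists d : V * V,
      adj d.1 d.2 && (left d.1 d.2 == Some p) && (left d.2 d.1 == o)].
    rewrite (big_pred1 d) => [|d' /=].
      case/andP: Pd => /andP[_ /eqP l1] /eqP l2.
      rewrite /jump /weight l1 l2; case: o {l2} => [q|] //=.
      by rewrite addr0.
    case/andP: Pd => /andP[ad /eqP l1] /eqP l2.
    apply/andP/eqP => [[/andP[ad' /eqP l1'] /eqP l2']|->]; last first.
      by rewrite ad l1 l2 !eqxx.
    have := @left_inj d'.1 d'.2 d.1 d.2 ad' ad; rewrite l1 l2 l1' l2'.
    by case: d {ad l1 l2} => ? ?; case: d' {ad' l1' l2'} => ? ? /= -> .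
  rewrite big1 => [|d Pd]; last by case/existsP: noD; exists d.
  case: o noD => [q|] noD /=; last first.
    have [ad l1 l2] := cycP p; case/existsP: noD; exists (cyc p).
    by rewrite ad l1 l2 !eqxx.
  have [->|pq] := eqVneq p q; first by rewrite F2_addrr mulr0.
  have [->|/Me epq] := eqVneq (M p q) 0; first by rewrite mul0r.
  have [v [w [ad l1 l2]]] := left_e pq epq; case/existsP: noD; exists (v, w).
  by rewrite /= ad l1 l2 !eqxx.
rewrite (bigD1 None) //= (reindex_omap Some id) /=; last by case.
rewrite [X in _ + X](eq_bigl xpredT) => [|q]; last by rewrite /= ?eqxx.
rewrite mulr_suml -big_split /=; apply: eq_bigr => q _.
by rewrite mulrDr addrA F2_addrr add0r.
Qed.

(** The map [F] sends a dart to the next one on the same face, so the heads of the boundary darts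
    are their tails again. *)
Lemma sum_around_face (g : V -> 'F_2) p :
  \sum_(d : V * V | adj d.1 d.2 && (left d.1 d.2 == Some p)) (g d.1 + g d.2) = 0.
Proof.
rewrite big_split /=; pose F (d : V * V) := (d.2, r0 d.2 d.1).
have F_inj : injective F by move=> [v w] [v' w'] [<- /perm_inj ->].
rewrite (reindex_inj F_inj) /= (eq_bigl (fun d =>
  adj d.1 d.2 && (left d.1 d.2 == Some p))) ?F2_addrr // => d.
rewrite /F /= adj_r0 adj_sym; case: (boolP (adj d.1 d.2)) => //= ad.
by rewrite left_r0 // adj_sym.
Qed.

(** Along the inner edges a potential always exists. Each inner face has one outer edge, and
    summation around the face shows that the equation at this edge is the corresponding coordinate
    of [y *m M = 0]. *)
Lemma potential_jump y :
  (exists g : V -> 'F_2, forall v w, adj v w -> g v + g w = jump y v w)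
  <-> y *m M = 0.
Proof.
have /sym_suppP[Ms Me] := eM.
have yM p : (y *m M) 0 p = \sum_q M p q * y 0 q.
  by rewrite mxE; apply: eq_bigr => q _; rewrite mulrC Ms.
split=> [[g gj]|yM0].
  apply/rowP => p; rewrite yM -sum_jump mxE -[RHS](sum_around_face g p).
  by apply: eq_bigr => d /andP[/gj].
have [g gj] := inner_potential (jump_sym y).
suff cycj p : g (cyc p).1 + g (cyc p).2 = jump y (cyc p).1 (cyc p).2.
  exists g => v w vw.
  case lvw: (left v w) => [p|]; case lwv: (left w v) => [q|].
  - by apply: gj; rewrite ?lvw ?lwv.
  - have [ad l1 l2] := cycP p; have := @left_inj v w _ _ vw ad.
    by rewrite lvw lwv l1 l2 => /(_ erefl erefl)[-> ->].
  - have wv : adj w v by rewrite adj_sym.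
    have [ad l1 l2] := cycP q; have := @left_inj w v _ _ wv ad.
    rewrite lwv lvw l1 l2 => /(_ erefl erefl)[-> ->].
    by rewrite addrC jump_sym.
  by have := left_neq vw; rewrite lvw lwv.
have [ad l1 l2] := cycP p.
have : \sum_(d : V * V | adj d.1 d.2 && (left d.1 d.2 == Some p))
    (g d.1 + g d.2 + jump y d.1 d.2) = 0.
  rewrite big_split /= sum_around_face sum_jump -yM yM0 mxE; exact: addr0.
(* All other boundary edges of [p] are inner and contribute 0. *)
rewrite (bigD1 (cyc p)) /=; last by rewrite ad l1 eqxx.
rewrite big1 => [|d /andP[/andP[ad' /eqP l1'] dp]]; last first.
  rewrite gj ?F2_addrr // ?l1' //; apply: contraNneq dp => l2'.
  have := @left_inj d.1 d.2 _ _ ad' ad; rewrite l1 l2 l1' l2' => /(_ erefl erefl).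
  by case: d {ad' l1' l2'} => ? ?; case: (cyc p) => ? ? /= ->.
by rewrite addr0 => /eqP; rewrite addr_eq0 F2_oppr => /eqP.
Qed.

Lemma card_edges : (#|edges adj| * 2 = #|V| * 3)%N.
Proof.
pose D := [set d : V * V | adj d.1 d.2].
transitivity #|D|.
  rewrite -[RHS]sum1_card (partition_big (fun d => [set d.1; d.2]) (mem (edges adj))) /=.
    rewrite -sum_nat_const; apply: eq_bigr => E /imsetP[[v w] /= vw ->].
    rewrite inE /= in vw.
    have <- : #|[set (v, w); (w, v)]| = 2%N.
      rewrite cards2; suff -> : (v, w) != (w, v) by [].
      by apply: contraTneq vw => -[-> _]; rewrite adj_irr.
    rewrite sum1dep_card; apply: eq_card => -[v' w']; rewrite !inE /=.
    apply/orP/andP => [[] /eqP[-> ->]|[_ /eqP/set2_inj[[-> ->]|[-> ->]]]]; auto.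
    by rewrite adj_sym vw setUC.
  by move=> d; rewrite inE => dD; apply/imsetP; exists d; rewrite ?inE.
rewrite -sum1_card; under eq_bigl do rewrite inE.
rewrite -(pair_big_dep xpredT adj (fun _ _ => 1%N)) /= -sum_nat_const.
apply: eq_bigr => v _; rewrite sum1_card.
transitivity #|na v |: [set nb v; nc v]|.
  by apply: eq_card => w; rewrite !inE -adjE.
by rewrite cardsU1 cards2 !inE negb_or nab nac nbc.
Qed.

Section Genus.
Variables (phi : {ffun V -> 'F_2}) (rho : rotation_system V).
Hypothesis rho1 : forall v, rho.1 v = if phi v == 0 then r0 v else (r0 v)^-1%g.
Hypothesis rho2 : forall v w, adj v w ->
  ([set v; w] \in rho.2) = (weight v w + phi v + phi w != 0).

Let X : {pred V * V * bool} := [pred x | adj x.1.1 x.1.2].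
Let twisted v w := [set v; w] \in rho.2.
(** The same side of the edge followed backwards: the orientation reached at [w] is
    [s (+) twisted v w], and turning round reverses it. *)
Let rev (x : V * V * bool) :=
  let: (v, w, s) := x in (w, v, ~~ (s (+) twisted v w)).

Let twisted_sym v w : twisted v w = twisted w v.
Proof. by rewrite /twisted setUC. Qed.

Let rho_adj b w v : adj w (if b then (rho.1 w)^-1%g v else rho.1 w v) = adj w v.
Proof.
by rewrite rho1; case: b; case: (phi w == 0); rewrite ?invgK ?adj_r0 ?adj_r0V.
Qed.

Let rhoE b w v : (if b then (rho.1 w)^-1%g v else rho.1 w v)
  = if b (+) (phi w != 0) then (r0 w)^-1%g v else r0 w v.
Proof. by rewrite rho1; case: b; case: (phi w == 0); rewrite ?invgK. Qed.

(* Each face is traversed in both directions, by two orbits of face_step that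
   rev exchanges. *)
Lemma card_face_colourings :
  (#|invariant_functions (face_step rho) rev X| ^ 2
   = 2 ^ fcard (face_step rho) X)%N.
Proof.
apply: card_invariant_functions.
- move=> [[v w] s] [[v' w'] s'] /= [<-]; rewrite -/(twisted v w) -/(twisted v' w).
  case E: (s (+) twisted v w); case E': (s' (+) twisted v' w) => // vv _.
  + have vv' : v = v' by exact: perm_inj vv.
    rewrite -vv' in E' *; congr (_, _, _).
    by move: E E'; case: s; case: s'; case: twisted.
  + have vv' : v = v' by exact: perm_inj vv.
    rewrite -vv' in E' *; congr (_, _, _).
    by move: E E'; case: s; case: s'; case: twisted.
- by move=> [[v w] s] _ /eqP <-; rewrite !inE /= rho_adj adj_sym.
- by move=> [[v w] s]; rewrite !inE /= adj_sym.
- move=> [[v w] s] _ /=; rewrite (twisted_sym w v).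
  by case: s; case: (twisted v w).
- move=> [[v w] s] _ /=; rewrite -/(twisted v w).
  set u := if s (+) twisted v w then _ else _.
  rewrite -/(twisted u w) (twisted_sym u w).
  have -> : ~~ (s (+) twisted v w (+) twisted w u) (+) twisted w u
          = ~~ (s (+) twisted v w).
    by rewrite addNb addbK.
  by rewrite /u if_neg; case: (s (+) twisted v w); rewrite ?permK ?permKV.
- move=> [[v w] s]; rewrite !inE /= => vw; apply: contraTneq vw => -[-> _ _].
  by rewrite adj_irr.
move=> [[v w] s]; rewrite !inE /= -/(twisted v w) => vw.
set u := if s (+) twisted v w then _ else _; apply/eqP => -[uv].
rewrite uv (twisted_sym w v) addbK.
by case: (s).
Qed.

(** The face of the plane embedding on the left of the dart, or on its right if [b] holds. *)
Definition side v w (b : bool) := if b then left w v else left v w.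

Lemma sideN v w b : side v w (~~ b) = side w v b.
Proof. by case: b. Qed.

Lemma side_flip y v w b : face_val y (side v w (b (+) (weight v w != 0)))
  = face_val y (side v w b) + jump y v w.
Proof.
rewrite /jump; case: (F2_cases (weight v w)) => ->.
  by rewrite addbF mul0r addr0.
rewrite addbT mul1r; case: b => /=.
  by rewrite addrCA F2_addrr addr0.
by rewrite addrA F2_addrr add0r.
Qed.

Lemma side_r0 v w b : adj w v ->
  side w (if b then (r0 w)^-1%g v else r0 w v) b = side v w b.
Proof.
move=> wv; case: b => /=; last by rewrite left_r0.
by rewrite -left_r0 ?permKV // adj_r0V.
Qed.

Let twistedE v w : adj v w ->
  twisted v w = (weight v w != 0) (+) (phi v != 0) (+) (phi w != 0).
Proof. by move=> vw; rewrite /twisted rho2 // !F2_neq0D. Qed.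

(** The label of a traversal is the value of the plane face on the side it follows plus the value of
    the starting vertex. The term [phi v != 0] translates the local orientation at [v] into that of
    the plane. *)
Definition colouring (p : 'rV['F_2]_n * {ffun V -> 'F_2}) : {ffun V * V * bool -> 'F_2} :=
  [ffun x => let: (v, w, s) := x in
     if adj v w then face_val p.1 (side v w (s (+) (phi v != 0))) + p.2 v else 0].

Lemma colouring_invariant y (g : {ffun V -> 'F_2}) :
  (forall v w, adj v w -> g v + g w = jump y v w) ->
  colouring (y, g) \in invariant_functions (face_step rho) rev X.
Proof.
move=> gj; have key v w s : adj v w ->
    face_val y (side v w ((s (+) twisted v w) (+) (phi w != 0))) + g w
    = face_val y (side v w (s (+) (phi v != 0))) + g v.
  move=> vw; rewrite twistedE //.
  have -> : s (+) (((weight v w != 0) (+) (phi v != 0)) (+) (phi w != 0))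
    (+) (phi w != 0) = s (+) (phi v != 0) (+) (weight v w != 0).
    by case: s; case: (phi v != 0); case: (phi w != 0); case: (weight v w != 0).
  rewrite side_flip -(gj v w vw) -!addrA; congr (_ + _).
  by rewrite F2_addrr addr0.
rewrite inE; apply/forallP => -[[v w] s]; rewrite inE /=.
case: ifP => vw; last by rewrite ffunE vw.
have wv : adj w v by rewrite adj_sym.
rewrite -/(twisted v w) !ffunE rho_adj wv vw -(key v w s vw) /=.
rewrite rhoE side_r0 // eqxx /=.
by rewrite addNb sideN.
Qed.

(** On an outer edge one side has face value 0, so the sum of the labels of both sides recovers [y];
    then [g] follows. *)
Lemma colouring_inj : injective colouring.
Proof.
move=> [y g] [y' g'] /ffunP E.
have E' v w b : adj v w ->
    face_val y (side v w b) + g v = face_val y' (side v w b) + g' v.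
  move=> vw; have := E (v, w, b (+) (phi v != 0)).
  by rewrite !ffunE vw /= addbK.
have yy : y = y'.
  apply/rowP => p; have [ad l1 l2] := cycP p.
  have := E' _ _ true ad; have := E' _ _ false ad.
  by rewrite /side l1 l2 /= !add0r => E1 E2; move: E1; rewrite E2 => /addIr.
congr (_, _); first exact: yy.
apply/ffunP => v; have := E' v (na v) true (adj_na v).
by rewrite yy => /addrI.
Qed.

(** The sum [x] of the labels on the two sides of a dart is independent of its direction and adds up
    to 0 around a vertex, because both darts at a corner carry the same label there. The same holds
    for the sums [d] of face values. The vector [y] makes [x] and [d] agree on the outer edges, so
    [inner_acyclic] makes them agree everywhere; labels and face values then differ by a function of
    the vertex. *)
Lemma colouring_surj f : f \in invariant_functions (face_step rho) rev X ->
  exists y (g : {ffun V -> 'F_2}),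
    (forall v w, adj v w -> g v + g w = jump y v w) /\ colouring (y, g) = f.
Proof.
rewrite inE => /forallP fX.
(* The labels expressed in the orientation of the plane embedding, where [phi] no longer appears. *)
pose c v w b := f (v, w, b (+) (phi v != 0)).
have fI v w s : adj v w -> f (face_step rho (v, w, s)) = f (v, w, s)
    /\ f (rev (v, w, s)) = f (v, w, s).
  by move=> vw; have := fX (v, w, s); rewrite inE /= vw => /andP[/eqP -> /eqP ->].
have cR v w b : adj v w -> c v w b = c w v (~~ (b (+) (weight v w != 0))).
  move=> vw; rewrite /c; have [_ <-] := fI v w (b (+) (phi v != 0)) vw.
  rewrite /= twistedE //; congr (f (_, _, _)).
  by case: b; case: (phi v != 0); case: (phi w != 0); case: (weight v w != 0).
have cS v w b : adj v w -> c v w b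
    = c w (let b' := b (+) (weight v w != 0) in
           if b' then (r0 w)^-1%g v else r0 w v) (b (+) (weight v w != 0)).
  move=> vw; rewrite /c; have [<- _] := fI v w (b (+) (phi v != 0)) vw.
  rewrite /= rhoE -/(twisted v w) twistedE //.
  suff -> : b (+) (phi v != 0)
    (+) ((weight v w != 0) (+) (phi v != 0) (+) (phi w != 0))
    = b (+) (weight v w != 0) (+) (phi w != 0) by rewrite addbK.
  by case: b; case: (phi v != 0); case: (phi w != 0); case: (weight v w != 0).
(* A reversal followed by a face step turns around the corner at [v]. *)
have corner v w : adj v w -> c v w true = c v (r0 v w) false.
  move=> vw; rewrite (cR v w true vw) (cS w v) 1?adj_sym // (weight_sym w v).
  by case: (weight v w != 0).
have [cab cbc cca] : [/\ forall v, c v (na v) true = c v (nb v) false,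
    forall v, c v (nb v) true = c v (nc v) false &
    forall v, c v (nc v) true = c v (na v) false].
  split=> v; have [ra rb rc _] := rot3E (nab v) (nac v) (nbc v).
  - by rewrite corner ?adj_na ?ra.
  - by rewrite corner ?adj_nb ?rb.
  - by rewrite corner ?adj_nc ?rc.
pose x v w := c v w false + c v w true.
have x_sym v w : adj v w -> x v w = x w v.
  move=> vw; rewrite /x !(cR v w) //.
  by case: (weight v w != 0); rewrite //= addrC.
pose y : 'rV['F_2]_n := \row_p x (cyc p).1 (cyc p).2.
pose d v w := face_val y (left v w) + face_val y (left w v).
have xd v w : adj v w -> x v w = d v w.
  move=> vw; apply/eqP; rewrite -subr_eq0 F2_oppr; apply/eqP.
  apply: (inner_acyclic (x := fun v w => x v w + d v w)) vw.
  - by move=> v' w' vw; rewrite x_sym // /d [face_val _ _ + _]addrC.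
  - move=> u; rewrite /x cab cbc cca /d left_ab left_bc left_ca.
    set a1 := c u _ _; set a2 := c u _ _; set a3 := c u _ _.
    set b1 := face_val _ _; set b2 := face_val _ _; set b3 := face_val _ _.
    rewrite (_ : _ + _ + _ = (a1 + a1) + (a2 + a2) + (a3 + a3)
                          + (b1 + b1) + (b2 + b2) + (b3 + b3)); last by ring.
    by rewrite !F2_addrr ?addr0.
  move=> v' w' vw lvw; case lwv: (left w' v') => [p|]; last first.
    by have := left_neq vw; rewrite lvw lwv.
  have [ad l1 l2] := cycP p; have wv : adj w' v' by rewrite adj_sym.
  have := @left_inj w' v' _ _ wv ad; rewrite lwv lvw l1 l2 => /(_ erefl erefl)[ew ev].
  by rewrite x_sym // /d lvw lwv /= mxE -ew -ev add0r F2_addrr.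
pose g := [ffun v => c v (na v) false + face_val y (left v (na v))].
have cg v w b : adj v w -> c v w b = face_val y (side v w b) + g v.
  have ct u : adj v u -> c v u false = face_val y (side v u false) + g v ->
      c v u true = face_val y (side v u true) + g v.
    move=> vu cf; have -> : c v u true = c v u false + x v u.
      by rewrite /x addrA F2_addrr add0r.
    by rewrite xd // cf /d /= addrACA F2_addrr add0r addrC.
  have fa : c v (na v) false = face_val y (side v (na v) false) + g v.
    by rewrite ffunE addrCA F2_addrr addr0.
  have fb : c v (nb v) false = face_val y (side v (nb v) false) + g v.
    by rewrite -cab (ct _ (adj_na v) fa) /= left_ab.
  have fc : c v (nc v) false = face_val y (side v (nc v) false) + g v.
    by rewrite -cbc (ct _ (adj_nb v) fb) /= left_bc.
  case: b; first by rewrite adjE => /or3P[] /eqP ->; apply: ct;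
    rewrite ?adj_na ?adj_nb ?adj_nc.
  by rewrite adjE => /or3P[] /eqP ->.
exists y, g; split=> [v w vw|].
  have wv : adj w v by rewrite adj_sym.
  have := cR v w false vw; rewrite !cg // sideN side_flip.
  rewrite -addrA => /addrI ->; rewrite -addrA F2_addrr addr0.
  by [].
apply/ffunP => -[[v w] s]; rewrite ffunE /=.
case: ifP => vw; first by rewrite -cg // /c addbK.
by have := fX (v, w, s); rewrite inE /= vw => /eqP.
Qed.

Lemma has_euler_genusE i : has_euler_genus adj rho i = (\rank M == i).
Proof.
pose S := [set p : 'rV['F_2]_n * {ffun V -> 'F_2} | p.2 \in potentials adj (jump p.1)].
have cardS : #|S| = (2 * 2 ^ (n - \rank M))%N.
  rewrite -card_kermx -sum1_card.
  under eq_bigl do rewrite inE.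
  rewrite -(pair_big_dep xpredT (fun y g => g \in potentials adj (jump y))
                         (fun _ _ => 1%N)) /=.
  rewrite mulnC -sum_nat_const [RHS]big_mkcond /=; apply: eq_bigr => y _.
  rewrite sum1_card inE; case: eqP => yM.
    have /potential_jump := yM; exact: card_potentials v0 adj_connected.
  apply: eq_card0 => g; apply/negbTE/negP => /potentialsP gj.
  by apply: yM; apply/potential_jump; exists g.
have cardW : #|invariant_functions (face_step rho) rev X| = #|S|.
  rewrite -(card_imset _ colouring_inj); apply: eq_card => f.
  apply/idP/imsetP => [/colouring_surj[y [g [gj <-]]]|[[y g] /[1!inE] /potentialsP gj ->]].
    by exists (y, g); rewrite // inE; apply/potentialsP.
  exact: colouring_invariant.
have := card_face_colourings; rewrite cardW cardS -expnS -expnM.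
move/eqP; rewrite eqn_exp2l // => /eqP fc.
rewrite /has_euler_genus /nb_faces -fc muln2 doubleK.
(* With [#|V| + 2 = 2 * n] and twice the number of edges equal to three times [#|V|], the Euler
   equation becomes [i = \rank M]. *)
have := card_edges; have := rank_leq_row M; have := cardV.
move=> cV rM cE; apply/eqP/eqP; lia.
Qed.

End Genus.

End FixedMatrix.

Lemma r0_neqV v : r0 v != (r0 v)^-1%g.
Proof.
have [ra rb rc _] := rot3E (nab v) (nac v) (nbc v).
apply/eqP => /permP/(_ (nb v)); rewrite rb -{2}ra permK => cb.
by have := nac v; rewrite cb eqxx.
Qed.

Lemma cyclic_perm_on_neighbours v s :
  cyclic_perm_on (neighbours adj v) s = (s == r0 v) || (s == (r0 v)^-1%g).
Proof.
rewrite -cyclic_perm_on3 ?nab ?nac ?nbc //; congr (cyclic_perm_on _ s).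
by apply/setP => w; rewrite !inE adjE orbA.
Qed.

Definition flipped_rotation (p : {ffun V -> 'F_2} * 'M['F_2]_n) : rotation_system V :=
  ([ffun v => if p.1 v == 0 then r0 v else (r0 v)^-1%g],
   [set [set d.1; d.2] | d : V * V
      & adj d.1 d.2 && (weight p.2 d.1 d.2 + p.1 d.1 + p.1 d.2 != 0)]).

Lemma mem_flipped_rotation phi M v w : sym_supp e M -> adj v w ->
  ([set v; w] \in (flipped_rotation (phi, M)).2)
  = (weight M v w + phi v + phi w != 0).
Proof.
move=> eM vw; apply/imsetP/idP => [[[v' w']]|wn0].
  rewrite inE /= => /andP[_ wn0] /set2_inj[[-> ->]|[-> ->]] //.
  by rewrite weight_sym // addrAC.
by exists (v, w); rewrite ?inE /= ?vw.
Qed.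

Lemma weight_inj M M' : sym_supp e M -> sym_supp e M' ->
  (forall v w, adj v w -> weight M v w = weight M' v w) -> M = M'.
Proof.
move=> /sym_suppP[Ms Me] /sym_suppP[Ms' Me'] MM.
have off p q : p != q -> M p q = M' p q.
  move=> pq; case: (boolP (e p q)) => [epq|nepq].
    have [v [w [vw l1 l2]]] := left_e pq epq.
    by have := MM v w vw; rewrite /weight l1 l2.
  have -> : M p q = 0 by apply/eqP; apply: contraNT nepq; exact: Me.
  by apply/esym/eqP; apply: contraNT nepq; exact: Me'.
apply/matrixP => p q; have [<-|] := eqVneq p q; last exact: off.
have [vw l1 l2] := cycP p; have := MM _ _ vw; rewrite /weight l1 l2.
rewrite (bigD1 p) //= [RHS](bigD1 p) //= [X in _ + X](eq_bigr (fun q => M' p q)).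
  by move/addIr.
by move=> r rp; rewrite off // eq_sym.
Qed.

(** The weights of the inner edges are the off-diagonal entries; each diagonal entry is then
    adjusted so that the row sum is the weight of the outer edge. *)
Lemma weight_surj (t : V -> V -> 'F_2) : (forall v w, t v w = t w v) ->
  exists2 M, sym_supp e M & forall v w, adj v w -> weight M v w = t v w.
Proof.
move=> ts; pose off p q : 'F_2 := if [pick d : V * V | [&& adj d.1 d.2,
    left d.1 d.2 == Some p & left d.2 d.1 == Some q]] is Some d
  then t d.1 d.2 else 0.
have offE v w p q : adj v w -> left v w = Some p -> left w v = Some q ->
    off p q = t v w.
  move=> vw l1 l2; rewrite /off; case: pickP => [d /and3P[ad /eqP l1' /eqP l2']|].
    have := @left_inj d.1 d.2 v w ad vw; rewrite l1 l2 l1' l2'.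
    by move=> /(_ erefl erefl)[-> ->].
  by move=> /(_ (v, w)); rewrite /= vw l1 l2 !eqxx.
have off_e p q : off p q != 0 -> e p q.
  rewrite /off; case: pickP => [d /and3P[ad /eqP l1 /eqP l2] _|]; last by rewrite eqxx.
  exact: e_left ad l1 l2.
have off_sym p q : off p q = off q p.
  have half p' q' : off p' q' != 0 -> off p' q' = off q' p'.
    rewrite {1 2}/off; case: pickP => [d /and3P[ad /eqP l1 /eqP l2] _|]; last by rewrite eqxx.
    by rewrite ts; apply/esym/offE; rewrite // adj_sym.
  have [p0|/half//] := eqVneq (off p q) 0.
  by have [q0|/half//] := eqVneq (off q p) 0; rewrite p0 q0.
pose M : 'M['F_2]_n := \matrix_(p, q) if p == q
  then t (cyc p).1 (cyc p).2 + \sum_(r | r != p) off p r else off p q.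
exists M => [|v w vw].
  apply/sym_suppP; split=> p q; rewrite !mxE; last first.
    by case: (eqVneq p q) => [-> _|_]; [exact: e_refl | exact: off_e].
  by case: (eqVneq p q) => [->|_].
have row p : \sum_q M p q = t (cyc p).1 (cyc p).2.
  rewrite (bigD1 p) //= mxE eqxx [X in _ + X](eq_bigr (fun r => off p r)) => [|r rp].
    by rewrite -addrA F2_addrr addr0.
  by rewrite mxE eq_sym (negPf rp).
have wv : adj w v by rewrite adj_sym.
rewrite /weight; case l1: (left v w) => [p|]; case l2: (left w v) => [q|].
- rewrite mxE (offE v w) //; case: eqP => // pq.
  by have := left_neq vw; rewrite l1 l2 pq eqxx.
- rewrite row; have [ad l1' l2'] := cycP p.
  have := @left_inj v w _ _ vw ad; rewrite l1 l2 l1' l2' => /(_ erefl erefl)[<- <-].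
  by [].
- rewrite row; have [ad l1' l2'] := cycP q.
  have := @left_inj w v _ _ wv ad; rewrite l1 l2 l1' l2' => /(_ erefl erefl)[<- <-].
  by rewrite ts.
by have := left_neq vw; rewrite l1 l2.
Qed.

Lemma edges_adj v w : ([set v; w] \in edges adj) = adj v w.
Proof.
apply/imsetP/idP => [[[v' w']]|vw]; last by exists (v, w); rewrite ?inE.
by rewrite inE /= => vw' /set2_inj[[-> ->]|[-> ->]]; rewrite // adj_sym.
Qed.

(** A rotation system consists of the set [phi] of reversed vertices and the twisted edges; given
    [phi], the twists correspond to the weights and hence to a unique [M]. The edges of [T] are
    untwisted exactly when [phi] is a potential on [T] for these weights, which leaves two choices
    of [phi] for each [M]. *)
Lemma nb_embeddingsE T i : spanning_tree adj T ->
  nb_embeddings adj T i = (2 * #|[set M | sym_supp e M & \rank M == i]|)%N.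
Proof.
move=> [/subsetP Tadj Tconn Tacyc].
pose joined := [rel v w | [set v; w] \in T].
have joined_adj v w : joined v w -> adj v w by move=> /Tadj; rewrite edges_adj.
pose A := [set p : {ffun V -> 'F_2} * 'M['F_2]_n |
  [&& sym_supp e p.2, \rank p.2 == i & p.1 \in potentials joined (weight p.2)]].
have weight_symM M : sym_supp e M -> forall v w, weight M v w = weight M w v.
  by move=> eM v w; exact: weight_sym.
have cardA : #|A| = (2 * #|[set M | sym_supp e M & \rank M == i]|)%N.
  rewrite -sum1_card (partition_big (fun p => p.2)
    (mem [set M | sym_supp e M & \rank M == i])) /=.
    rewrite mulnC -sum_nat_const; apply: eq_bigr => M; rewrite inE => /andP[eM rM].
    transitivity #|potentials joined (weight M)|; last apply: (card_potentials v0 Tconn).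
      have pairM_inj : injective (fun g : {ffun V -> 'F_2} => (g, M)) by move=> ? ? [].
      rewrite sum1dep_card -[RHS](card_imset _ pairM_inj).
      apply: eq_card => -[g M'].
      apply/idP/imsetP => [|[g' g'p [-> ->]]].
        rewrite inE /= [in X in X && _]inE /= => /andP[/and3P[_ _ gp] /eqP MM].
        by exists g; rewrite -MM.
      by rewrite inE /= [in X in X && _]inE /= eM rM g'p eqxx.
    apply: (forest_potential (weight_symM M eM)) Tacyc.
    move=> v; apply/negP => vT; have := joined_adj v v; rewrite /= setUid vT.
    by rewrite adj_irr => /(_ isT).
  by move=> p; rewrite !inE => /and3P[-> ->].
rewrite -cardA /nb_embeddings -(@card_in_imset _ _ flipped_rotation A).
  apply: eq_card => rho; rewrite inE; apply/andP/imsetP.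
    move=> [/andP[/andP[/forallP cyc_rho rho_edges] rhoT] genus].
    pose phi : {ffun V -> 'F_2} := [ffun v => if rho.1 v == r0 v then 0 else 1].
    have rho1 v : rho.1 v = if phi v == 0 then r0 v else (r0 v)^-1%g.
      have := cyc_rho v; rewrite cyclic_perm_on_neighbours ffunE.
      by case: eqP => [-> _|_ /eqP ->]; rewrite ?eqxx.
    (* The weights for which [rho] has its twists, obtained by solving the equation of [rho2] for
       the weight. *)
    pose t v w : 'F_2 := ([set v; w] \in rho.2)%:R + phi v + phi w.
    have [M eM Mt] : exists2 M, sym_supp e M & forall v w, adj v w -> weight M v w = t v w.
      by apply: weight_surj => v w; rewrite /t setUC addrAC.
    have rho2 v w : adj v w -> ([set v; w] \in rho.2) = (weight M v w + phi v + phi w != 0).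
      move=> vw; rewrite Mt // /t.
      rewrite (_ : _ + _ + _ + _ + _ = ([set v; w] \in rho.2)%:R + (phi v + phi v)
        + (phi w + phi w)); last by ring.
      by rewrite !F2_addrr !addr0; case: (_ \in _).
    exists (phi, M).
      rewrite inE eM -(has_euler_genusE eM rho1 rho2) genus /=.
      apply/potentialsP => v w vwT; rewrite Mt ?joined_adj // /t.
      by rewrite (disjointFl rhoT vwT) add0r.
    apply: injective_projections => /=.
      by apply/ffunP => v; rewrite [RHS]ffunE rho1.
    apply/setP => E; apply/idP/imsetP => [Er|[[v w]]].
      have /imsetP[[v w] /[1!inE] /= vw EE] := subsetP rho_edges _ Er.
      by exists (v, w); rewrite // inE /= vw -rho2 // -EE.
    by rewrite inE /= => /andP[vw wn0] ->; rewrite rho2.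
  move=> [[phi M] /[1!inE] /= /and3P[eM rM /potentialsP phiT] ->].
  have rho1 v : (flipped_rotation (phi, M)).1 v = if phi v == 0 then r0 v else (r0 v)^-1%g.
    by rewrite ffunE.
  split; last by rewrite (has_euler_genusE eM rho1) // => v w; exact: mem_flipped_rotation.
  apply/andP; split; first apply/andP; first split.
  - apply/forallP => v; rewrite cyclic_perm_on_neighbours rho1.
    by case: ifP; rewrite eqxx ?orbT.
  - apply/subsetP => E /imsetP[[v w] /[1!inE] /= /andP[vw _] ->].
    by rewrite edges_adj.
  rewrite disjoint_subset; apply/subsetP => E /imsetP[[v w] /[1!inE] /= /andP[vw wn0] ->].
  rewrite inE; apply: contraNN wn0 => vwT; rewrite -(phiT v w vwT).
  rewrite (_ : _ + _ + _ + _ = (phi v + phi v) + (phi w + phi w)); last by ring.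
  by rewrite !F2_addrr ?addr0.
move=> [phi M] [phi' M'] /[1!inE] /= /and3P[eM _ _] /[1!inE] /= /and3P[eM' _ _] E.
have phiE : phi = phi'.
  apply/ffunP => v; have := congr1 (fun rho : rotation_system V => rho.1 v) E.
  rewrite /= !ffunE /=; have /eqP ne := r0_neqV v.
  case: (F2_cases (phi v)) (F2_cases (phi' v)) => -> [] ->;
    by rewrite ?eqxx ?oner_eq0 // => F; case: ne.
congr (_, _) => //; apply: (weight_inj eM eM') => v w vw.
have := mem_flipped_rotation phi eM vw; rewrite E phiE mem_flipped_rotation //.
rewrite -!addrA !(F2_neq0D (weight _ _ _)) => /addIb.
by case: (F2_cases (weight M v w)) (F2_cases (weight M' v w)) => -> [] ->;
  rewrite ?eqxx ?oner_eq0.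
Qed.

End PlaneCubicGraph.

(** * The graphs H_m *)

Section CurrentFaces.
Local Open Scope nat_scope.
Variable up : nat -> bool.

(* Inner faces are numbered from left to right: 1 and 0 are the upper and the
   lower face at v_0, and j + 2 is the face on the right of the leaf inr j. These
   are the faces above and below the edge from v_j to v_{j+1}. *)
Fixpoint upper_face j : nat :=
  if j is i.+1 then if up i then i.+2 else upper_face i else 1.
Fixpoint lower_face j : nat :=
  if j is i.+1 then if up i then lower_face i else i.+2 else 0.

Lemma upper_face_lt j : upper_face j < j.+2.
Proof. by elim: j => //= j IH; case: ifP => // _; exact: leqW. Qed.

Lemma lower_face_lt j : lower_face j < j.+2.
Proof. by elim: j => //= j IH; case: ifP => // _; exact: leqW. Qed.

Definition is_upper f := if f is j.+2 then up j else f == 1.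

Lemma upper_faceP j : is_upper (upper_face j).
Proof. by elim: j => //= j IH; case: ifP. Qed.

Lemma lower_faceP j : ~~ is_upper (lower_face j).
Proof. by elim: j => //= j IH; case: ifP => //= ->. Qed.

Lemma upper_neq_lower i j : upper_face i != lower_face j.
Proof.
by apply: contraTneq (upper_faceP i) => ->; exact: lower_faceP.
Qed.

Variable st : pred nat.
Variable L : nat.
Hypothesis up0 : up 0.
Hypothesis st_up : forall j, j.+1 < L -> st j.+2 = (up j.+1 != up j).
Hypothesis st1 : ~~ st 1.

Lemma current_faces j : j <= L ->
  (upper_face j, lower_face j)
  = if j is i.+1 then if up i then (j.+1, last_start st j)
                      else (last_start st j, j.+1)
    else (1, 0).
Proof.
case: j => // j; elim: j => [|j IH] jL; first by rewrite /= up0 (negPf st1).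
have [IH1 IH2] : (upper_face j.+1 = if up j then j.+2 else last_start st j.+1)
    /\ (lower_face j.+1 = if up j then last_start st j.+1 else j.+2).
  have := IH (ltnW jL).
  by case: (up j) => E; (split; [exact (congr1 fst E) | exact (congr1 snd E)]).
have -> : last_start st j.+2 = if up j.+1 != up j then j.+2 else last_start st j.+1.
  by rewrite -st_up.
have -> : upper_face j.+2 = if up j.+1 then j.+3 else upper_face j.+1 by [].
have -> : lower_face j.+2 = if up j.+1 then lower_face j.+1 else j.+3 by [].
by rewrite IH1 IH2; case: (up j.+1); case: (up j).
Qed.

Lemma current_facesP j : j <= L ->
  (upper_face j = j.+1 /\ lower_face j = last_start st j)
  \/ (lower_face j = j.+1 /\ upper_face j = last_start st j).
Proof.
move/current_faces; case: j => [|j]; first by move=> _; left.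
by case: (up j) => E; [left; split; [exact (congr1 fst E) | exact (congr1 snd E)]
  | right; split; [exact (congr1 snd E) | exact (congr1 fst E)]].
Qed.

End CurrentFaces.

(** * Blocks of leaves and changes of side *)

Section HalinBlocks.
Local Open Scope nat_scope.
Variable m : seq nat.
Hypotheses (m_size : 2 <= size m) (m_gt0 : all (leq 1) m).
Local Notation k := (size m).

Definition leaf_up j := ~~ odd (reshape_index (block_sizes m) j).

Lemma nth_block_sizes i : i < k ->
  nth 0 (block_sizes m) i = nth 0 m i + ((0 < i) && (i.+1 < k)).
Proof. by move=> ik; rewrite nth_mkseq. Qed.

Lemma size_block_sizes : size (block_sizes m) = k.
Proof. by rewrite size_mkseq. Qed.

Definition leaf_start i := sumn (take i (block_sizes m)).

Lemma leaf_startS i : i < k ->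
  leaf_start i.+1 = leaf_start i + (nth 0 m i + ((0 < i) && (i.+1 < k))).
Proof.
move=> ik; rewrite /leaf_start (take_nth 0) ?size_block_sizes //.
by rewrite sumn_rcons nth_block_sizes.
Qed.

(** The end blocks have one leaf less than indices and the others equally many, so the two counts
    differ by 1 at every interior boundary. Since leaf [j] opens face [j + 2], the index e_i of a
    block after the first is the face opened by the last leaf of the preceding block; it lies across
    the spine from all leaves of its own block. *)
Lemma leaf_startE i : 0 < i < k -> (leaf_start i).+1 = block_start m i.
Proof.
case: i => // i; elim: i => [|i IH] ik.
  have k0 : 0 < k by lia.
  by rewrite leaf_startS // block_startS // block_start0 /leaf_start take0 /=; lia.
rewrite (@leaf_startS i.+1) 1?(@block_startS m i.+1) ?(ltnW ik); [|lia..].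
by have := IH; lia.
Qed.

Lemma strip_sizeE : strip_size m = (nb_spine m).+2.
Proof.
have k1 : k.-1 < k by lia.
have := @block_startS m k.-1 k1; rewrite prednK; last by lia.
rewrite block_start_size => ->; have := @leaf_startS k.-1 k1.
rewrite prednK; last by lia.
rewrite {1}/leaf_start -size_block_sizes take_size size_block_sizes.
rewrite -/(nb_spine m) => ->; have := @leaf_startE k.-1; lia.
Qed.

Lemma leaf_upE i j : i < k -> leaf_start i <= j < leaf_start i.+1 ->
  leaf_up j = ~~ odd i.
Proof.
move=> ik /andP[ij ji]; rewrite /leaf_up.
have -> : j = flatten_index (block_sizes m) i (j - leaf_start i).
  by rewrite /flatten_index -/(leaf_start i) subnKC.
rewrite flatten_indexKl // nth_block_sizes //.
by move: ji; rewrite leaf_startS //; lia.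
Qed.

Lemma leaf_block j : j < nb_spine m ->
  exists2 i, i < k & leaf_start i <= j < leaf_start i.+1.
Proof.
move=> jl; exists (reshape_index (block_sizes m) j).
  by rewrite -size_block_sizes reshape_indexP.
have := reshape_indexK (block_sizes m) j; have := reshape_offsetP jl.
have ik : reshape_index (block_sizes m) j < k.
  by rewrite -size_block_sizes reshape_indexP.
rewrite nth_block_sizes // leaf_startS // /flatten_index -/(leaf_start _).
by lia.
Qed.

Lemma leaf_up0 : leaf_up 0.
Proof.
have k0 : 0 < k by lia.
rewrite (@leaf_upE 0) // leaf_startS // /leaf_start take0 /=.
by have := nth_gt0 m_gt0 k0; lia.
Qed.

Lemma is_startP r : reflect (exists2 i, i < k & r = block_start m i) (is_start m r).
Proof.
apply: (iffP mapP) => [[i]|[i ik ->]]; last by exists i; rewrite ?mem_iota.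
by rewrite mem_iota /= => ik ->; exists i.
Qed.

Lemma block_start1 : 1 < block_start m 1 <= nb_spine m.
Proof.
have k0 : 0 < k by lia.
have := nth_gt0 m_gt0 k0; have := nth_gt0 m_gt0 m_size.
have := @block_start_lt m 1 k; rewrite m_size leqnn block_start_size.
rewrite strip_sizeE => /(_ isT) + m1 m0.
by rewrite block_startS // block_start0; lia.
Qed.

Lemma is_start1 : ~~ is_start m 1.
Proof.
apply/is_startP => -[[|i] ik]; first by rewrite block_start0.
have := block_start1; case: i ik => [|i] ik; first by lia.
have i1 : 1 < i.+2 <= k by lia.
by have := block_start_lt i1; lia.
Qed.

Lemma is_start_leaf_up j : j.+1 < nb_spine m ->
  is_start m j.+2 = (leaf_up j.+1 != leaf_up j).
Proof.
move=> jl; have [i ik /andP[ij ji]] := leaf_block jl.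
rewrite (@leaf_upE i) ?ij //.
have [eij|nij] := eqVneq (leaf_start i) j.+1.
  case: i ik ij ji eij => [|i] ik ij ji eij; first by move: eij; rewrite /leaf_start take0.
  have -> : leaf_up j = ~~ odd i.
    apply: leaf_upE; first exact: ltnW.
    rewrite eij; have := nth_gt0 m_gt0 (ltnW ik); move: eij.
    by rewrite leaf_startS ?(ltnW ik) //; lia.
  rewrite /= negbK; have -> : is_start m j.+2.
    by apply/is_startP; exists i.+1; rewrite // -eij leaf_startE.
  by case: (odd i).
rewrite (@leaf_upE i) ?eqxx //; last by lia.
apply/negbTE/is_startP => -[i' ik' E].
case: i' ik' E => [|i'] ik' E; first by move: E; rewrite block_start0.
have := @leaf_startE i'.+1; rewrite ik' -E => /(_ isT) [Ei].
case: (ltngtP i i'.+1) => [ii|ii|ii]; last by rewrite ii Ei eqxx in nij.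
  have : leaf_start i.+1 <= leaf_start i'.+1.
    rewrite /leaf_start -(cat_take_drop i.+1 (take i'.+1 _)) sumn_cat.
    by rewrite take_takel // leq_addr.
  by lia.
have : leaf_start i'.+2 <= leaf_start i.
  rewrite /leaf_start -(cat_take_drop i'.+2 (take i _)) sumn_cat.
  by rewrite take_takel // leq_addr.
by rewrite leaf_startS //; have := nth_gt0 m_gt0 ik'; lia.
Qed.

(** At the right end both current faces have been opened by leaves, so the two ends of the spine are
    not neighbours on the cycle. *)
Lemma last_start_spine : 1 < last_start (is_start m) (nb_spine m).
Proof.
have /andP[b1 bl] := block_start1.
have st1 : is_start m (block_start m 1) by apply/is_startP; exists 1.
have H j : block_start m 1 <= j -> block_start m 1 <= last_start (is_start m) j.
  elim: j => [|j IH] bj /=; first by lia.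
  case: ifP => // stj; apply: IH.
  by move: bj; rewrite leq_eqVlt => /orP[/eqP E|//]; rewrite -E st1 in stj.
by have := H _ bl; lia.
Qed.

End HalinBlocks.

Lemma uniq_next_neq (T : finType) (p : seq T) x : uniq p -> x \in p ->
  (2 < size p)%N -> next p x != x /\ next p x != prev p x.
Proof.
move=> up xp p3; have := orbit_uniq (next p) x.
rewrite /fingraph.orbit (order_cycle (cycle_next up) up xp).
case: (size p) p3 => [|[|[|n]]] //= _; rewrite !inE !negb_or.
move=> /andP[/and3P[x1 x2 _] _]; split; first by rewrite eq_sym.
by apply: contraNneq x2 => nxx; rewrite nxx next_prev.
Qed.

(** * The outer cycle and the faces along it *)

Section HalinGraph.
Local Open Scope nat_scope.
Variable m : seq nat.
Hypotheses (m_size : 2 <= size m) (m_gt0 : all (leq 1) m).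
Local Notation L := (nb_spine m).
Local Notation V := (halin_vertex m).
Local Notation up := (leaf_up m).
Local Notation cu := (upper_face (leaf_up m)).
Local Notation cl := (lower_face (leaf_up m)).
Local Notation C := (halin_cycle m).
Local Notation nx := (next (halin_cycle m)).
Local Notation pv := (prev (halin_cycle m)).
Local Notation adj := (@halin_adj m).

Definition spine (i : nat) : V := inl (inord i).
Definition leaf (j : nat) : V :=
  if insub j is Some i then inr (i : 'I_L) else spine 0.

Lemma leafE (j : 'I_L) : leaf j = inr j.
Proof. by rewrite /leaf valK. Qed.

Lemma leaf_ord j (jL : j < L) : leaf j = inr (Ordinal jL).
Proof. exact: (leafE (Ordinal jL)). Qed.

Lemma halin_vertex_ind (P : V -> Prop) : P (spine 0) -> P (spine L.+1) ->
  (forall j, j < L -> P (spine j.+1)) -> (forall j, j < L -> P (leaf j)) ->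
  forall v, P v.
Proof.
move=> P0 PL Ps Pl [i|j]; last by rewrite -leafE; exact: Pl.
have iE : inl i = spine i by rewrite /spine inord_val.
rewrite iE; have := ltn_ord i; case: (nat_of_ord i) => [|i'] // iL.
by have [->|ne] := eqVneq i' L; [exact: PL | apply: Ps; rewrite ltn_neqAle ne -ltnS].
Qed.

Lemma leaf_inj i j : i < L -> j < L -> leaf i = leaf j -> i = j.
Proof.
by move=> iL jL; rewrite (leaf_ord iL) (leaf_ord jL) => -[].
Qed.

Lemma spine_inj i j : i <= L.+1 -> j <= L.+1 -> spine i = spine j -> i = j.
Proof. by move=> iL jL [] /(congr1 val); rewrite /= !inordK. Qed.

Lemma spine_neq_leaf i j : j < L -> spine i != leaf j.
Proof. by move=> jL; rewrite (leaf_ord jL). Qed.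

Lemma caterpillar_ss i j : i <= L.+1 -> j <= L.+1 ->
  caterpillar_arc (spine i) (spine j) = (j == i.+1).
Proof. by move=> iL jL; rewrite /= !inordK. Qed.

Lemma caterpillar_sl i j : i <= L.+1 -> j < L ->
  caterpillar_arc (spine i) (leaf j) = (i == j.+1).
Proof.
by move=> iL jL; rewrite (leaf_ord jL) /= inordK.
Qed.

Lemma caterpillar_l j v : j < L -> caterpillar_arc (leaf j) v = false.
Proof. by move=> jL; rewrite (leaf_ord jL). Qed.

Lemma halin_cycleE : C = spine 0 :: [seq leaf j | j <- iota 0 L & up j]
  ++ spine L.+1 :: rev [seq leaf j | j <- iota 0 L & ~~ up j].
Proof.
have H (a : pred nat) :
    map (fun i : 'I_L => inr i : V) (filter (fun i : 'I_L => a i) (enum 'I_L))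
    = [seq leaf j | j <- iota 0 L & a j].
  rewrite -val_enum_ord filter_map -map_comp; apply: eq_map => j /=.
  by rewrite leafE.
rewrite /halin_cycle -(H (fun j => up j)) -(H (fun j => ~~ up j)) /spine.
congr (inl _ :: _ ++ inl _ :: _).
  by apply: val_inj; rewrite /= inordK.
by apply: val_inj; rewrite /= inordK.
Qed.

Lemma mem_cycle_spine i : i <= L.+1 -> (spine i \in C) = (i == 0) || (i == L.+1).
Proof.
move=> iL; rewrite halin_cycleE inE mem_cat inE mem_rev.
have nl (a : pred nat) : (spine i \in [seq leaf j | j <- iota 0 L & a j]) = false.
  apply/negbTE/mapP => -[j]; rewrite mem_filter mem_iota => /andP[_ jL].
  by apply/eqP/spine_neq_leaf.
rewrite !nl orbF /=; congr (_ || _); apply/eqP/eqP => [|-> //]; exact: spine_inj.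
Qed.

Lemma mem_cycle_leaf j : j < L -> leaf j \in C.
Proof.
move=> jL; rewrite halin_cycleE inE mem_cat inE mem_rev.
have al (a : pred nat) : a j -> leaf j \in [seq leaf j | j <- iota 0 L & a j].
  by move=> aj; apply: map_f; rewrite mem_filter aj mem_iota.
by case: (boolP (up j)) => uj; [rewrite al | rewrite [in X in _ || (_ || X)]al]; rewrite ?orbT.
Qed.

Lemma uniq_halin_cycle : uniq C.
Proof.
have ul (a : pred nat) : uniq [seq leaf j | j <- iota 0 L & a j].
  rewrite map_inj_in_uniq ?filter_uniq ?iota_uniq // => i j.
  rewrite !mem_filter !mem_iota => /andP[_ iL] /andP[_ jL]; exact: leaf_inj.
have nl i (a : pred nat) : (spine i \in [seq leaf j | j <- iota 0 L & a j]) = false.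
  apply/negbTE/mapP => -[j]; rewrite mem_filter mem_iota => /andP[_ jL].
  by apply/eqP/spine_neq_leaf.
rewrite halin_cycleE cons_uniq cat_uniq cons_uniq mem_cat inE !mem_rev !nl.
rewrite rev_uniq !ul orbF /= andbT; apply/andP; split.
  by apply/eqP => /spine_inj => /(_ isT (leqnn _)).
rewrite negb_or nl /=; apply/hasPn => x; rewrite mem_rev => /mapP[j].
rewrite mem_filter mem_iota => /andP[uj jL] ->; apply/mapP => -[j'].
rewrite mem_filter mem_iota => /andP[uj' jL'] /leaf_inj E.
by rewrite -E ?(negPf uj) in uj'.
Qed.

Definition arrives_above (v : V) : bool :=
  match v with inl i => i != 0 :> nat | inr j => up j end.
Definition leaves_above (v : V) : bool :=
  match v with inl i => i == 0 :> nat | inr j => up j end.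
(** On the cycle the only spine vertices are the two ends, and [column] is used there for the right
    end, where all [L] leaves have been passed. *)
Definition column (v : V) : nat :=
  match v with inl _ => L | inr j => j end.
Definition face_start (f : nat) : V := if f is j.+2 then leaf j else spine 0.

(** A local description of the successor on the cycle, which runs to the right above and to the left
    below. An upper arc ends at [y] and starts where the upper face before [y] was opened; a lower
    arc goes from [x] back to where the lower face before [x] was opened. *)
Definition cycle_step (x y : V) : bool :=
  if arrives_above y then leaves_above x && (x == face_start (cu (column y)))
  else ~~ leaves_above x && (y == face_start (cl (column x))).

Lemma arrives_leaf j : j < L -> arrives_above (leaf j) = up j.
Proof. by move=> jL; rewrite (leaf_ord jL). Qed.
Lemma leaves_leaf j : j < L -> leaves_above (leaf j) = up j.
Proof. by move=> jL; rewrite (leaf_ord jL). Qed.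
Lemma column_leaf j : j < L -> column (leaf j) = j.
Proof. by move=> jL; rewrite (leaf_ord jL). Qed.
Lemma arrives_spine i : i <= L.+1 -> arrives_above (spine i) = (i != 0).
Proof. by move=> iL; rewrite /= inordK. Qed.
Lemma leaves_spine i : i <= L.+1 -> leaves_above (spine i) = (i == 0).
Proof. by move=> iL; rewrite /= inordK. Qed.

Lemma leaves_face_start f : f < L.+2 -> is_upper up f -> leaves_above (face_start f).
Proof.
by case: f => [|[|j]] //= jL uj; [rewrite inordK | rewrite leaves_leaf].
Qed.

Lemma arrives_face_start f : f < L.+2 -> ~~ is_upper up f ->
  ~~ arrives_above (face_start f).
Proof.
by case: f => [|[|j]] //= jL uj; [rewrite inordK | rewrite arrives_leaf].
Qed.

Lemma cu_lt j : j <= L -> cu j < L.+2.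
Proof. by move=> jL; apply: leq_trans (upper_face_lt _ _) _. Qed.
Lemma cl_lt j : j <= L -> cl j < L.+2.
Proof. by move=> jL; apply: leq_trans (lower_face_lt _ _) _. Qed.

Lemma cycle_halin : path.cycle cycle_step C.
Proof.
have upper n : n <= L ->
    path cycle_step (spine 0) [seq leaf j | j <- iota 0 n & up j]
    /\ last (spine 0) [seq leaf j | j <- iota 0 n & up j] = face_start (cu n).
  elim: n => [|n IH] nL //; have [IH1 IH2] := IH (ltnW nL).
  rewrite -addn1 iotaD filter_cat map_cat cat_path last_cat IH1 IH2 addn1 /=.
  case: ifP => un //=; split=> //; rewrite andbT /cycle_step arrives_leaf // un.
  rewrite column_leaf // eqxx andbT; apply: leaves_face_start; last exact: upper_faceP.
  by apply: cu_lt; exact: ltnW.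
have lower n : n <= L ->
    path (fun z => cycle_step^~ z) (spine 0) [seq leaf j | j <- iota 0 n & ~~ up j]
    /\ last (spine 0) [seq leaf j | j <- iota 0 n & ~~ up j] = face_start (cl n).
  elim: n => [|n IH] nL //; have [IH1 IH2] := IH (ltnW nL).
  rewrite -addn1 iotaD filter_cat map_cat cat_path last_cat IH1 IH2 addn1 /=.
  case: (boolP (up n)) => un //=; split=> //; rewrite andbT /cycle_step.
  rewrite (negPf (arrives_face_start _ (lower_faceP _ _))) ?cl_lt ?(ltnW nL) //.
  by rewrite leaves_leaf // un column_leaf // eqxx.
have [u1 u2] := upper L (leqnn L); have [l1 l2] := lower L (leqnn L).
rewrite halin_cycleE /= rcons_cat cat_path u1 /= u2; apply/andP; split.
  rewrite /cycle_step arrives_spine // eqxx andbT leaves_face_start ?cu_lt //.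
  exact: upper_faceP.
(* The lower half is listed backwards, so it is the reversal of the path given by [lower] for the
   converse relation. *)
rewrite -[spine L.+1](last_rcons (spine 0) [seq leaf j | j <- iota 0 L & ~~ up j]).
rewrite -rev_cons -(belast_rcons (spine 0) _ (spine L.+1)) rev_path rcons_path l1 l2 /=.
rewrite /cycle_step (negPf (arrives_face_start _ (lower_faceP _ _))) ?cl_lt //.
by rewrite leaves_spine // eqxx.
Qed.

Lemma step_next x : x \in C -> cycle_step x (nx x).
Proof. exact: next_cycle cycle_halin. Qed.

Lemma arrives_next x : x \in C -> arrives_above (nx x) = leaves_above x.
Proof.
move=> xC; have := step_next xC; rewrite /cycle_step.
by case: ifP => _ /andP[] => [->|/negbTE ->].
Qed.

Definition arc_face (x y : V) : nat :=
  if arrives_above y then cu (column y) else cl (column x).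

Lemma column_le v : column v <= L.
Proof. by case: v => [i|j] //=; exact: ltnW. Qed.

(** Inverses of [face_start] on the upper and on the lower faces. Two functions are needed because
    [spine 0] is the start of the faces 1 and 0. *)
Definition top_number (v : V) : nat := match v with inl _ => 1 | inr j => j.+2 end.
Definition bottom_number (v : V) : nat := match v with inl _ => 0 | inr j => j.+2 end.

Lemma top_face_start f : f < L.+2 -> is_upper up f -> top_number (face_start f) = f.
Proof.
case: f => [|[|j]] //= jL _.
by rewrite (leaf_ord jL).
Qed.

Lemma bottom_face_start f : f < L.+2 -> ~~ is_upper up f ->
  bottom_number (face_start f) = f.
Proof.
case: f => [|[|j]] //= jL _.
by rewrite (leaf_ord jL).
Qed.

Lemma arc_face_lt x y : arc_face x y < L.+2.
Proof.
by rewrite /arc_face; case: ifP => _; [apply: cu_lt | apply: cl_lt]; exact: column_le.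
Qed.

Lemma arc_face_top x : x \in C -> leaves_above x -> arc_face x (nx x) = top_number x.
Proof.
move=> xC lx; have := step_next xC; rewrite /cycle_step /arc_face arrives_next // lx /=.
by move=> /eqP {2}->; rewrite top_face_start ?cu_lt ?column_le // upper_faceP.
Qed.

Lemma arc_face_bottom x : x \in C -> ~~ leaves_above x ->
  arc_face x (nx x) = bottom_number (nx x) /\ arc_face x (nx x) = cl (column x).
Proof.
move=> xC lx; have := step_next xC; rewrite /cycle_step /arc_face arrives_next //.
rewrite (negPf lx) /= => /eqP ->.
by rewrite bottom_face_start ?cl_lt ?column_le // lower_faceP.
Qed.

Lemma arc_face_upper x : x \in C -> is_upper up (arc_face x (nx x)) = leaves_above x.
Proof.
move=> xC; rewrite /arc_face arrives_next //.
by case: ifP => _; rewrite ?upper_faceP // (negPf (lower_faceP _ _)).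
Qed.

Lemma L_gt0 : 0 < L.
Proof. by have := block_start1 m_size m_gt0; lia. Qed.

Lemma next_neq x : x \in C -> nx x != x /\ nx x != pv x.
Proof.
move=> xC; have sC : 2 < size C.
  apply: (@uniq_leq_size _ [:: spine 0; spine L.+1; leaf 0]).
    rewrite /= !inE negb_or !spine_neq_leaf ?L_gt0 // !andbT.
    by apply/eqP => /spine_inj => /(_ isT (leqnn _)).
  move=> y; rewrite in_cons in_cons mem_seq1 => /or3P[] /eqP ->.
  - by rewrite mem_cycle_spine.
  - by rewrite mem_cycle_spine // eqxx orbT.
  exact: mem_cycle_leaf L_gt0.
exact: uniq_next_neq uniq_halin_cycle xC sC.
Qed.

Lemma current_facesL j : j <= L ->
  (cu j = j.+1 /\ cl j = last_start (is_start m) j)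
  \/ (cl j = j.+1 /\ cu j = last_start (is_start m) j).
Proof.
apply: current_facesP; [exact: leaf_up0 | | exact: is_start1].
by move=> i; exact: is_start_leaf_up.
Qed.

(** The right end could follow only if the upper face there were the initial one, but its number is
    [L + 1] or [last_start] of [L], both greater than 1. *)
Lemma next_spine0 : exists2 j, j < L & nx (spine 0) = leaf j.
Proof.
have xC : spine 0 \in C by rewrite mem_cycle_spine.
have ax : arrives_above (nx (spine 0)) by rewrite arrives_next // leaves_spine.
have nC : nx (spine 0) \in C by rewrite mem_next.
have := step_next xC; rewrite /cycle_step ax => /andP[_ /eqP].
move: ax nC; elim/halin_vertex_ind: (nx (spine 0)) => [| |j jL|j jL].
- by rewrite arrives_spine.
- move=> _ _ /esym /=; have := current_facesL (leqnn L).
  have := last_start_spine m_size m_gt0; have := L_gt0.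
  case: (cu L) (cu_lt (leqnn L)) => [|[|f]] fL /=; try by lia.
  by move=> _ _ _ E; have := spine_neq_leaf 0 (fL : f < L); rewrite -E eqxx.
- by rewrite mem_cycle_spine //; lia.
by move=> _ _ _; exists j.
Qed.

Lemma next_spine_end : exists2 j, j < L & nx (spine L.+1) = leaf j.
Proof.
have xC : spine L.+1 \in C by rewrite mem_cycle_spine ?eqxx ?orbT.
have := step_next xC; rewrite /cycle_step arrives_next // leaves_spine //=.
move=> /eqP ->; have := current_facesL (leqnn L).
have := last_start_spine m_size m_gt0; have := L_gt0.
case: (cl L) (cl_lt (leqnn L)) => [|[|f]] fL /=; try by lia.
by move=> _ _ _; exists f.
Qed.

(** The cycle is traversed clockwise, so the outer face is on the left of its arcs and the inner
    face on the left of the reversed arcs. *)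
Definition left_face (v w : V) : option 'I_L.+2 :=
  let outer_arc := if w == nx v then None else Some (inord (arc_face w v)) in
  match v, w with
  | inl i, inl j => Some (inord (if i < j then cu i else cl j))
  | inl i, inr j => if i == j.+1 :> nat
                    then Some (inord (if up j then cu j else j.+2)) else outer_arc
  | inr j, inl i => if i == j.+1 :> nat
                    then Some (inord (if up j then j.+2 else cl j)) else outer_arc
  | inr _, inr _ => outer_arc
  end.

Lemma left_face_right i : i <= L ->
  left_face (spine i) (spine i.+1) = Some (inord (cu i)).
Proof. by move=> iL; rewrite /= !inordK ?ltnSn //; lia. Qed.

Lemma left_face_left i : i <= L ->
  left_face (spine i.+1) (spine i) = Some (inord (cl i)).
Proof. by move=> iL; rewrite /= !inordK ?[_.+1 < _]ltnNge ?leqnSn //; lia. Qed.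

Lemma left_face_to_leaf j : j < L ->
  left_face (spine j.+1) (leaf j) = Some (inord (if up j then cu j else j.+2)).
Proof. by move=> jL; rewrite (leaf_ord jL) /= inordK ?eqxx // ltnS ltnW. Qed.

Lemma left_face_from_leaf j : j < L ->
  left_face (leaf j) (spine j.+1) = Some (inord (if up j then j.+2 else cl j)).
Proof. by move=> jL; rewrite (leaf_ord jL) /= inordK ?eqxx // ltnS ltnW. Qed.

Lemma left_face_cycle v w : v \in C -> w \in C -> (v == nx w) || (w == nx v) ->
  left_face v w = if w == nx v then None else Some (inord (arc_face w v)).
Proof.
have nb x y : x \in C -> y = nx x -> y \in C by move=> xC ->; rewrite mem_next.
move=> vC wC vw; have no i j : v = inl i -> w = inl j -> False.
  move=> vi wj; subst v w.
  have ss a b : a <= L.+1 -> a = 0 \/ a = L.+1 -> nx (spine a) = inl b -> False.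
    move=> _ [] ->; [have [j' jL ->] := next_spine0 | have [j' jL ->] := next_spine_end];
    by rewrite (leaf_ord jL).
  have end_ (a : 'I_L.+2) : inl a \in C ->
      inl a = spine a /\ (a = 0 :> nat \/ a = L.+1 :> nat).
    have -> : inl a = spine a by rewrite /spine inord_val.
    rewrite mem_cycle_spine ?leq_ord // => /orP[] /eqP; auto.
  have [iE i0] := end_ i vC; have [jE j0] := end_ j wC.
  case/orP: vw => /eqP E.
    by apply: (ss j i _ j0); rewrite ?leq_ord -?jE.
  by apply: (ss i j _ i0); rewrite ?leq_ord -?iE.
have noT (i : 'I_L.+2) (j : 'I_L) : inl i \in C -> (i == j.+1 :> nat) = false.
  have -> : inl i = spine i by rewrite /spine inord_val.
  rewrite mem_cycle_spine ?leq_ord // => /orP[] /eqP ->; first by [].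
  by rewrite eqSS; apply/negbTE; rewrite gtn_eqF.
case: v vC vw no => [i|i] vC vw no; case: w wC vw no => [j|j] wC vw no //=.
- by case: (no i j).
- by rewrite noT.
by rewrite noT.
Qed.

Lemma left_face_next x : x \in C -> left_face x (nx x) = None.
Proof. by move=> xC; rewrite left_face_cycle ?mem_next ?eqxx ?orbT. Qed.

Lemma left_face_prev x : x \in C ->
  left_face (nx x) x = Some (inord (arc_face x (nx x))).
Proof.
move=> xC; rewrite left_face_cycle ?mem_next ?eqxx //.
have [_] : nx (nx x) != nx x /\ nx (nx x) != pv (nx x).
  by apply: next_neq; rewrite mem_next.
by rewrite prev_next ?uniq_halin_cycle // eq_sym => /negbTE ->.
Qed.

Variant dart_spec : V -> V -> Prop :=
 | DartRight i of i <= L : dart_spec (spine i) (spine i.+1)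
 | DartLeft i of i <= L : dart_spec (spine i.+1) (spine i)
 | DartToLeaf j of j < L : dart_spec (spine j.+1) (leaf j)
 | DartFromLeaf j of j < L : dart_spec (leaf j) (spine j.+1)
 | DartNext x of x \in C : dart_spec x (nx x)
 | DartPrev x of x \in C : dart_spec (nx x) x.

Lemma caterpillar_arcP v w : caterpillar_arc v w ->
  (exists2 i, i <= L & v = spine i /\ w = spine i.+1)
  \/ (exists2 j, j < L & v = spine j.+1 /\ w = leaf j).
Proof.
case: v w => [i|i] [j|j] //= /eqP E; [left; exists i | right; exists j] => //.
- by rewrite -ltnS -ltnS -E.
- by rewrite /spine -E !inord_val.
by rewrite /spine leafE -E inord_val.
Qed.

Lemma dartP v w : adj v w -> dart_spec v w.
Proof.
case/or4P.
- move/caterpillar_arcP => [[i iL [-> ->]]|[j jL [-> ->]]]; by constructor.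
- move/caterpillar_arcP => [[i iL [-> ->]]|[j jL [-> ->]]]; by constructor.
- by case/andP => vC /eqP ->; constructor.
by case/andP => wC /eqP ->; constructor.
Qed.

Lemma adj_sym : symmetric adj.
Proof.
move=> v w; rewrite /halin_adj orbA [caterpillar_arc v w || _]orbC -orbA.
by congr [|| _, _ | _]; rewrite orbC.
Qed.

Lemma adj_right i : i <= L -> adj (spine i) (spine i.+1).
Proof. by move=> iL; rewrite /halin_adj caterpillar_ss ?eqxx // leqW. Qed.

Lemma adj_to_leaf j : j < L -> adj (spine j.+1) (leaf j).
Proof. by move=> jL; rewrite /halin_adj caterpillar_sl ?eqxx // !ltnS ltnW. Qed.

Lemma adj_next x : x \in C -> adj x (nx x).
Proof. by move=> xC; rewrite /halin_adj /halin_cycle_arc xC eqxx /= !orbT. Qed.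

Lemma dart_adj v w : dart_spec v w -> adj v w.
Proof.
case=> [i iL|i iL|j jL|j jL|x xC|x xC]; rewrite 1?[adj (nx _) _]adj_sym.
- exact: adj_right.
- by rewrite adj_sym adj_right.
- exact: adj_to_leaf.
- by rewrite adj_sym adj_to_leaf.
- exact: adj_next.
exact: adj_next.
Qed.

End HalinGraph.

(** * Neighbours in clockwise order *)

Section HalinNeighbours.
Local Open Scope nat_scope.
Variable m : seq nat.
Hypotheses (m_size : 2 <= size m) (m_gt0 : all (leq 1) m).
Local Notation L := (nb_spine m).
Local Notation V := (halin_vertex m).
Local Notation up := (leaf_up m).
Local Notation C := (halin_cycle m).
Local Notation nx := (next (halin_cycle m)).
Local Notation pv := (prev (halin_cycle m)).
Local Notation adj := (@halin_adj m).
Local Notation spine := (spine m).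
Local Notation leaf := (leaf m).

(** The clockwise order starts with the left neighbour at an inner spine vertex, and with the
    predecessor on the cycle otherwise. *)
Definition nbr_a (v : V) : V :=
  if v is inl i then if 0 < i <= L then spine i.-1 else pv v else pv v.
Definition nbr_b (v : V) : V :=
  if v is inl i then
    if 0 < i <= L then if up i.-1 then leaf i.-1 else spine i.+1 else nx v
  else nx v.
Definition nbr_c (v : V) : V :=
  match v with
  | inl i => if 0 < i <= L then if up i.-1 then spine i.+1 else leaf i.-1
             else if i == 0 :> nat then spine 1 else spine L
  | inr j => spine j.+1
  end.

Lemma nbr_spine j : j < L -> [/\ nbr_a (spine j.+1) = spine j,
  nbr_b (spine j.+1) = (if up j then leaf j else spine j.+2) &
  nbr_c (spine j.+1) = if up j then spine j.+2 else leaf j].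
Proof. by move=> jL; rewrite /= inordK ?jL // !ltnS ltnW. Qed.

Lemma nbr_cycle x : x \in C -> nbr_a x = pv x /\ nbr_b x = nx x.
Proof.
case: x => [i|j] //; have -> : inl i = spine i by rewrite /spine inord_val.
rewrite mem_cycle_spine ?leq_ord // => /orP[] /eqP ->; rewrite /= inordK //.
by rewrite ltnn.
Qed.

Lemma nbr_c_spine0 : nbr_c (spine 0) = spine 1.
Proof. by rewrite /= inordK. Qed.
Lemma nbr_c_end : nbr_c (spine L.+1) = spine L.
Proof. by rewrite /= inordK // ltnn. Qed.
Lemma nbr_c_leaf j : j < L -> nbr_c (leaf j) = spine j.+1.
Proof. by move=> jL; rewrite (leaf_ord jL). Qed.

Lemma spine_in_cycle j : j < L -> spine j.+1 \in C = false.
Proof. by move=> jL; rewrite mem_cycle_spine; lia. Qed.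

Lemma eq_spine i j : i <= L.+1 -> j <= L.+1 -> (spine i == spine j) = (i == j).
Proof. by move=> iL jL; apply/eqP/eqP => [|-> //]; exact: spine_inj. Qed.

Lemma eq_leaf i j : i < L -> j < L -> (leaf i == leaf j) = (i == j).
Proof. by move=> iL jL; apply/eqP/eqP => [|-> //]; exact: leaf_inj. Qed.

Lemma cycle_arcs v w : v \in C ->
  halin_cycle_arc v w || halin_cycle_arc w v = (w == pv v) || (w == nx v).
Proof.
move=> vC; rewrite /halin_cycle_arc vC orbC andTb; congr (_ || _).
apply/andP/eqP => [[wC /eqP ->]|->].
  by rewrite prev_next // uniq_halin_cycle.
by rewrite mem_prev next_prev ?uniq_halin_cycle.
Qed.

Lemma no_cycle_arcs v w : v \notin C ->
  halin_cycle_arc v w || halin_cycle_arc w v = false.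
Proof.
move=> vC; rewrite /halin_cycle_arc (negPf vC) andFb orFb; apply/negP => /andP[wC /eqP vE].
by rewrite vE mem_next wC in vC.
Qed.

Lemma halin_adjE v w : adj v w = [|| w == nbr_a v, w == nbr_b v | w == nbr_c v].
Proof.
have L0 := L_gt0 m_size m_gt0.
elim/halin_vertex_ind: v => [| |j jL|j jL].
- have zC : spine 0 \in C by rewrite mem_cycle_spine.
  have [-> ->] := nbr_cycle zC.
  rewrite nbr_c_spine0 /halin_adj cycle_arcs ?mem_cycle_spine //.
  rewrite [LHS]orbA [LHS]orbC [RHS]orbA; congr (_ || _).
  elim/halin_vertex_ind: w => [| |i iL|i iL].
  + by rewrite !caterpillar_ss // eq_spine.
  + by rewrite !caterpillar_ss // eq_spine // orbF.
  + by rewrite !caterpillar_ss ?eq_spine //; lia.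
  by rewrite caterpillar_sl // caterpillar_l // [RHS]eq_sym (negPf (spine_neq_leaf _ iL)).
- have eC : spine L.+1 \in C by rewrite mem_cycle_spine // eqxx orbT.
  have [-> ->] := nbr_cycle eC.
  rewrite nbr_c_end /halin_adj cycle_arcs //.
  rewrite [LHS]orbA [LHS]orbC [RHS]orbA; congr (_ || _).
  elim/halin_vertex_ind: w => [| |i iL|i iL].
  + by rewrite !caterpillar_ss // eq_spine //; lia.
  + by rewrite !caterpillar_ss // eq_spine //; lia.
  + by rewrite !caterpillar_ss ?eq_spine //; lia.
  rewrite caterpillar_sl // caterpillar_l // [RHS]eq_sym.
  by rewrite (negPf (spine_neq_leaf _ iL)); lia.
- have [-> -> ->] := nbr_spine jL.
  rewrite /halin_adj no_cycle_arcs ?spine_in_cycle // orbF.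
  elim/halin_vertex_ind: w => [| |i iL|i iL].
  + rewrite !caterpillar_ss //; try lia.
    rewrite eq_spine //; last by lia.
    case: (up j); rewrite eq_spine ?(negPf (spine_neq_leaf _ jL)) ?orbF ?orFb //; lia.
  + rewrite !caterpillar_ss //; try lia.
    rewrite eq_spine //; last by lia.
    case: (up j); rewrite eq_spine ?(negPf (spine_neq_leaf _ jL)) ?orbF ?orFb //; lia.
  + rewrite !caterpillar_ss //; try lia.
    rewrite eq_spine //; try lia.
    case: (up j); rewrite eq_spine ?(negPf (spine_neq_leaf _ jL)) ?orbF ?orFb //; lia.
  rewrite caterpillar_sl ?caterpillar_l //; last by lia.
  rewrite [leaf i == spine _]eq_sym (negPf (spine_neq_leaf _ iL)).
  by case: (up j); rewrite eq_leaf // [leaf i == spine _]eq_sym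
    (negPf (spine_neq_leaf _ iL)); lia.
have jC := mem_cycle_leaf jL.
have [-> ->] := nbr_cycle jC; rewrite nbr_c_leaf // /halin_adj cycle_arcs //.
rewrite [LHS]orbA [LHS]orbC [RHS]orbA; congr (_ || _).
rewrite caterpillar_l //=.
elim/halin_vertex_ind: w => [| |i iL|i iL].
- by rewrite caterpillar_sl // eq_spine //; lia.
- by rewrite caterpillar_sl // eq_spine //; lia.
- by rewrite caterpillar_sl // ?eq_spine //; lia.
by rewrite caterpillar_l // [RHS]eq_sym (negPf (spine_neq_leaf _ iL)).
Qed.

Lemma halin_adj_irr : irreflexive adj.
Proof.
have L0 := L_gt0 m_size m_gt0.
move=> v; rewrite halin_adjE.
have cyc x : x \in C -> [|| x == nbr_a x, x == nbr_b x | x == nbr_c x] = (x == nbr_c x).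
  move=> xC; have [-> ->] := nbr_cycle xC; have [n1 n2] := next_neq m_size m_gt0 xC.
  rewrite [x == nx x]eq_sym (negPf n1) /=.
  suff -> : x == pv x = false by [].
  apply: contraNF n1 => /eqP E.
  by rewrite {1}E next_prev ?uniq_halin_cycle.
elim/halin_vertex_ind: v => [| |j jL|j jL].
- by rewrite cyc ?mem_cycle_spine // nbr_c_spine0 eq_spine.
- by rewrite cyc ?mem_cycle_spine ?eqxx ?orbT // nbr_c_end eq_spine //; lia.
- have [-> -> ->] := nbr_spine jL.
  rewrite eq_spine //; try lia.
  case: (up j); rewrite eq_spine ?(negPf (spine_neq_leaf _ jL)) ?orbF ?orFb //; lia.
by rewrite cyc ?mem_cycle_leaf // nbr_c_leaf // eq_sym (negPf (spine_neq_leaf _ jL)).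
Qed.

Lemma nbr_neq v : [/\ nbr_a v != nbr_b v, nbr_a v != nbr_c v & nbr_b v != nbr_c v].
Proof.
have L0 := L_gt0 m_size m_gt0.
have cyc x : x \in C -> nbr_c x \notin C ->
    [/\ nbr_a x != nbr_b x, nbr_a x != nbr_c x & nbr_b x != nbr_c x].
  move=> xC cC; have [-> ->] := nbr_cycle xC; have [n1 n2] := next_neq m_size m_gt0 xC.
  split; first by rewrite eq_sym.
    by apply: contraNneq cC => <-; rewrite mem_prev.
  by apply: contraNneq cC => <-; rewrite mem_next.
elim/halin_vertex_ind: v => [| |j jL|j jL].
- by apply: cyc; rewrite ?mem_cycle_spine // nbr_c_spine0 spine_in_cycle.
- apply: cyc; first by rewrite mem_cycle_spine // eqxx orbT.
  by rewrite nbr_c_end mem_cycle_spine; lia.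
- have [-> -> ->] := nbr_spine jL.
  case: (up j); split; rewrite ?eq_spine ?spine_neq_leaf // 1?eq_sym ?spine_neq_leaf //; lia.
by apply: cyc; rewrite ?mem_cycle_leaf // nbr_c_leaf // spine_in_cycle.
Qed.

End HalinNeighbours.

(** * Faces at the corners and on both sides of an edge *)

Section HalinFaces.
Local Open Scope nat_scope.
Variable m : seq nat.
Hypotheses (m_size : 2 <= size m) (m_gt0 : all (leq 1) m).
Local Notation L := (nb_spine m).
Local Notation V := (halin_vertex m).
Local Notation up := (leaf_up m).
Local Notation cu := (upper_face (leaf_up m)).
Local Notation cl := (lower_face (leaf_up m)).
Local Notation C := (halin_cycle m).
Local Notation nx := (next (halin_cycle m)).
Local Notation pv := (prev (halin_cycle m)).
Local Notation adj := (@halin_adj m).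
Local Notation spine := (spine m).
Local Notation leaf := (leaf m).
Local Notation left := (@left_face m).

Lemma arc_face_into x : x \in C ->
  arc_face (pv x) x = if arrives_above x then cu (column x) else bottom_number x.
Proof.
move=> xC; have pC : pv x \in C by rewrite mem_prev.
have E : nx (pv x) = x by rewrite next_prev ?uniq_halin_cycle.
case: ifP => ax; first by rewrite /arc_face ax.
have lp : ~~ leaves_above (pv x) by rewrite -arrives_next // E ax.
by have [] := arc_face_bottom pC lp; rewrite E.
Qed.

Lemma left_face_pv x : x \in C -> left (pv x) x = None.
Proof.
move=> xC; have := @left_face_next m m_size m_gt0 (pv x).
by rewrite mem_prev next_prev ?uniq_halin_cycle //; apply.
Qed.

Lemma left_face_to_pv x : x \in C -> left x (pv x) = Some (inord (arc_face (pv x) x)).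
Proof.
move=> xC; have := @left_face_prev m m_size m_gt0 (pv x).
by rewrite mem_prev next_prev ?uniq_halin_cycle //; apply.
Qed.

Lemma mem_cycle_end : spine L.+1 \in C.
Proof. by rewrite mem_cycle_spine // eqxx orbT. Qed.
Lemma mem_cycle_0 : spine 0 \in C.
Proof. by rewrite mem_cycle_spine. Qed.

Lemma top_leaf j : j < L -> top_number (leaf j) = j.+2.
Proof. by move=> jL; rewrite (leaf_ord jL). Qed.
Lemma bottom_leaf j : j < L -> bottom_number (leaf j) = j.+2.
Proof. by move=> jL; rewrite (leaf_ord jL). Qed.

Lemma left_face_ab v : left (nbr_a v) v = left v (nbr_b v).
Proof.
have cyc x : x \in C -> left (nbr_a x) x = left x (nbr_b x).
  by move=> xC; have [-> ->] := nbr_cycle xC; rewrite left_face_pv ?left_face_next.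
elim/halin_vertex_ind: v => [| |j jL|j jL].
- exact: cyc mem_cycle_0.
- exact: cyc mem_cycle_end.
- have [-> -> _] := nbr_spine jL.
  rewrite (left_face_right m_size m_gt0 (ltnW jL)); case: (boolP (up j)) => uj.
    by rewrite left_face_to_leaf // uj.
  by rewrite (left_face_right m_size m_gt0 jL) /= (negPf uj).
exact: cyc (mem_cycle_leaf jL).
Qed.

Lemma left_face_bc v : left (nbr_b v) v = left v (nbr_c v).
Proof.
elim/halin_vertex_ind: v => [| |j jL|j jL].
- have [_ ->] := nbr_cycle mem_cycle_0; rewrite nbr_c_spine0.
  rewrite left_face_prev ?mem_cycle_0 // arc_face_top ?mem_cycle_0 ?leaves_spine //.
  by rewrite left_face_right.
- have [_ ->] := nbr_cycle mem_cycle_end; rewrite nbr_c_end.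
  rewrite left_face_prev ?mem_cycle_end //.
  have [_ ->] := @arc_face_bottom m _ mem_cycle_end (negbT (leaves_spine (leqnn _))).
  by rewrite left_face_left.
- have [_ -> ->] := nbr_spine jL; case: (boolP (up j)) => uj.
    by rewrite left_face_from_leaf // left_face_right // uj /= uj.
  by rewrite left_face_left // left_face_to_leaf // (negPf uj) /= (negPf uj).
have jC := mem_cycle_leaf jL; have [_ ->] := nbr_cycle jC; rewrite nbr_c_leaf //.
rewrite left_face_prev // left_face_from_leaf //; case: (boolP (up j)) => uj.
  by rewrite arc_face_top ?leaves_leaf // top_leaf.
have lj : ~~ leaves_above (leaf j) by rewrite leaves_leaf.
by have [_ ->] := arc_face_bottom jC lj; rewrite column_leaf.
Qed.

Lemma left_face_ca v : left (nbr_c v) v = left v (nbr_a v).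
Proof.
elim/halin_vertex_ind: v => [| |j jL|j jL].
- have [-> _] := nbr_cycle mem_cycle_0; rewrite nbr_c_spine0.
  rewrite left_face_to_pv ?mem_cycle_0 // arc_face_into ?mem_cycle_0 //.
  by rewrite arrives_spine // left_face_left.
- have [-> _] := nbr_cycle mem_cycle_end; rewrite nbr_c_end.
  rewrite left_face_to_pv ?mem_cycle_end // arc_face_into ?mem_cycle_end //.
  by rewrite arrives_spine // left_face_right.
- have [-> _ ->] := nbr_spine jL.
  rewrite (left_face_left m_size m_gt0 (ltnW jL)); case: (boolP (up j)) => uj.
    by rewrite (left_face_left m_size m_gt0 jL) /= uj.
  by rewrite left_face_from_leaf // (negPf uj).
have jC := mem_cycle_leaf jL; have [-> _] := nbr_cycle jC; rewrite nbr_c_leaf //.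
rewrite left_face_to_pv // arc_face_into // arrives_leaf // left_face_to_leaf //.
by rewrite column_leaf // bottom_leaf.
Qed.

Lemma inord_inj a b : a < L.+2 -> b < L.+2 ->
  inord a = inord b :> 'I_L.+2 -> a = b.
Proof. by move=> aL bL /(congr1 val); rewrite /= !inordK. Qed.

(** For adjacent inner faces [b < a], the dart with [a] on its left and [b] on its right. This
    explicit inverse shows that two inner faces share at most one edge. *)
Definition low_dart (a b : nat) : V * V :=
  if a is j.+2 then
    if up j then if b == cl j then (spine j.+1, spine j.+2) else (leaf j, spine j.+1)
    else if b == cu j then (spine j.+2, spine j.+1) else (spine j.+1, leaf j)
  else (spine 0, spine 1).

Definition swap (d : V * V) := (d.2, d.1).

Definition dart_between (a b : nat) : V * V :=
  if b < a then low_dart a b else swap (low_dart b a).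

Lemma dart_betweenC a b : a != b -> dart_between b a = swap (dart_between a b).
Proof.
rewrite /dart_between; case: ltngtP => // _ _.
by rewrite /swap; case: (low_dart _ _).
Qed.

(** The edges between two inner faces are those of the caterpillar; the numbers are the faces on the
    left and on the right. *)
Variant tree_dart_spec : V -> V -> nat -> nat -> Prop :=
 | TreeRight i of i <= L :
     tree_dart_spec (spine i) (spine i.+1) (cu i) (cl i)
 | TreeLeft i of i <= L :
     tree_dart_spec (spine i.+1) (spine i) (cl i) (cu i)
 | TreeToLeaf j of j < L : tree_dart_spec (spine j.+1) (leaf j)
     (if up j then cu j else j.+2) (if up j then j.+2 else cl j)
 | TreeFromLeaf j of j < L : tree_dart_spec (leaf j) (spine j.+1)
     (if up j then j.+2 else cl j) (if up j then cu j else j.+2).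

Lemma tree_dartP v w p q : adj v w -> left v w = Some p -> left w v = Some q ->
  tree_dart_spec v w p q.
Proof.
have some a : a < L.+2 -> forall p : 'I_L.+2, Some (inord a) = Some p -> a = p.
  by move=> aL r [<-]; rewrite inordK.
move=> /dartP[i iL|i iL|j jL|j jL|x xC|x xC].
- rewrite left_face_right // left_face_left // => /some <-; last exact: cu_lt.
  by move/some => <-; [constructor | exact: cl_lt].
- rewrite left_face_right // left_face_left // => /some <-; last exact: cl_lt.
  by move/some => <-; [constructor | exact: cu_lt].
- rewrite left_face_to_leaf // left_face_from_leaf //.
  have := cu_lt (ltnW jL); have := cl_lt (ltnW jL) => clL cuL.
  move=> /some <-; last by case: ifP; rewrite // !ltnS.
  by move=> /some <-; [constructor | case: ifP; rewrite // !ltnS].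
- rewrite left_face_to_leaf // left_face_from_leaf //.
  have := cu_lt (ltnW jL); have := cl_lt (ltnW jL) => clL cuL.
  move=> /some <-; last by case: ifP; rewrite // !ltnS.
  by move=> /some <-; [constructor | case: ifP; rewrite // !ltnS].
- by rewrite left_face_next.
by rewrite left_face_next.
Qed.

Lemma tree_dart_adj v w a b : tree_dart_spec v w a b -> adj v w.
Proof.
case=> [i iL|i iL|j jL|j jL]; apply: dart_adj; by constructor.
Qed.

Lemma tree_dart_between v w a b : tree_dart_spec v w a b -> (v, w) = dart_between a b.
Proof.
have clt j := upper_face_lt up j; have llt j := lower_face_lt up j.
have neq j := upper_neq_lower up j j.
have right i : (spine i, spine i.+1) = dart_between (cu i) (cl i).
  case: i => [|j] //; rewrite /dart_between /=; case: (boolP (up j)) => uj.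
    by rewrite llt /= uj eqxx.
  by rewrite ltnNge ltnW //= (negPf uj) eqxx.
have to_leaf j : (spine j.+1, leaf j)
    = dart_between (if up j then cu j else j.+2) (if up j then j.+2 else cl j).
  rewrite /dart_between; case: (boolP (up j)) => uj.
    by rewrite ltnNge ltnW //= uj (negPf (neq j)).
  by rewrite llt /= (negPf uj) eq_sym (negPf (neq j)).
case=> [i iL|i iL|j jL|j jL] //.
- by rewrite dart_betweenC // -right.
rewrite dart_betweenC -?to_leaf //; case: ifP => _.
  by rewrite ltn_eqF.
by rewrite gtn_eqF.
Qed.

End HalinFaces.

(** * The graphs H_m as plane cubic graphs *)

Section HalinEmbeddings.
Local Open Scope nat_scope.
Variable m : seq nat.
Hypotheses (m_size : 2 <= size m) (m_gt0 : all (leq 1) m).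
Local Notation L := (nb_spine m).
Local Notation V := (halin_vertex m).
Local Notation up := (leaf_up m).
Local Notation cu := (upper_face (leaf_up m)).
Local Notation cl := (lower_face (leaf_up m)).
Local Notation C := (halin_cycle m).
Local Notation nx := (next (halin_cycle m)).
Local Notation pv := (prev (halin_cycle m)).
Local Notation adj := (@halin_adj m).
Local Notation spine := (spine m).
Local Notation leaf := (leaf m).
Local Notation left := (@left_face m).
Local Notation st := (is_start m).
Local Notation tree_dart_spec := (@tree_dart_spec m).

Lemma strip_current j : j < L -> strip st j.+2 (cu j) && strip st j.+2 (cl j).
Proof.
move=> jL; have s1 : strip st j.+2 j.+1 by rewrite stripE // /strip_arc eqxx.
have s2 : strip st j.+2 (last_start st j).
  have := last_start_le st j => lj; rewrite stripE; last by lia.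
  by rewrite /strip_arc eqxx orbT.
by have [[-> ->]|[-> ->]] := current_facesL m_size m_gt0 (ltnW jL); rewrite ?s1 ?s2.
Qed.

Lemma tree_dart_strip v w a b : tree_dart_spec v w a b -> (a != b) && strip st a b.
Proof.
have clt j := upper_face_lt up j; have llt j := lower_face_lt up j.
have neq j := upper_neq_lower up j j.
have sp i : i <= L -> strip st (cu i) (cl i).
  move=> iL; have := strip_last_start st i.
  have [[-> ->] //|[-> ->]] := current_facesL m_size m_gt0 iL.
  by rewrite strip_sym.
case=> [i iL|i iL|j jL|j jL].
- by rewrite neq sp.
- by rewrite eq_sym neq strip_sym sp.
- have /andP[s1 s2] := strip_current jL; case: ifP => _.
    by rewrite ltn_eqF // strip_sym.
  by rewrite gtn_eqF.
have /andP[s1 s2] := strip_current jL; case: ifP => _.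
  by rewrite gtn_eqF.
by rewrite ltn_eqF // strip_sym.
Qed.

(** The smaller neighbours of the face [j + 2] are the two current faces at leaf [j]: its spoke
    separates the new face from the one on its side, and the next spine edge separates it from the
    one across. *)
Lemma strip_tree_dart a b : a < L.+2 -> b < L.+2 -> a != b -> strip st a b ->
  exists v w, tree_dart_spec v w a b.
Proof.
have low r s : r < L.+2 -> s < r -> strip st r s ->
    exists v w, tree_dart_spec v w r s /\ tree_dart_spec w v s r.
  case: r => [|[|j]] // jL sr.
    case: s sr => // _ _; exists (spine 0), (spine 1).
    by split; [exact: (TreeRight (leq0n L)) | exact: (TreeLeft (leq0n L))].
  rewrite stripE // => sarc.
  have {sarc} : s = cu j \/ s = cl j.
    have jL' : j <= L by lia.
    have [[-> ->]|[-> ->]] := current_facesL m_size m_gt0 jL';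
      move: sarc; rewrite /strip_arc eqSS eq_sym => /orP[/eqP|/= /eqP]; auto.
  have right := @TreeRight m j.+1 jL; have left_ := @TreeLeft m j.+1 jL.
  have to := @TreeToLeaf m j jL; have from := @TreeFromLeaf m j jL.
  move: right left_ to from; rewrite /=; case: (up j) => r1 r2 r3 r4 [] ->.
  - by exists (leaf j), (spine j.+1).
  - by exists (spine j.+1), (spine j.+2).
  - by exists (spine j.+2), (spine j.+1).
  by exists (spine j.+1), (leaf j).
move=> aL bL; case: (ltngtP a b) => // ab _ sab.
  have [|v [w [t1 t2]]] := low b a bL ab; first by rewrite strip_sym.
  by exists w, v.
by have [v [w [t1 t2]]] := low a b aL ab sab; exists v, w.
Qed.

Lemma left_tree_dart v w a b : tree_dart_spec v w a b ->
  left v w = Some (inord a) /\ left w v = Some (inord b).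
Proof.
case=> [i iL|i iL|j jL|j jL].
- by rewrite left_face_right // left_face_left.
- by rewrite left_face_right // left_face_left.
- by rewrite left_face_to_leaf // left_face_from_leaf.
by rewrite left_face_to_leaf // left_face_from_leaf.
Qed.

Lemma left_face_neq v w : adj v w -> left v w != left w v.
Proof.
move=> vw; case l1: (left v w) => [p|]; case l2: (left w v) => [q|] //.
  have /tree_dart_strip/andP[pq _] := tree_dartP m_size m_gt0 vw l1 l2.
  by apply: contraNneq pq => -[->].
move: vw l1 l2; move=> /dartP[i iL|i iL|j jL|j jL|x xC|x xC].
- by rewrite left_face_right.
- by rewrite left_face_left.
- by rewrite left_face_to_leaf.
- by rewrite left_face_from_leaf.
- by rewrite left_face_prev.
by rewrite left_face_prev.
Qed.

Lemma outer_dartP v w : adj v w -> left v w = None -> v \in C /\ w = nx v.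
Proof.
move=> /dartP[i iL|i iL|j jL|j jL|x xC|x xC] //.
- by rewrite left_face_to_leaf.
- by rewrite left_face_from_leaf.
by rewrite left_face_prev.
Qed.

Lemma top_number_inj (x y : V) : leaves_above x -> leaves_above y ->
  top_number x = top_number y -> x = y.
Proof.
case: x y => [i|i] [j|j] //=; last by move=> _ _ [/val_inj ->].
by move=> /eqP i0 /eqP j0 _; congr inl; apply: val_inj; rewrite /= i0 j0.
Qed.

Lemma bottom_number_inj (x y : V) : ~~ arrives_above x -> ~~ arrives_above y ->
  bottom_number x = bottom_number y -> x = y.
Proof.
case: x y => [i|i] [j|j] //=; last by move=> _ _ [/val_inj ->].
by rewrite !negbK => /eqP i0 /eqP j0 _; congr inl; apply: val_inj; rewrite /= i0 j0.
Qed.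

Lemma arc_face_inj (x y : V) : x \in C -> y \in C ->
  arc_face x (nx x) = arc_face y (nx y) -> x = y.
Proof.
move=> xC yC E; have := arc_face_upper xC; rewrite E arc_face_upper // => lxy.
case: (boolP (leaves_above x)) => lx.
  have ly : leaves_above y by rewrite lxy.
  by apply: top_number_inj; rewrite // -!arc_face_top.
have ly : ~~ leaves_above y by rewrite lxy.
apply: (can_inj (prev_next (uniq_halin_cycle m))).
apply: bottom_number_inj; rewrite ?arrives_next //.
by have [<- _] := arc_face_bottom xC lx; have [<- _] := arc_face_bottom yC ly.
Qed.

Lemma left_face_inj v w v' w' : adj v w -> adj v' w' ->
  left v w = left v' w' -> left w v = left w' v' -> (v, w) = (v', w').
Proof.
have outer x y x' y' : adj x y -> adj x' y' -> left x y = None -> left x' y' = None ->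
    left y x = left y' x' -> (x, y) = (x', y').
  move=> xy xy' l l'; have [xC ->] := outer_dartP xy l.
  have [xC' ->] := outer_dartP xy' l'; rewrite !left_face_prev // => -[].
  move/inord_inj; rewrite !arc_face_lt => /(_ isT isT) E.
  by rewrite (arc_face_inj xC xC' E).
move=> vw vw' E1 E2; case l1: (left v w) => [p|]; last first.
  by apply: outer; rewrite // -E1.
case l2: (left w v) => [q|]; last first.
  have wv : adj w v by rewrite adj_sym.
  have wv' : adj w' v' by rewrite adj_sym.
  have := outer w v w' v' wv wv' l2.
  by rewrite -E2 l2 E1 => /(_ erefl erefl) [-> ->].
have /tree_dart_between -> := tree_dartP m_size m_gt0 vw l1 l2.
rewrite E1 in l1; rewrite E2 in l2.
by have /tree_dart_between -> := tree_dartP m_size m_gt0 vw' l1 l2.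
Qed.

(** An upper face starts at the tail of its arc and a lower face at the head, because the cycle runs
    to the left below. *)
Definition outer_dart (p : 'I_L.+2) : V * V :=
  if is_upper up p then (nx (face_start m p), face_start m p)
  else (face_start m p, pv (face_start m p)).

Lemma face_start_in_cycle p : p < L.+2 -> face_start m p \in C.
Proof.
by case: p => [|[|j]] jL; rewrite ?mem_cycle_spine //; exact: mem_cycle_leaf.
Qed.

Lemma outer_dart_left p :
  [/\ adj (outer_dart p).1 (outer_dart p).2,
      left (outer_dart p).1 (outer_dart p).2 = Some p
    & left (outer_dart p).2 (outer_dart p).1 = None].
Proof.
have pL := ltn_ord p; have pC := face_start_in_cycle pL; rewrite /outer_dart.
case: ifPn => pu; rewrite [(_, _).1]/= [(_, _).2]/=.
  split; first by rewrite adj_sym adj_next.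
    rewrite left_face_prev // arc_face_top ?leaves_face_start //.
    by rewrite top_face_start // inord_val.
  by rewrite left_face_next.
split.
- have := @adj_next m (pv (face_start m p)).
  by rewrite mem_prev next_prev ?uniq_halin_cycle // adj_sym; apply.
- rewrite left_face_to_pv // arc_face_into // (negPf (arrives_face_start _ _)) //.
  by rewrite bottom_face_start // inord_val.
by rewrite left_face_pv.
Qed.

(** With zeros on the cycle, the equations at the leaves and at [spine 0] clear their tree edges;
    the equations at the spine vertices then clear the spine from left to right. *)
Lemma halin_inner_acyclic (x : V -> V -> 'F_2) :
  (forall v w, adj v w -> x v w = x w v) ->
  (forall v, (x v (nbr_a v) + x v (nbr_b v) + x v (nbr_c v) = 0)%R) ->
  (forall v w, adj v w -> left v w = None -> x v w = 0%R) ->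
  forall v w, adj v w -> x v w = 0%R.
Proof.
move=> xs x0 xN.
have xnx v : v \in C -> x v (nx v) = 0%R.
  by move=> vC; apply: xN; rewrite ?adj_next ?left_face_next.
have xpv v : v \in C -> x v (pv v) = 0%R.
  move=> vC; have E := next_prev (uniq_halin_cycle m) v.
  by rewrite -{1}E -xs ?xnx ?adj_next // mem_prev.
have xc v : v \in C -> x v (nbr_c v) = 0%R.
  move=> vC; have := x0 v; have [-> ->] := nbr_cycle vC.
  by rewrite xnx // xpv // !add0r.
have xl j : j < L -> x (leaf j) (spine j.+1) = 0%R.
  by move=> jL; rewrite -(nbr_c_leaf jL) xc // mem_cycle_leaf.
have xl' j : j < L -> x (spine j.+1) (leaf j) = 0%R.
  by move=> jL; rewrite xs ?adj_to_leaf // xl.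
have xr i : i <= L -> x (spine i) (spine i.+1) = 0%R.
  elim: i => [|j IH] jL; first by rewrite -(nbr_c_spine0 m) xc // mem_cycle_spine.
  have := x0 (spine j.+1); have [-> -> ->] := nbr_spine jL.
  have -> : x (spine j.+1) (spine j) = 0%R.
    by rewrite -xs ?adj_right ?IH // ltnW.
  by case: (up j); rewrite xl' // ?addr0 ?add0r.
move=> v w /dartP[i iL|i iL|j jL|j jL|y yC|y yC].
- exact: xr.
- by rewrite -xs ?adj_right ?xr.
- exact: xl'.
- exact: xl.
- exact: xnx.
by rewrite -xs ?adj_next ?xnx.
Qed.

(** Partial sums of [h] along the spine, extended by one term to each leaf. *)
Lemma halin_inner_potential (h : V -> V -> 'F_2) : (forall v w, h v w = h w v) ->
  exists g : V -> 'F_2, forall v w, adj v w -> left v w != None ->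
    left w v != None -> (g v + g w)%R = h v w.
Proof.
move=> hs; pose gs i := (\sum_(t < i) h (spine t) (spine t.+1))%R.
pose g (v : V) : 'F_2 := match v with
  | inl i => gs i | inr j => (gs j.+1 + h (spine j.+1) (inr j))%R end.
have gS i : i <= L.+1 -> g (spine i) = gs i by move=> iL; rewrite /= inordK.
have gL j : j < L -> g (leaf j) = (gs j.+1 + h (spine j.+1) (leaf j))%R.
  by move=> jL; rewrite (leaf_ord jL).
have F2K (a b : 'F_2) : (a + (a + b) = b)%R by rewrite addrA F2_addrr add0r.
have gsS i : gs i.+1 = (gs i + h (spine i) (spine i.+1))%R by rewrite /gs big_ord_recr.
exists g => v w /dartP[i iL|i iL|j jL|j jL|x xC|x xC].
- by move=> _ _; rewrite !gS ?gsS ?F2K // ltnW.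
- by move=> _ _; rewrite !gS ?gsS // 1?addrC ?F2K // ltnW.
- by move=> _ _; rewrite gS ?gL ?F2K // ltnW.
- by move=> _ _; rewrite gS ?gL // 1?addrC ?F2K // ltnW.
- by rewrite left_face_next.
by rewrite left_face_next.
Qed.

Lemma nb_halin_embeddings T i : spanning_tree adj T ->
  nb_embeddings adj T i
  = 2 * #|[set M | sym_supp (fun a b : 'I_L.+2 => strip st a b) M & \rank M == i]|.
Proof.
move=> treeT.
apply: (@nb_embeddingsE _ adj L.+2 (@nbr_a m) (@nbr_b m) (@nbr_c m) left
  (fun a b : 'I_L.+2 => strip st a b) outer_dart (spine 0)) => //.
- exact: halin_adjE.
- exact: adj_sym.
- exact: halin_adj_irr.
- by move=> v; have [] := nbr_neq m_size m_gt0 v.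
- by move=> v; have [] := nbr_neq m_size m_gt0 v.
- by move=> v; have [] := nbr_neq m_size m_gt0 v.
- exact: left_face_ab.
- exact: left_face_bc.
- exact: left_face_ca.
- exact: left_face_neq.
- exact: left_face_inj.
- exact: outer_dart_left.
- by move=> a; exact: strip_refl.
- move=> v w p q vw l1 l2.
  by have /tree_dart_strip/andP[] := tree_dartP m_size m_gt0 vw l1 l2.
- move=> p q pq spq; have [v [w vw]] := strip_tree_dart (ltn_ord p) (ltn_ord q) pq spq.
  exists v, w; have [l1 l2] := left_tree_dart vw.
  by split; [exact: tree_dart_adj vw | rewrite l1 inord_val | rewrite l2 inord_val].
- exact: halin_inner_acyclic.
- exact: halin_inner_potential.
- move=> v w; have [Tadj Tconn _] := treeT; have := Tconn v w.
  apply: connect_sub => x y /= xyT; apply: connect1.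
  move/subsetP: Tadj => /(_ _ xyT) /imsetP[[x' y'] /[1!inE] /= xy'].
  by move=> /set2_inj[[-> ->]|[-> ->]]; rewrite // adj_sym.
by rewrite card_sum !card_ord; lia.
Qed.

Lemma euler_genus_polyE T : spanning_tree adj T ->
  euler_genus_poly adj T = (2 * full_strip_poly st (strip_size m))%R.
Proof.
move=> treeT; have cE : #|edges adj| * 2 = #|{: V}| * 3.
  apply: (@card_edges _ adj (@nbr_a m) (@nbr_b m) (@nbr_c m)).
  - exact: halin_adjE.
  - exact: adj_sym.
  - exact: halin_adj_irr.
  - by move=> v; have [] := nbr_neq m_size m_gt0 v.
  - by move=> v; have [] := nbr_neq m_size m_gt0 v.
  - by move=> v; have [] := nbr_neq m_size m_gt0 v.
rewrite strip_sizeE // /full_strip_poly /strip_poly.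
rewrite (@eq_rank_poly _ _ (fun a b : 'I_L.+2 => strip st a b)) => [|a b]; last first.
  by rewrite /= !ltn_ord.
(* The truncation of [euler_genus_poly] lies beyond every rank, since there are more edges than
   inner faces. *)
rewrite /rank_poly (@sum_polyX_card _ _ _ #|edges adj|.+3) => [|M _]; last first.
  have := rank_leq_row M; move: cE; rewrite card_sum !card_ord; lia.
apply/polyP => i; rewrite mulr_natl coefMn !coef_poly; case: ifP => _; last by rewrite mul0rn.
by rewrite nb_halin_embeddings // PoszM mulrC -mulr_natr natz.
Qed.

End HalinEmbeddings.

(** * Recurrences in the last two blocks *)

Lemma last_start_ext (st st' : pred nat) j :
  (forall x, (x <= j)%N -> st x = st' x) -> last_start st j = last_start st' j.
Proof.
elim: j => //= j IH E; rewrite -E // IH // => x xj.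
by apply: E; exact: leqW.
Qed.

Lemma strip_ext (st st' : pred nat) r s :
  (forall x, (x.+2 <= maxn r s)%N -> st x = st' x) -> strip st r s = strip st' r s.
Proof.
have arc r' s' : (forall x, (x.+2 <= maxn r' s')%N -> st x = st' x) ->
    strip_arc st r' s' = strip_arc st' r' s'.
  move=> E; rewrite /strip_arc; case: (ltnP 1 r') => //= r1.
  rewrite (@last_start_ext st st') // => x xr; apply: E.
  by rewrite leq_max; apply/orP; left; lia.
by move=> E; rewrite /strip !arc // maxnC.
Qed.

(** A start influences arcs only two positions further on, so those from [N - 2] on are invisible.
    Hence one predicate [st] can serve sequences with different last blocks. *)
Lemma strip_poly_st (st st' : pred nat) S N :
  (forall x, (x.+2 < N)%N -> st x = st' x) -> strip_poly st S N = strip_poly st' S N.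
Proof.
move=> E; apply: eq_rank_poly => i j; rewrite (@strip_ext st st') // => x xij.
by apply: E; have := ltn_ord i; have := ltn_ord j; lia.
Qed.

Lemma strip_size_rcons m n : strip_size (rcons m n) = (strip_size m + n.+1)%N.
Proof. by rewrite /strip_size map_rcons sumn_rcons. Qed.

Lemma block_start_rcons m n i : (i <= size m)%N ->
  block_start (rcons m n) i = block_start m i.
Proof.
move=> im; rewrite /block_start map_rcons -cats1 takel_cat // size_map //.
Qed.

Lemma is_start_rcons m n r :
  is_start (rcons m n) r = is_start m r || (r == strip_size m).
Proof.
rewrite /is_start /= size_rcons -addn1 iotaD map_cat mem_cat /= mem_seq1.
rewrite add0n block_start_rcons // block_start_size; congr (_ || _).
have -> // : map (block_start (rcons m n)) (iota 0 (size m))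
  = map (block_start m) (iota 0 (size m)).
apply/eq_in_map => i; rewrite mem_iota => im; rewrite block_start_rcons //.
by lia.
Qed.

Lemma is_start_lt m r : all (leq 1) m -> is_start m r -> (r < strip_size m)%N.
Proof.
move=> m0 /is_startP[i im ->]; rewrite -block_start_size.
have im' : (i < size m <= size m)%N by rewrite im leqnn.
by have := block_start_lt im'; lia.
Qed.

Section Recurrences.
Variables (M : seq nat) (a : nat).
Hypotheses (M_size : (1 <= size M)%N) (M_gt0 : all (leq 1) M) (a_gt0 : (0 < a)%N).
Local Notation delta m := (full_strip_poly (is_start m) (strip_size m)).

(** The length 1 is arbitrary: [s] is where the last block starts, [s'] where the one before it
    starts, and neither depends on the length of the last block. *)
Let st := is_start (rcons (rcons M a) 1).
Let s := strip_size (rcons M a).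
Let s' := strip_size M.

Let sE : s = (s' + a.+1)%N. Proof. exact: strip_size_rcons. Qed.

Let s'_gt1 : (1 < s')%N.
Proof.
rewrite /s' /strip_size; case: M M_size M_gt0 => //= b m _ /andP[b0 _]; lia.
Qed.

Let stE r : st r = [|| is_start M r, r == s' | r == s].
Proof. by rewrite /st !is_start_rcons orbA. Qed.

Let st_n n r : is_start (rcons (rcons M a) n) r = st r.
Proof. by rewrite /st !is_start_rcons. Qed.

Let st_b b r : (r < s)%N -> is_start (rcons M b) r = st r.
Proof. by move=> rs; rewrite stE is_start_rcons (ltn_eqF rs) orbF. Qed.

Let last_s j : (s <= j)%N -> last_start st j = s.
Proof.
move=> sj; apply: last_start_uniq => //; first by right; rewrite stE eqxx !orbT.
move=> x xj; rewrite stE; apply/negP => /or3P[/(is_start_lt M_gt0)|/eqP|/eqP]; lia.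
Qed.

Let last_s' j : (s' <= j < s)%N -> last_start st j = s'.
Proof.
move=> /andP[sj js]; apply: last_start_uniq => //.
  by right; rewrite stE eqxx orbT.
move=> x xj; rewrite stE; apply/negP => /or3P[/(is_start_lt M_gt0)|/eqP|/eqP]; lia.
Qed.

Let delta_n n : delta (rcons (rcons M a) n) = full_strip_poly st (s + n.+1)%N.
Proof. by rewrite strip_size_rcons; apply: strip_poly_st => x _; exact: st_n. Qed.

Let delta_a : delta (rcons M a) = full_strip_poly st s.
Proof. by apply: strip_poly_st => x xs; apply: st_b; lia. Qed.

(** One index into the new block, the strip cannot yet be told from one whose previous block is
    longer by one. This is why the sequence ending in [a + 1] appears. *)
Let delta_aS : delta (rcons M a.+1) = full_strip_poly st s.+1.
Proof.
have -> : strip_size (rcons M a.+1) = s.+1 by rewrite strip_size_rcons sE; lia.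
by apply: strip_poly_st => x xs; apply: st_b; lia.
Qed.

Let lambda_n n : (0 < n)%N ->
  lambda_poly (rcons (rcons M a) n) = cut_strip_poly st (s + n.+1)%N s.
Proof.
move=> n0; rewrite lambda_polyE ?size_rcons // ?all_rcons ?n0 ?a_gt0 //=.
rewrite block_start_rcons ?size_rcons // -(size_rcons M a) block_start_size.
by rewrite strip_size_rcons; apply: strip_poly_st => x _; exact: st_n.
Qed.

Let lambda_a : lambda_poly (rcons M a) = cut_strip_poly st s s'.
Proof.
rewrite lambda_polyE ?size_rcons // ?all_rcons ?a_gt0 //=.
rewrite block_start_rcons // block_start_size.
by apply: strip_poly_st => x xs; apply: st_b; lia.
Qed.

Let lambda_aS : lambda_poly (rcons M a.+1) = cut_strip_poly st s.+1 s'.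
Proof.
rewrite lambda_polyE ?size_rcons // ?all_rcons //=.
rewrite block_start_rcons // block_start_size.
have -> : strip_size (rcons M a.+1) = s.+1 by rewrite strip_size_rcons sE; lia.
by apply: strip_poly_st => x xs; apply: st_b; lia.
Qed.

(** The last index is now [s + 1]; its neighbours are [s] and [s']. Deleting [s'] from the strip of
    size [s + 1] gives Lambda for the last block [a + 1]. *)
Lemma delta_rec1 : delta (rcons (rcons M a) 1)
  = (1 + 4 * 'X) * delta (rcons M a.+1) + 16 * 'X^2 * delta (rcons M a)
    + 8 * 'X^2 * (2 ^+ a.+1 * lambda_poly (rcons M a.+1)).
Proof.
rewrite delta_n delta_aS delta_a lambda_aS.
have [t st_] : exists t, s = t.+1 by exists s.-1; rewrite prednK //; lia.
have qE : last_start st t = s' by apply: last_s'; lia.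
have := @full_strip_rec st t; rewrite qE -st_ => /(_ s'_gt1).
rewrite addn2 => ->; congr (_ + _).
have -> : (s.+3 - s' = a.+4)%N by lia.
by rewrite natrX !exprS; ring.
Qed.

Lemma delta_rec n : (0 < n)%N -> delta (rcons (rcons M a) n.+1)
  = (1 + 4 * 'X) * delta (rcons (rcons M a) n)
    + 16 * 'X^2 * (if n == 1%N then delta (rcons M a.+1)
                   else delta (rcons (rcons M a) n.-1))
    + 8 * 'X^2 * (2 ^+ n * lambda_poly (rcons (rcons M a) n)).
Proof.
move=> n0; rewrite !delta_n lambda_n //.
have -> : (if n == 1%N then delta (rcons M a.+1) else full_strip_poly st (s + n.-1.+1)%N)
    = full_strip_poly st (s + n)%N.
  by case: eqP => [->|_]; [rewrite addn1 delta_aS | rewrite prednK].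
have [t tE] : exists t, (s + n)%N = t.+1 by exists (s + n).-1; rewrite prednK //; lia.
have qE : last_start st t = s by apply: last_s; lia.
have := @full_strip_rec st t; rewrite qE !addnS tE => ->; last by lia.
congr (_ + _); have -> : (t.+4 - s = n.+3)%N by lia.
by rewrite natrX !exprS; ring.
Qed.

Lemma lambda_rec1 : 2 * lambda_poly (rcons (rcons M a) 1)
  = 16 * 'X^2 * (2 ^+ a * lambda_poly (rcons M a))
    + (1 + 2 * 'X) * (2 * delta (rcons M a)).
Proof.
rewrite lambda_n // lambda_a delta_a.
have [t st_] : exists t, s = t.+1 by exists s.-1; rewrite prednK //; lia.
have qE : last_start st t = s' by apply: last_s'; lia.
have := @cut_strip_rec0 st t; rewrite qE -st_ => H.
rewrite addn2 H; last by lia.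
have -> : (s.+2 - s' = a.+3)%N by lia.
by rewrite natrX !exprS; ring.
Qed.

(** For [n = 1], two steps back only the deleted start is left of the new block, so that
    [cut_strip0] gives the full strip of the shorter sequence. *)
Lemma lambda_rec n : (0 < n)%N -> 2 ^+ n.+1 * lambda_poly (rcons (rcons M a) n.+1)
  = (2 + 4 * 'X) * (2 ^+ n * lambda_poly (rcons (rcons M a) n))
    + (if n == 1%N then 8 * 'X^2 * (2 * delta (rcons M a))
       else 16 * 'X^2 * (2 ^+ n.-1 * lambda_poly (rcons (rcons M a) n.-1))).
Proof.
move=> n0; rewrite (lambda_n (ltn0Sn n)) (lambda_n n0).
have [t tE] : exists t, (s + n)%N = t.+1 by exists (s + n).-1; rewrite prednK //; lia.
have qE : last_start st t = s by apply: last_s; lia.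
have := @cut_strip_rec st t; rewrite qE !addnS tE => ->; last by lia.
case: eqP => [n1|n1].
  have -> : t.+1 = s.+1 by lia.
  by rewrite cut_strip0 delta_a n1 expr1 expr2; ring.
case: n n0 tE n1 => [|[|n]] // _ tE _.
rewrite lambda_n // (_ : s + n.+2 = t.+1)%N // !exprS; ring.
Qed.

End Recurrences.

(** * Generating series *)

Lemma lvar_inv (R : comNzRingType) k j :
  (lvar R k j)^-1 = lmonom 1 (- [ffun i : 'I_k => (i.+1 == j)%:Z]).
Proof.
apply: (mulrI (lvar_unit R k j)); rewrite mulrV ?lvar_unit //.
by rewrite /lvar lmonomM mul1r subrr.
Qed.

Lemma mem_take_enum k j (r : 'I_k) : (r \in take j (enum 'I_k)) = (r < j)%N.
Proof.
rewrite -(mem_map val_inj) map_take val_enum_ord take_iota mem_iota /= add0n.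
by rewrite leq_min ltn_ord andbT.
Qed.

Lemma gen_seriesE k j i c (e : expo k) (m := [seq absz (e r) | r <- take j (enum 'I_k)]) :
  (j <= k)%N ->
  gen_series k j i c e
  = if [forall r : 'I_k, if (r < j)%N then 1 <= e r else e r == 0] && (i <= last 0 m)%N
    then c m else 0.
Proof.
move=> jk; rewrite /gen_series /= /gen_coef -/m andbA; congr (if _ && _ then _ else _).
have sm : size m = j by rewrite size_map size_take size_enum_ord; case: ltngtP jk.
have mr (r : 'I_k) : nth 0%N m r = if (r < j)%N then absz (e r) else 0%N.
  case: ifP => rj; last by rewrite nth_default // sm leqNgt rj.
  by rewrite (nth_map r) ?nth_take ?nth_ord_enum //
    -[X in (_ < X)%N](size_map (fun r => absz (e r))) sm.
apply/andP/forallP => [[/eqP em /allP mge] r|eH].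
  have er : e r = (if (r < j)%N then absz (e r) else 0%N)%:Z :> int.
    by rewrite {1}em ffunE mr.
  case: ifP er => rj er; last by rewrite er.
  have : (0 < absz (e r))%N by apply: mge; apply: map_f; rewrite mem_take_enum.
  by lia.
split.
  apply/eqP/ffunP => r; rewrite ffunE mr; have := eH r.
  by case: ifP => _; [move: (e r : int) => x; lia | move/eqP].
apply/allP => x /mapP[r]; rewrite mem_take_enum => rj ->.
by have := eH r; rewrite rj; lia.
Qed.

(** * Coefficients as functions of the last two exponents *)

Section LastTwoVariables.
Variables (k j : nat) (p q : 'I_k).
Hypotheses (pE : p = j.+1 :> nat) (qE : q = j.+2 :> nat).
Implicit Types (e : expo k) (c : seq nat -> {poly int}).

Definition init_exponents e : seq nat := [seq absz (e r) | r <- take j.+1 (enum 'I_k)].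
Definition regular e : bool :=
  [forall r : 'I_k, ((r < j.+1)%N ==> (1 <= e r)) && ((j.+2 < r)%N ==> (e r == 0))].

(** The exponents are integers, because multiplication by the variables and their inverses shifts
    them to zero and below, where the coefficient is 0. *)
Definition last_coef i c M (a n : int) : {poly int} :=
  if [&& 1 <= a, 1 <= n & i%:Z <= n] then c (rcons (rcons M (absz a)) (absz n)) else 0.
Definition prev_coef i c M (a n : int) : {poly int} :=
  if [&& 1 <= a, i%:Z <= a & n == 0] then c (rcons M (absz a)) else 0.

Lemma take_enum_S (r : 'I_k) : take r.+1 (enum 'I_k) = rcons (take r (enum 'I_k)) r.
Proof. by rewrite (take_nth r) ?size_enum_ord ?nth_ord_enum. Qed.

Lemma gen_series_last e i c : gen_series k j.+3 i c e
  = if regular e then last_coef i c (init_exponents e) (e p) (e q) else 0.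
Proof.
have jk : (j.+3 <= k)%N by rewrite -qE ltn_ord.
rewrite gen_seriesE // -qE take_enum_S qE -pE take_enum_S pE !map_rcons last_rcons.
rewrite -/(init_exponents e) /last_coef.
have -> : [forall r : 'I_k, if (r < j.+3)%N then 1 <= e r else e r == 0]
    = [&& regular e, 1 <= e p & 1 <= e q].
  apply/forallP/and3P => [H|[/forallP H ep eq_] r].
    split; [|by have := H p; rewrite pE ltnS leqnSn|by have := H q; rewrite qE ltnS leqnn].
    apply/forallP => r; have := H r.
    by case: ltnP => rj er; apply/andP; split; apply/implyP => rj'; rewrite ?er //; lia.
  have /andP[/implyP H1 /implyP H2] := H r.
  case: ltnP => rj; last exact: H2.
  have [rp|rp] := eqVneq r p; first by rewrite rp.
  have [rq|rq] := eqVneq r q; first by rewrite rq.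
  apply: H1; move: rp rq; rewrite -!val_eqE /= pE qE; lia.
case: (regular e) => //=; rewrite -andbA.
congr (if _ then _ else _); congr (_ && _).
by case: (boolP (1 <= e q)) => //= eq1; lia.
Qed.

Lemma gen_series_prev e i c : gen_series k j.+2 i c e
  = if regular e then prev_coef i c (init_exponents e) (e p) (e q) else 0.
Proof.
have jk : (j.+2 <= k)%N by rewrite ltnW // -qE ltn_ord.
rewrite gen_seriesE // -pE take_enum_S pE !map_rcons last_rcons.
rewrite -/(init_exponents e) /prev_coef.
have -> : [forall r : 'I_k, if (r < j.+2)%N then 1 <= e r else e r == 0]
    = [&& regular e, 1 <= e p & e q == 0].
  apply/forallP/and3P => [H|[/forallP H ep eq_] r].
    split; [|by have := H p; rewrite pE ltnS leqnn|by have := H q; rewrite qE ltnn].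
    apply/forallP => r; have := H r.
    by case: ltnP => rj er; apply/andP; split; apply/implyP => rj'; rewrite ?er //; lia.
  have /andP[/implyP H1 /implyP H2] := H r.
  have [rp|rp] := eqVneq r p; first by rewrite rp pE ltnS leqnn.
  have [rq|rq] := eqVneq r q; first by rewrite rq qE ltnn.
  move: rp rq; rewrite -!val_eqE /= pE qE.
  by case: ltnP => rj rp rq; [apply: H1 | apply: H2]; lia.
case: (regular e) => //=; rewrite -andbA.
case: (boolP (1 <= e p)) => //= ep; rewrite andbC; congr (if _ && _ then _ else _); lia.
Qed.

Lemma regular_ext e e' : (forall r, r != p -> r != q -> e r = e' r) ->
  regular e = regular e' /\ init_exponents e = init_exponents e'.
Proof.
move=> ee; split.
  apply: eq_forallb => r; have [->|rp] := eqVneq r p.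
    by rewrite pE ltnn ltnNge leqnSn.
  have [->|rq] := eqVneq r q; first by rewrite qE ltnn ltnNge leqnSn.
  by rewrite ee.
apply/eq_in_map => r; rewrite mem_take_enum => rj; rewrite ee // -val_eqE /= ?pE ?qE; lia.
Qed.

End LastTwoVariables.

(** * Recurrences between coefficients, including the boundary cases *)

Section CoefficientRecurrences.
Variables (M : seq nat) (cL cE : seq nat -> {poly int}).
Local Notation m1 a := (rcons M a).
Local Notation m2 a n := (rcons (rcons M a) n).
Hypothesis E1 : forall a, (0 < a)%N -> cE (m2 a 1)
  = (1 + 4 * 'X) * cE (m1 a.+1) + 16 * 'X^2 * cE (m1 a) + 16 * 'X^2 * cL (m1 a.+1).
Hypothesis EE : forall a n, (0 < a)%N -> (0 < n)%N -> cE (m2 a n.+1)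
  = (1 + 4 * 'X) * cE (m2 a n)
    + 16 * 'X^2 * (if n == 1%N then cE (m1 a.+1) else cE (m2 a n.-1))
    + 16 * 'X^2 * cL (m2 a n).
Hypothesis L1 : forall a, (0 < a)%N -> cL (m2 a 1)
  = 16 * 'X^2 * cL (m1 a) + (1 + 2 * 'X) * cE (m1 a).
Hypothesis LL : forall a n, (0 < a)%N -> (0 < n)%N -> cL (m2 a n.+1)
  = (2 + 4 * 'X) * cL (m2 a n)
    + (if n == 1%N then 8 * 'X^2 * cE (m1 a) else 16 * 'X^2 * cL (m2 a n.-1)).

Lemma last_coef_neg i c a n : n <= 0 -> last_coef i c M a n = 0.
Proof. by move=> n0; rewrite /last_coef; case: and3P => // -[_ n1 _]; lia. Qed.

Lemma last_coef_nonpos i c a n : a <= 0 -> last_coef i c M a n = 0.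
Proof. by move=> n0; rewrite /last_coef; case: and3P => // -[]; lia. Qed.

Lemma prev_coef_nonpos i c a n : a <= 0 -> prev_coef i c M a n = 0.
Proof. by move=> n0; rewrite /prev_coef; case: and3P => // -[]; lia. Qed.

Lemma prev_coef_neq0 i c a n : n != 0 -> prev_coef i c M a n = 0.
Proof. by move=> n0; rewrite /prev_coef (negPf n0) !andbF. Qed.

Lemma last_coefE i c (a n : nat) : (0 < a)%N -> (i <= n.+1)%N ->
  last_coef i c M a n.+1 = c (m2 a n.+1).
Proof. by move=> a0 ni; rewrite /last_coef; case: and3P => // -[]; split; lia. Qed.

Lemma prev_coefE i c (a : nat) : (0 < a)%N -> (i <= a)%N -> prev_coef i c M a 0 = c (m1 a).
Proof. by move=> a0 ai; rewrite /prev_coef; case: and3P => // -[]; split; lia. Qed.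

Lemma last_coef_lt i c (a n : nat) : (n < i)%N -> last_coef i c M a n = 0.
Proof. by move=> ni; rewrite /last_coef; case: and3P => // -[]; lia. Qed.

Lemma coef_lambda1 a n :
  last_coef 1 cL M a n - (2 + 4 * 'X) * last_coef 1 cL M a (n - 1)
    - 16 * 'X^2 * last_coef 1 cL M a (n - 1 - 1)
  = 16 * 'X^2 * prev_coef 1 cL M a (n - 1) + (1 + 2 * 'X) * prev_coef 1 cE M a (n - 1)
    + 8 * 'X^2 * prev_coef 1 cE M a (n - 1 - 1).
Proof.
have [a0|] := lerP a 0.
  by rewrite !(last_coef_nonpos _ _ _ a0) !(prev_coef_nonpos _ _ _ a0) !mulr0 !subr0 !addr0.
case: a => [a|a] a0; last by lia.
have {}a0 : (0 < a)%N by lia.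
have [n0|] := lerP n 0.
  by rewrite !last_coef_neg ?prev_coef_neq0; try lia; rewrite !mulr0 !subr0 !addr0.
case: n => [[|[|[|n]]]|n] n0; try by lia.
- by rewrite last_coefE // !prev_coefE // [prev_coef _ _ _ _ (_ - 1 - 1)]prev_coef_neq0 //
    !last_coef_neg // L1 // !mulr0 !subr0 addr0.
- rewrite (_ : 2%Z - 1 = 1) // (_ : 1 - 1 = 0 :> int) // !last_coefE // prev_coefE //.
  by rewrite !prev_coef_neq0 // last_coef_neg // (LL a0 (ltn0Sn 0)) /=; ring.
rewrite (_ : n.+3%:Z - 1 = n.+2%:Z); last by lia.
rewrite (_ : n.+2%:Z - 1 = n.+1%:Z); last by lia.
by rewrite !prev_coef_neq0 // !last_coefE // (LL a0 (ltn0Sn n.+1)) /=; ring.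
Qed.

(** The two series differ in the terms with [n = 1], which [L1] evaluates. *)
Lemma coef_lambda2 a n :
  last_coef 2 cL M a n = last_coef 1 cL M a n
    - 16 * 'X^2 * prev_coef 1 cL M a (n - 1) - (1 + 2 * 'X) * prev_coef 1 cE M a (n - 1).
Proof.
have [a0|] := lerP a 0.
  by rewrite !(last_coef_nonpos _ _ _ a0) !(prev_coef_nonpos _ _ _ a0) !mulr0 !subr0.
case: a => [a|a] a0; last by lia.
have {}a0 : (0 < a)%N by lia.
have [n0|] := lerP n 0.
  by rewrite !last_coef_neg ?prev_coef_neq0; try lia; rewrite !mulr0 !subr0.
case: n => [[|[|n]]|n] n0; try by lia.
- rewrite (_ : 1%Z - 1 = 0) // last_coef_lt // last_coefE // !prev_coefE // L1 //; ring.
by rewrite !prev_coef_neq0; try lia; rewrite !last_coefE // !mulr0 !subr0.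
Qed.

(** The values at [a + 1] come from the division by the variable before the last. The series that
    start at exponent 2 are the right ones, as [a + 1 >= 2] means [a >= 1]. *)
Lemma coef_euler1 a n :
  last_coef 1 cE M a n - (1 + 4 * 'X) * last_coef 1 cE M a (n - 1)
    - 16 * 'X^2 * last_coef 1 cE M a (n - 1 - 1)
  = 16 * 'X^2 * last_coef 1 cL M a (n - 1) + 16 * 'X^2 * prev_coef 2 cL M (a + 1) (n - 1)
    + 16 * 'X^2 * prev_coef 1 cE M a (n - 1)
    + (1 + 4 * 'X) * prev_coef 2 cE M (a + 1) (n - 1)
    + 16 * 'X^2 * prev_coef 2 cE M (a + 1) (n - 1 - 1).
Proof.
have [a0|] := lerP a 0.
  rewrite !(last_coef_nonpos _ _ _ a0) !(prev_coef_nonpos _ _ _ a0).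
  have z c n' : prev_coef 2 c M (a + 1) n' = 0.
    by rewrite /prev_coef; case: and3P => // -[]; lia.
  by rewrite !z !mulr0 !subr0 !addr0.
case: a => [a|a] a0; last by lia.
have {}a0 : (0 < a)%N by lia.
have -> : a%:Z + 1 = a.+1%:Z by lia.
have [n0|] := lerP n 0.
  by rewrite !last_coef_neg ?prev_coef_neq0; try lia; rewrite !mulr0 !subr0 !addr0.
case: n => [[|[|[|n]]]|n] n0; try by lia.
- rewrite (_ : 1%Z - 1 = 0) // last_coefE // !prev_coefE //
    [prev_coef _ _ _ _ (_ - 1)]prev_coef_neq0 //.
  by rewrite !last_coef_neg // E1 //; ring.
- rewrite (_ : 2%Z - 1 = 1) // (_ : 1 - 1 = 0 :> int) // !last_coefE // prev_coefE //.
  by rewrite !prev_coef_neq0 // last_coef_neg // (EE a0 (ltn0Sn 0)) /=; ring.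
rewrite (_ : n.+3%:Z - 1 = n.+2%:Z); last by lia.
rewrite (_ : n.+2%:Z - 1 = n.+1%:Z); last by lia.
by rewrite !prev_coef_neq0 // !last_coefE // (EE a0 (ltn0Sn n.+1)) /=; ring.
Qed.

Lemma coef_euler2 a n :
  last_coef 2 cE M a n = last_coef 1 cE M a n
    - 16 * 'X^2 * prev_coef 2 cL M (a + 1) (n - 1) - 16 * 'X^2 * prev_coef 1 cE M a (n - 1)
    - (1 + 4 * 'X) * prev_coef 2 cE M (a + 1) (n - 1).
Proof.
have [a0|] := lerP a 0.
  rewrite !(last_coef_nonpos _ _ _ a0) !(prev_coef_nonpos _ _ _ a0).
  have z c n' : prev_coef 2 c M (a + 1) n' = 0.
    by rewrite /prev_coef; case: and3P => // -[]; lia.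
  by rewrite !z !mulr0 !subr0.
case: a => [a|a] a0; last by lia.
have {}a0 : (0 < a)%N by lia.
have -> : a%:Z + 1 = a.+1%:Z by lia.
have [n0|] := lerP n 0.
  by rewrite !last_coef_neg ?prev_coef_neq0; try lia; rewrite !mulr0 !subr0.
case: n => [[|[|n]]|n] n0; try by lia.
- rewrite (_ : 1%Z - 1 = 0) // last_coef_lt // last_coefE // !prev_coefE // E1 //; ring.
by rewrite !prev_coef_neq0; try lia; rewrite !last_coefE // !mulr0 !subr0.
Qed.

End CoefficientRecurrences.

Lemma lcoef_constM (R : comNzRingType) k c (f : lseries R k) e :
  (lconst k c * f) e = c * f e.
Proof. by rewrite /lconst lcoef_monomM subr0. Qed.

Lemma lcoef_varM (R : comNzRingType) k j (f : lseries R k) e :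
  (lvar R k j * f) e = f (e - [ffun i : 'I_k => (i.+1 == j)%:Z]).
Proof. by rewrite /lvar lcoef_monomM mul1r. Qed.

Lemma lcoef_varVM (R : comNzRingType) k j (f : lseries R k) e :
  ((lvar R k j)^-1 * f) e = f (e + [ffun i : 'I_k => (i.+1 == j)%:Z]).
Proof. by rewrite lvar_inv lcoef_monomM mul1r opprK. Qed.

(** * From coefficient identities to equations between series *)

Section ShiftEquations.
Variables (R : comNzRingType) (k i j : nat).
Implicit Types (F L G H J : lseries R k) (e : expo k) (c d : R).
Local Notation K := (lconst k).
Local Notation t := (lvar R k j).
Local Notation s := (lvar R k i).
Local Notation dt := ([ffun r : 'I_k => (r.+1 == j)%:Z] : expo k).
Local Notation ds := ([ffun r : 'I_k => (r.+1 == i)%:Z] : expo k).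

Lemma lcoefK1 c F e : (K c * (t * F)) e = c * F (e - dt).
Proof. by rewrite lcoef_constM lcoef_varM. Qed.

Lemma lcoefK2 c F e : (K c * (t * (t * F))) e = c * F (e - dt - dt).
Proof. by rewrite lcoef_constM !lcoef_varM. Qed.

Lemma lcoefVK1 c F e : (K c * (s^-1 * (t * F))) e = c * F (e + ds - dt).
Proof. by rewrite lcoef_constM lcoef_varVM lcoef_varM. Qed.

Lemma lcoefVK2 c F e : (K c * (s^-1 * (t * (t * F)))) e = c * F (e + ds - dt - dt).
Proof. by rewrite lcoef_constM lcoef_varVM !lcoef_varM. Qed.

Lemma shift_eq_lambda1 F G H c1 c2 c3 c4 c5 :
  (forall e, F e - c1 * F (e - dt) - c2 * F (e - dt - dt)
     = c3 * G (e - dt) + c4 * H (e - dt) + c5 * H (e - dt - dt)) ->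
  F - K c1 * (t * F) - K c2 * (t * (t * F))
  = K c3 * (t * G) + K c4 * (t * H) + K c5 * (t * (t * H)).
Proof.
move=> E; apply: lcoefP => e; have := E e.
by rewrite -(lcoefK1 c1 F e) -(lcoefK2 c2 F e) -(lcoefK1 c3 G e) -(lcoefK1 c4 H e)
  -(lcoefK2 c5 H e).
Qed.

Lemma shift_eq_lambda2 F F' G H c1 c2 :
  (forall e, F e = F' e - c1 * G (e - dt) - c2 * H (e - dt)) ->
  F = F' - K c1 * (t * G) - K c2 * (t * H).
Proof.
move=> E; apply: lcoefP => e; have := E e.
by rewrite -(lcoefK1 c1 G e) -(lcoefK1 c2 H e).
Qed.

Lemma shift_eq_euler1 F L G H J c1 c2 c3 c4 c5 c6 c7 :
  (forall e, F e - c1 * F (e - dt) - c2 * F (e - dt - dt)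
     = c3 * L (e - dt) + c4 * G (e + ds - dt) + c5 * H (e - dt)
       + c6 * J (e + ds - dt) + c7 * J (e + ds - dt - dt)) ->
  F - K c1 * (t * F) - K c2 * (t * (t * F))
  = K c3 * (t * L) + K c4 * (s^-1 * (t * G)) + K c5 * (t * H)
    + K c6 * (s^-1 * (t * J)) + K c7 * (s^-1 * (t * (t * J))).
Proof.
move=> E; apply: lcoefP => e; have := E e.
by rewrite -(lcoefK1 c1 F e) -(lcoefK2 c2 F e) -(lcoefK1 c3 L e) -(lcoefVK1 c4 G e)
  -(lcoefK1 c5 H e) -(lcoefVK1 c6 J e) -(lcoefVK2 c7 J e).
Qed.

Lemma shift_eq_euler2 F F' G H J c1 c2 c3 :
  (forall e, F e = F' e - c1 * G (e + ds - dt) - c2 * H (e - dt)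
     - c3 * J (e + ds - dt)) ->
  F = F' - K c1 * (s^-1 * (t * G)) - K c2 * (t * H) - K c3 * (s^-1 * (t * J)).
Proof.
move=> E; apply: lcoefP => e; have := E e.
by rewrite -(lcoefVK1 c1 G e) -(lcoefK1 c2 H e) -(lcoefVK1 c3 J e).
Qed.

End ShiftEquations.

(** * Solving the linear equations *)

Section SolveEquations.
Variables (R : comUnitRingType) (z t s D D' L1 L2 E1 E2 l1 l2 e1 e2 : R).
Hypotheses (D_unit : D \is a GRing.unit) (D'_unit : D' \is a GRing.unit).
Hypothesis DE : D = 1 - 2 * t - 4 * z * t - 16 * z ^+ 2 * t ^+ 2.
Hypothesis D'E : D' = 1 - t - 4 * z * t - 16 * z ^+ 2 * t ^+ 2.

Lemma solve_lambda1 :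
  L1 - (2 + 4 * z) * (t * L1) - 16 * z ^+ 2 * (t * (t * L1))
    = 16 * z ^+ 2 * (t * l1) + (1 + 2 * z) * (t * e1) + 8 * z ^+ 2 * (t * (t * e1)) ->
  L1 = 16 * z ^+ 2 * t / D * l1
       + (t * (1 + 2 * z) + 8 * z ^+ 2 * t ^+ 2) / D * e1.
Proof.
move=> eqL; apply: (mulrI D_unit); have := mulrV D_unit; move: (D^-1) => V DV.
transitivity (D * V * (16 * z ^+ 2 * (t * l1)
  + (1 + 2 * z) * (t * e1) + 8 * z ^+ 2 * (t * (t * e1)))); last by ring.
by rewrite DV mul1r -eqL DE; ring.
Qed.

Lemma solve_euler1 :
  E1 - (1 + 4 * z) * (t * E1) - 16 * z ^+ 2 * (t * (t * E1))
    = 16 * z ^+ 2 * (t * L1) + 16 * z ^+ 2 * (s * (t * l2)) + 16 * z ^+ 2 * (t * e1)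
      + (1 + 4 * z) * (s * (t * e2)) + 16 * z ^+ 2 * (s * (t * (t * e2))) ->
  E1 = 16 * z ^+ 2 * t * L1 / D' + 16 * z ^+ 2 * s * t / D' * l2
       + 16 * z ^+ 2 * t / D' * e1
       + ((1 + 4 * z) * s * t + 16 * z ^+ 2 * s * t ^+ 2) / D' * e2.
Proof.
move=> eqE; apply: (mulrI D'_unit); have := mulrV D'_unit; move: (D'^-1) => V DV.
transitivity (D' * V * (16 * z ^+ 2 * (t * L1) + 16 * z ^+ 2 * (s * (t * l2))
  + 16 * z ^+ 2 * (t * e1) + (1 + 4 * z) * (s * (t * e2))
  + 16 * z ^+ 2 * (s * (t * (t * e2))))); last by ring.
by rewrite DV mul1r -eqE D'E; ring.
Qed.

(** The third row results from substituting the solution for [L1] into the equation for [E1]. The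
    zero terms reproduce the expansion of the product with a column of length 4. *)
Lemma solve_rows (A11 := 16 * z ^+ 2 * t / D)
    (A13 := (t * (1 + 2 * z) + 8 * z ^+ 2 * t ^+ 2) / D)
    (A31 := 16 * z ^+ 2 * t * A11 / D') (A32 := 16 * z ^+ 2 * s * t / D')
    (A33 := (16 * z ^+ 2 * t + 16 * z ^+ 2 * t * A13) / D')
    (A34 := ((1 + 4 * z) * s * t + 16 * z ^+ 2 * s * t ^+ 2) / D') :
  L1 - (2 + 4 * z) * (t * L1) - 16 * z ^+ 2 * (t * (t * L1))
    = 16 * z ^+ 2 * (t * l1) + (1 + 2 * z) * (t * e1) + 8 * z ^+ 2 * (t * (t * e1)) ->
  L2 = L1 - 16 * z ^+ 2 * (t * l1) - (1 + 2 * z) * (t * e1) ->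
  E1 - (1 + 4 * z) * (t * E1) - 16 * z ^+ 2 * (t * (t * E1))
    = 16 * z ^+ 2 * (t * L1) + 16 * z ^+ 2 * (s * (t * l2)) + 16 * z ^+ 2 * (t * e1)
      + (1 + 4 * z) * (s * (t * e2)) + 16 * z ^+ 2 * (s * (t * (t * e2))) ->
  E2 = E1 - 16 * z ^+ 2 * (s * (t * l2)) - 16 * z ^+ 2 * (t * e1)
       - (1 + 4 * z) * (s * (t * e2)) ->
  [/\ L1 = A11 * l1 + (0 * l2 + (A13 * e1 + (0 * e2 + 0))),
      L2 = (A11 - 16 * z ^+ 2 * t) * l1
           + (0 * l2 + ((A13 - t * (1 + 2 * z)) * e1 + (0 * e2 + 0))),
      E1 = A31 * l1 + (A32 * l2 + (A33 * e1 + (A34 * e2 + 0)))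
    & E2 = A31 * l1 + ((A32 - 16 * z ^+ 2 * s * t) * l2
           + ((A33 - 16 * z ^+ 2 * t) * e1
           + ((A34 - (1 + 4 * z) * s * t) * e2 + 0)))].
Proof.
move=> /solve_lambda1 L1E L2E /solve_euler1 E1E E2E.
have {}E1E : E1 = A31 * l1 + (A32 * l2 + (A33 * e1 + (A34 * e2 + 0))).
  rewrite E1E L1E /A31 /A32 /A33 /A34 /A11 /A13.
  by move: (D^-1) (D'^-1) => V V'; ring.
split=> //.
- by rewrite L1E -/A11 -/A13; ring.
- by rewrite L2E L1E -/A11 -/A13; ring.
by rewrite E2E E1E; ring.
Qed.

End SolveEquations.

(** * The transfer matrix for one more block *)

Section LastBlock.
Variables (k : nat) (T : forall m : seq nat, {set {set halin_vertex m}}).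
Hypothesis T_tree : forall m : seq nat, (2 <= size m)%N -> all (leq 1) m ->
  spanning_tree (@halin_adj m) (T m).
Variable j : nat.
Hypothesis jk : (j.+3 <= k)%N.

Let p : 'I_k := Ordinal (ltnW jk).
Let q : 'I_k := Ordinal jk.

Let cL (m : seq nat) : {poly int} := 2 ^+ last 0%N m * lambda_poly m.
Let cE (m : seq nat) := euler_genus_poly (@halin_adj m) (T m).
Let K (c : {poly int}) : lseries {poly int} k := lconst k c.
Let t := lvar {poly int} k j.+3.
Let s := lvar {poly int} k j.+2.
Let z : lseries {poly int} k := lconst k 'X.
Let f2 i c := gen_series k j.+3 i c.
Let f1 i c := gen_series k j.+2 i c.
Let dp : expo k := [ffun i : 'I_k => (i.+1 == j.+2)%:Z].
Let dq : expo k := [ffun i : 'I_k => (i.+1 == j.+3)%:Z].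

Let f2E i c (e e' : expo k) : (forall r, r != p -> r != q -> e' r = e r) ->
  f2 i c e' = if regular j e then last_coef i c (init_exponents j e) (e' p) (e' q) else 0.
Proof.
move=> ee; have [E1 E2] := @regular_ext k j p q erefl erefl e' e ee.
by rewrite /f2 (@gen_series_last k j p q) // E1 E2.
Qed.

Let f1E i c (e e' : expo k) : (forall r, r != p -> r != q -> e' r = e r) ->
  f1 i c e' = if regular j e then prev_coef i c (init_exponents j e) (e' p) (e' q) else 0.
Proof.
move=> ee; have [E1 E2] := @regular_ext k j p q erefl erefl e' e ee.
by rewrite /f1 (@gen_series_prev k j p q) // E1 E2.
Qed.

Let shiftE (e : expo k) r : [/\ (e - dq) r = (e r : int) - (r == q)%:Z,
  (e - dq - dq) r = (e r : int) - (r == q)%:Z - (r == q)%:Z,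
  (e + dp - dq) r = (e r : int) + (r == p)%:Z - (r == q)%:Z &
  (e + dp - dq - dq) r = (e r : int) + (r == p)%:Z - (r == q)%:Z - (r == q)%:Z].
Proof. by rewrite !ffunE -!val_eqE /= !eqSS. Qed.

Let shift_off (e : expo k) r : r != p -> r != q ->
  [/\ (e - dq) r = e r, (e - dq - dq) r = e r, (e + dp - dq) r = e r &
      (e + dp - dq - dq) r = e r].
Proof.
move=> rp rq; have [-> -> -> ->] := shiftE e r.
by rewrite (negPf rp) (negPf rq) ?subr0 ?addr0 ?subr0.
Qed.

Let pq : (p == q) = false.
Proof. by rewrite -val_eqE /= eqn_leq ltnn andbF. Qed.

Let f2_values i c (e : expo k) :
  let F x y := if regular j e then last_coef i c (init_exponents j e) x y else 0 in
  [/\ f2 i c e = F (e p) (e q), f2 i c (e - dq) = F (e p) (e q - 1)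
    & f2 i c (e - dq - dq) = F (e p) (e q - 1 - 1)].
Proof.
have [p1 p2 _ _] := shiftE e p; have [q1 q2 _ _] := shiftE e q.
rewrite (@f2E i c e e) // (@f2E i c e (e - dq)) => [|r rp rq]; last first.
  by have [-> _ _ _] := shift_off e rp rq.
rewrite (@f2E i c e (e - dq - dq)) => [|r rp rq]; last first.
  by have [_ -> _ _] := shift_off e rp rq.
by rewrite p1 p2 q1 q2 pq eqxx !subr0.
Qed.

Let f1_values i c (e : expo k) :
  let F x y := if regular j e then prev_coef i c (init_exponents j e) x y else 0 in
  [/\ f1 i c (e - dq) = F (e p) (e q - 1),
      f1 i c (e - dq - dq) = F (e p) (e q - 1 - 1),
      f1 i c (e + dp - dq) = F (e p + 1) (e q - 1)
    & f1 i c (e + dp - dq - dq) = F (e p + 1) (e q - 1 - 1)].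
Proof.
have [p1 p2 p3 p4] := shiftE e p; have [q1 q2 q3 q4] := shiftE e q.
rewrite (@f1E i c e (e - dq)) => [|r rp rq]; last first.
  by have [-> _ _ _] := shift_off e rp rq.
rewrite (@f1E i c e (e - dq - dq)) => [|r rp rq]; last first.
  by have [_ -> _ _] := shift_off e rp rq.
rewrite (@f1E i c e (e + dp - dq)) => [|r rp rq]; last first.
  by have [_ _ -> _] := shift_off e rp rq.
rewrite (@f1E i c e (e + dp - dq - dq)) => [|r rp rq]; last first.
  by have [_ _ _ ->] := shift_off e rp rq.
by rewrite p1 p2 p3 p4 q1 q2 q3 q4 pq [q == p]eq_sym pq !eqxx ?subr0 ?addr0.
Qed.

Let prefix_recs (e : expo k) (M := init_exponents j e) : regular j e ->
  [/\ forall a, (0 < a)%N -> cE (rcons (rcons M a) 1)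
        = (1 + 4 * 'X) * cE (rcons M a.+1) + 16 * 'X^2 * cE (rcons M a)
          + 16 * 'X^2 * cL (rcons M a.+1),
      forall a n, (0 < a)%N -> (0 < n)%N -> cE (rcons (rcons M a) n.+1)
        = (1 + 4 * 'X) * cE (rcons (rcons M a) n)
          + 16 * 'X^2 * (if n == 1%N then cE (rcons M a.+1)
                         else cE (rcons (rcons M a) n.-1))
          + 16 * 'X^2 * cL (rcons (rcons M a) n),
      forall a, (0 < a)%N -> cL (rcons (rcons M a) 1)
        = 16 * 'X^2 * cL (rcons M a) + (1 + 2 * 'X) * cE (rcons M a)
    & forall a n, (0 < a)%N -> (0 < n)%N -> cL (rcons (rcons M a) n.+1)
        = (2 + 4 * 'X) * cL (rcons (rcons M a) n)
          + (if n == 1%N then 8 * 'X^2 * cE (rcons M a)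
             else 16 * 'X^2 * cL (rcons (rcons M a) n.-1))].
Proof.
move=> /forallP reg; have sM : size M = j.+1.
  by rewrite size_map size_take size_enum_ord; case: ltngtP jk => //; lia.
have M0 : all (leq 1) M.
  apply/allP => x /mapP[r]; rewrite mem_take_enum => rj ->.
  by have /andP[/implyP/(_ rj) + _] := reg r; lia.
have M1 : (1 <= size M)%N by rewrite sM.
pose delta m := full_strip_poly (is_start m) (strip_size m).
have cE1 a : (0 < a)%N -> cE (rcons M a) = 2 * delta (rcons M a).
  have hs : (2 <= size (rcons M a))%N by rewrite size_rcons sM.
  move=> a0; have h0 : all (leq 1) (rcons M a) by rewrite all_rcons a0.
  exact: euler_genus_polyE (T_tree hs h0).
have cE2 a n : (0 < a)%N -> (0 < n)%N ->
    cE (rcons (rcons M a) n) = 2 * delta (rcons (rcons M a) n).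
  have hs : (2 <= size (rcons (rcons M a) n))%N by rewrite !size_rcons sM.
  move=> a0 n0; have h0 : all (leq 1) (rcons (rcons M a) n).
    by rewrite !all_rcons a0 n0.
  exact: euler_genus_polyE (T_tree hs h0).
have cLE l n : cL (rcons l n) = 2 ^+ n * lambda_poly (rcons l n).
  by rewrite /cL last_rcons.
split=> [a a0|a n a0 n0|a a0|a n a0 n0].
- by rewrite cE2 // !cE1 // cLE /delta (delta_rec1 M1 M0 a0); ring.
- rewrite (cE2 a n.+1) // (cE2 a n) // cE1 // cLE /delta (delta_rec M1 M0 a0 n0).
  case: (eqVneq n 1%N) => n1; first by ring.
  by rewrite cE2 //; [rewrite /delta; ring | lia].
- by rewrite !cLE cE1 // expr1 (lambda_rec1 M1 M0 a0).
rewrite !cLE cE1 // (lambda_rec M1 M0 a0 n0) /delta.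
by case: (eqVneq n 1%N).
Qed.

Let lambda1_eq : f2 1 cL - K (2 + 4 * 'X) * (t * f2 1 cL)
    - K (16 * 'X^2) * (t * (t * f2 1 cL))
  = K (16 * 'X^2) * (t * f1 1 cL) + K (1 + 2 * 'X) * (t * f1 1 cE)
    + K (8 * 'X^2) * (t * (t * f1 1 cE)).
Proof.
apply: shift_eq_lambda1 => e; rewrite -/dq.
have [-> -> ->] := f2_values 1 cL e; have [-> _ _ _] := f1_values 1 cL e.
have [-> -> _ _] := f1_values 1 cE e.
case: ifP => [/prefix_recs[E1 EE L1 LL]|_]; last by rewrite !mulr0 !subr0 !addr0.
exact: coef_lambda1.
Qed.

Let lambda2_eq : f2 2 cL
  = f2 1 cL - K (16 * 'X^2) * (t * f1 1 cL) - K (1 + 2 * 'X) * (t * f1 1 cE).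
Proof.
apply: shift_eq_lambda2 => e; rewrite -/dq.
have [-> _ _] := f2_values 1 cL e; have [-> _ _] := f2_values 2 cL e.
have [-> _ _ _] := f1_values 1 cL e; have [-> _ _ _] := f1_values 1 cE e.
case: ifP => [/prefix_recs[E1 EE L1 LL]|_]; last by rewrite !mulr0 !subr0.
exact: coef_lambda2.
Qed.

Let euler1_eq : f2 1 cE - K (1 + 4 * 'X) * (t * f2 1 cE)
    - K (16 * 'X^2) * (t * (t * f2 1 cE))
  = K (16 * 'X^2) * (t * f2 1 cL) + K (16 * 'X^2) * (s^-1 * (t * f1 2 cL))
    + K (16 * 'X^2) * (t * f1 1 cE) + K (1 + 4 * 'X) * (s^-1 * (t * f1 2 cE))
    + K (16 * 'X^2) * (s^-1 * (t * (t * f1 2 cE))).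
Proof.
apply: shift_eq_euler1 => e; rewrite -/dq -/dp.
have [-> -> ->] := f2_values 1 cE e; have [_ -> _] := f2_values 1 cL e.
have [_ _ -> _] := f1_values 2 cL e; have [-> _ _ _] := f1_values 1 cE e.
have [_ _ -> ->] := f1_values 2 cE e.
case: ifP => [/prefix_recs[E1 EE L1 LL]|_]; last by rewrite !mulr0 !subr0 !addr0.
exact: coef_euler1.
Qed.

Let euler2_eq : f2 2 cE
  = f2 1 cE - K (16 * 'X^2) * (s^-1 * (t * f1 2 cL)) - K (16 * 'X^2) * (t * f1 1 cE)
    - K (1 + 4 * 'X) * (s^-1 * (t * f1 2 cE)).
Proof.
apply: shift_eq_euler2 => e; rewrite -/dq -/dp.
have [-> _ _] := f2_values 1 cE e; have [-> _ _] := f2_values 2 cE e.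
have [_ _ -> _] := f1_values 2 cL e; have [-> _ _ _] := f1_values 1 cE e.
have [_ _ -> _] := f1_values 2 cE e.
case: ifP => [/prefix_recs[E1 EE L1 LL]|_]; last by rewrite !mulr0 !subr0.
exact: coef_euler2.
Qed.

Let constE (a b : nat) : K (a%:R + b%:R * 'X) = a%:R + b%:R * z.
Proof. by rewrite /K rmorphD rmorphM !rmorph_nat. Qed.

Let const2E (b : nat) : K (b%:R * 'X^2) = b%:R * z ^+ 2.
Proof. by rewrite /K rmorphM rmorph_nat rmorphXn. Qed.

Lemma series_col_step :
  series_col k T j.+3 = transfer_mx k j.+2 j.+3 *m series_col k T j.+2.
Proof.
have jk' : (0 < j.+3 <= k)%N by rewrite jk.
have row1 := lambda1_eq.
rewrite (constE 2 4) (constE 1 2) (const2E 16) (const2E 8) in row1.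
have row2 := lambda2_eq; rewrite (constE 1 2) (const2E 16) in row2.
have row3 := euler1_eq; rewrite (constE 1 4) (const2E 16) in row3.
have row4 := euler2_eq; rewrite (constE 1 4) (const2E 16) in row4.
have [R1 R2 R3 R4] := solve_rows (transfer_D_unit jk') (transfer_D'_unit jk')
  erefl erefl row1 row2 row3 row4.
apply/matrixP => r c; rewrite [c]ord1 {c} !mxE !big_ord_recl big_ord0 !mxE.
by case: r => -[|[|[|[|//]]]] r4.
Qed.

End LastBlock.

Theorem theorem4p13 (k : nat) (hk : (3 <= k)%N)
    (T : forall m : seq nat, {set {set halin_vertex m}})
    (hT : forall m : seq nat, (2 <= size m)%N -> all (leq 1) m ->
            spanning_tree (@halin_adj m) (T m)) :
  series_col k T k = transfer_mx k k.-1 k *m series_col k T k.-1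
  /\
  series_col k T k =
    (\prod_(0 <= i < k - 2) transfer_mx k (k - i).-1 (k - i)) *m
      series_col k T 2.
Proof.
have step q : (3 <= q <= k)%N ->
    series_col k T q = transfer_mx k q.-1 q *m series_col k T q.-1.
  by case: q => [|[|[|j]]] // jk; apply: series_col_step.
split; first by apply: step; rewrite hk leqnn.
(* Induction on the number [r] of blocks removed from the end; each removal appends its matrix on
   the right of the product. *)
suff prod_step r : (r <= k - 2)%N -> series_col k T k =
    (\prod_(0 <= i < r) transfer_mx k (k - i).-1 (k - i)) *m series_col k T (k - r).
  by rewrite {1}(prod_step _ (leqnn _)) subKn // ltnW.
elim: r => [_|r IHr hr]; first by rewrite big_geq // mul1mx subn0.
rewrite big_nat_recr //= IHr 1?ltnW // [X in _ *m X]step; last lia.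
by rewrite mulmxA subnS.
Qed.
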